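(* Let $n\ge1$. For $A\in\mathbb{C}^{n\times n}$ let $f_A(Q)=\|\mathcal{N}(Q^*AQ)\|_F^2$, viewed as a function of $[Q]\in\mathcal{F}_n=U(n)/U(1)^n$. There exists a set $\mathcal{J}\subset\mathbb{C}^{n\times n}$ of Lebesgue measure zero such that, for every $A\in\mathbb{C}^{n\times n}\setminus\mathcal{J}$, the function $f_A$ has finitely many local minimizers on $\mathcal{F}_n$. Moreover, for every $A\notin\mathcal{J}$ and for every local minimizer $[Q]\in\mathcal{F}_n$ of $f_A$, the diagonal entries of $Q^*AQ$ are pairwise distinct and the Riemannian Hessian of $f_A$ on $\mathcal{F}_n$ at $[Q]$ is positive definite.
   Context: $U(n)$ is the group of $n\times n$ unitary matrices, a Riemannian submanifold of $\mathbb{C}^{n\times n}\cong\mathbb{R}^{2n^2}$ with the real inner product $\langle X,Y\rangle=\mathrm{Re}\,\mathrm{trace}(Y^*X)$; $\|X\|_F^2=\langle X,X\rangle$. $\mathrm{diag}(X)$ denotes the diagonal matrix whose diagonal entries coincide with those of $X$, and $\mathcal{N}(X):=X-\mathrm{diag}(X)$. The flag manifold $\mathcal{F}_n:=U(n)/U(1)^n$ is the quotient of $U(n)$ by right multiplication by diagonal unitary matrices, with the Riemannian quotient metric; $[Q]$ is the class of $Q$, and the tangent space at $[Q]$ is identified with the horizontal space $\{Q\Omega:\Omega=-\Omega^*,\ \mathrm{diag}(\Omega)=0\}$. The function $f_A$ is constant on the classes, hence is a smooth function on $\mathcal{F}_n$. Lebesgue measure is on $\mathbb{C}^{n\times n}\cong\mathbb{R}^{2n^2}$.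 *)

(* Defs.v *)
From HB Require Import structures.
From mathcomp Require Import all_boot all_order all_algebra.
From mathcomp Require Import spectral complex.
From mathcomp Require Import all_classical all_reals all_analysis.

Set Implicit Arguments.
Unset Strict Implicit.
Unset Printing Implicit Defensive.

Import Order.TTheory GRing.Theory Num.Theory.
Import numFieldNormedType.Exports.

Local Open Scope classical_set_scope.
Local Open Scope ring_scope.
Local Open Scope complex_scope.
Local Open Scope sesquilinear_scope.
Local Open Scope quotient_scope.

(* The type [R[i]] itself carries no topology in the library; seen as a
   numClosedFieldType it gets the topology of its norm, hence matrices over it
   get the usual topology. *)
Definition Cplx (R : realType) : numClosedFieldType := R[i].

Definition re {R : realType} (z : Cplx R) : R := complex.Re (z : R[i]).
Definition im {R : realType} (z : Cplx R) : R := complex.Im (z : R[i]).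
Definition mkC {R : realType} (x y : R) : Cplx R := (x +i* y : R[i]).

Section Euclidean.
Context {R : realType} {n : nat}.
Local Notation M := 'M[Cplx R]_n.
Implicit Types (X Y Z A Q : M).

Definition rinner X Y : R := re (\tr (Y^t* *m X)).

Definition offdiag X : M := X - diag_mx (\row_i X i i).

Definition fA A Q : R :=
  rinner (offdiag (Q^t* *m A *m Q)) (offdiag (Q^t* *m A *m Q)).

(* Lebesgue outer measure on C^(n x n), identified with R^(2 n^2) through the
   real and imaginary parts of the entries. *)
Definition box (lo hi : M) : set M :=
  [set X | forall i j,
    re (lo i j) <= re (X i j) <= re (hi i j) /\
    im (lo i j) <= im (X i j) <= im (hi i j)].

Definition box_volume (lo hi : M) : R :=
  \prod_i \prod_j
    (Num.max 0 (re (hi i j) - re (lo i j)) *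
     Num.max 0 (im (hi i j) - im (lo i j))).

Definition lebesgue_outer (E : set M) : \bar R :=
  ereal_inf [set v | exists lo hi : nat -> M,
    E `<=` \bigcup_k box (lo k) (hi k) /\
    v = (\sum_(0 <= k <oo) (box_volume (lo k) (hi k))%:E)%E].

Definition lebesgue_null (E : set M) : Prop := lebesgue_outer E = 0%E.

(* Differentiation in the real vector space C^(n x n), along real lines. *)
Definition velocity (c : R -> M) : M :=
  \matrix_(i, j) mkC (derive1 (fun t => re (c t i j)) 0)
                     (derive1 (fun t => im (c t i j)) 0).

Definition dirD (F : M -> M) X Z : M :=
  velocity (fun t => F (X + mkC t 0 *: Z)).

(* The gradient for [rinner]: its (i, j) entry collects the partial
   derivatives in the real directions E_ij and 'i E_ij. *)
Definition egrad (f : M -> R) X : M :=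
  \matrix_(i, j)
    mkC (derive1 (fun t => f (X + mkC t 0 *: delta_mx i j)) 0)
        (derive1 (fun t => f (X + mkC 0 t *: delta_mx i j)) 0).

End Euclidean.

Section EuclideanTheory.
Context {R : realType} {n : nat}.
Local Notation M := 'M[Cplx R]_n.
Implicit Types (X Y Z D : M).

Lemma reD (z w : Cplx R) : re (z + w) = re z + re w.
Proof. by case: z w => [a b] [c d]. Qed.

Lemma reN (z : Cplx R) : re (- z) = - re z.
Proof. by case: z. Qed.

Lemma re_conj (z : Cplx R) : re (Num.conj z) = re z.
Proof. by case: z. Qed.

Lemma adjM X Y : (X *m Y)^t* = Y^t* *m X^t*.
Proof. by rewrite trmx_mul map_mxM. Qed.

Lemma adjB X Y : (X - Y)^t* = X^t* - Y^t*.
Proof. by apply/matrixP => i j; rewrite !mxE rmorphB. Qed.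

Lemma rinnerDl X Y Z : rinner (X + Y) Z = rinner X Z + rinner Y Z.
Proof. by rewrite /rinner mulmxDr raddfD reD. Qed.

Lemma rinnerNl X Z : rinner (- X) Z = - rinner X Z.
Proof. by rewrite /rinner mulmxN raddfN reN. Qed.

Lemma rinnerNr X Z : rinner X (- Z) = - rinner X Z.
Proof. by rewrite /rinner raddfN map_mxN mulNmx raddfN reN. Qed.

Lemma rinner_adj X Y : rinner (X^t*) (Y^t*) = rinner X Y.
Proof.
rewrite /rinner trmxCK mxtrace_mulC.
rewrite -[RHS]re_conj; congr re.
by rewrite -[in RHS]mxtrace_tr -trace_map_mx adjM trmxCK.
Qed.

Lemma rinner_mull X Y Z : rinner X (Y *m Z) = rinner (Y^t* *m X) Z.
Proof. by rewrite /rinner adjM mulmxA. Qed.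

Lemma rinner_herm_skew X Y : X^t* = X -> Y^t* = - Y -> rinner X Y = 0.
Proof.
move=> hX hY; apply/eqP; rewrite -eqNr -rinnerNr -hY -{1}hX rinner_adj.
exact: eqxx.
Qed.

End EuclideanTheory.

Section FlagManifold.
Context {R : realType} {n : nat}.
Local Notation M := 'M[Cplx R]_n.

Definition unitary_group : Type := set_type [set Q : M | Q \is unitarymx].

Implicit Types (P Q S : unitary_group) (f : M -> R).

Definition mx_of Q : M := \val Q.

Lemma mx_ofP Q : mx_of Q \is unitarymx.
Proof. exact: set_mem (valP Q). Qed.

Lemma mx_of_KV Q : (mx_of Q)^t* *m mx_of Q = 1%:M.
Proof. by apply: mulmx1C; apply/unitarymxP; exact: mx_ofP. Qed.

Definition flag_rel P Q : bool :=
  `[< exists2 D : M, D \is unitarymx /\ is_diag_mx D &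
      mx_of Q = mx_of P *m D >].

Lemma flag_rel_refl : reflexive flag_rel.
Proof.
move=> P; apply/asboolP; exists 1%:M; last by rewrite mulmx1.
split; last exact: scalar_mx_is_diag.
by apply/unitarymxP; rewrite trmx1 map_mx1 mulmx1.
Qed.

Lemma is_diag_mx_adj (D : M) : is_diag_mx D -> is_diag_mx (D^t*).
Proof.
move=> /is_diag_mxP dD; apply/is_diag_mxP => i j ij.
by rewrite !mxE dD ?conjC0// eq_sym.
Qed.

Lemma is_diag_mx_mul (D E : M) :
  is_diag_mx D -> is_diag_mx E -> is_diag_mx (D *m E).
Proof.
by move=> /diag_mxP[d ->] /diag_mxP[e ->]; rewrite mulmx_diag diag_mx_is_diag.
Qed.

Lemma flag_rel_sym : symmetric flag_rel.
Proof.
suff H P Q : flag_rel P Q -> flag_rel Q P.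
  by move=> P Q; apply/idP/idP; exact: H.
move=> /asboolP[D [uD dD] e]; apply/asboolP; exists (D^t*).
  by split; [rewrite trmxC_unitary|exact: is_diag_mx_adj].
by rewrite e -mulmxA (unitarymxP uD) mulmx1.
Qed.

Lemma flag_rel_trans : transitive flag_rel.
Proof.
move=> Q P S /asboolP[D [uD dD] e] /asboolP[E [uE dE] e'].
apply/asboolP; exists (D *m E); last by rewrite e' e mulmxA.
by split; [exact: mul_unitarymx|exact: is_diag_mx_mul].
Qed.

Canonical flag_equiv :=
  EquivRel flag_rel flag_rel_refl flag_rel_sym flag_rel_trans.

Definition flag : Type := quotient_topology {eq_quot flag_equiv}.

Definition flag_class Q : flag := \pi_flag Q.

Definition flag_fun f (x : flag) : R := f (mx_of (repr x)).

Lemma fA_diag (A Q D : M) : D \is unitarymx -> is_diag_mx D ->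
  fA A (Q *m D) = fA A Q.
Proof.
move=> uD /diag_mxP[d eD]; rewrite /fA adjM !mulmxA.
have -> : D^t* *m Q^t* *m A *m Q *m D = D^t* *m (Q^t* *m A *m Q) *m D.
  by rewrite !mulmxA.
move: (Q^t* *m A *m Q) => B.
have offD : offdiag (D^t* *m B *m D) = D^t* *m offdiag B *m D.
  rewrite /offdiag mulmxBr mulmxBl; congr (_ - _).
  have -> : D^t* = diag_mx (map_mx Num.conj d).
    rewrite eD; apply/matrixP => i j; rewrite !mxE eq_sym.
    by case: eqP => [->|_]; rewrite ?mulr1n ?mulr0n ?conjC0.
  rewrite eD; apply/matrixP => i j.
  rewrite !mul_mx_diag !mul_diag_mx !mxE.
  case: eqP => [->|_]; rewrite ?mulr1n ?mulr0n ?mulr0 ?mul0r//.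
rewrite offD -mulmxA rinner_mull trmxCK !mulmxA (unitarymxP uD) mul1mx.
rewrite /rinner adjM -!mulmxA; congr re.
rewrite mxtrace_mulC -!mulmxA (unitarymxP uD) mulmx1 mxtrace_mulC.
by rewrite mxtrace_mulC.
Qed.

Lemma flag_fun_fA (A : M) Q :
  flag_fun (fA A) (flag_class Q) = fA A (mx_of Q).
Proof.
have : flag_rel Q (repr (flag_class Q)).
  have /eqmodP := reprK (flag_class Q).
  by rewrite /= flag_rel_sym.
by move=> /asboolP[D [uD dD] e]; rewrite /flag_fun e fA_diag.
Qed.

Definition local_minimizer (F : flag -> R) (x : flag) : Prop :=
  \forall y \near x, F x <= F y.

(* The Riemannian structure of U(n), a submanifold of C^(n x n), and of its
   quotient. Tangent vectors at a class are represented by their horizontal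
   lifts at a representative Q. *)
Definition horizontal (Q : M) : set M :=
  [set xi | exists Omega : M,
    [/\ Omega^t* = - Omega, forall i, Omega i i = 0 & xi = Q *m Omega]].

Definition skew (X : M) : M := 2^-1 *: (X - X^t*).

(* Orthogonal projections onto the tangent space of U(n) at Q and onto the
   horizontal space at Q, see [tproj_tangent], [tproj_orth],
   [hproj_horizontal], [hproj_orth] below. *)
Definition tproj (Q Z : M) : M := Q *m skew (Q^t* *m Z).
Definition hproj (Q Z : M) : M := Q *m offdiag (skew (Q^t* *m Z)).

Lemma skew_adj (X : M) : (skew X)^t* = - skew X.
Proof.
rewrite /skew -scalerN opprB; apply/matrixP => i j; rewrite !mxE.
by rewrite rmorphM rmorphB /= conjCK fmorphV rmorph_nat.
Qed.

Lemma sub_skew_herm (X : M) : (X - skew X)^t* = X - skew X.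
Proof.
rewrite adjB skew_adj opprK /skew; apply/matrixP => i j; rewrite !mxE.
set x := X i j; set y := Num.conj (X j i).
have h (z : Cplx R) : 2^-1 * z + 2^-1 * z = z.
  by rewrite -mulrDl -[2^-1]mul1r -mulrDl divff ?mul1r// pnatr_eq0.
by apply/(canRL (addrK _)); rewrite -addrA h addrC subrK.
Qed.

Lemma tproj_tangent (Q Z : M) :
  exists2 Omega : M, Omega^t* = - Omega & tproj Q Z = Q *m Omega.
Proof. by exists (skew (Q^t* *m Z)) => //; exact: skew_adj. Qed.

Lemma tproj_orth (Q Z Omega : M) : Q \is unitarymx -> Omega^t* = - Omega ->
  rinner (Z - tproj Q Z) (Q *m Omega) = 0.
Proof.
move=> /unitarymxP/mulmx1C uQ hO.
rewrite rinner_mull mulmxBr /tproj [_ *m (Q *m _)]mulmxA uQ mul1mx.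
by apply: rinner_herm_skew => //; exact: sub_skew_herm.
Qed.

Lemma hproj_horizontal (Q Z : M) : horizontal Q (hproj Q Z).
Proof.
exists (offdiag (skew (Q^t* *m Z))); split => //.
  move: (skew_adj (Q^t* *m Z)); move: (skew _) => S hS.
  have hSij i j : Num.conj (S j i) = - S i j.
    by move/matrixP: hS => /(_ i j); rewrite !mxE.
  apply/matrixP => i j; rewrite !mxE rmorphB /= hSij eq_sym.
  have [->|_] := eqVneq i j; last by rewrite !mulr0n conjC0 !subr0.
  by rewrite !mulr1n hSij !subrr oppr0.
by move=> i; rewrite !mxE eqxx mulr1n subrr.
Qed.

Lemma hproj_orth (Q Z xi : M) : Q \is unitarymx -> horizontal Q xi ->
  rinner (Z - hproj Q Z) xi = 0.
Proof.
move=> uQ [W [hO dO ->]].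
have -> : Z - hproj Q Z = (Z - tproj Q Z)
    + Q *m diag_mx (\row_i skew (Q^t* *m Z) i i).
  by rewrite /hproj /offdiag mulmxBr opprB addrA addrAC.
rewrite rinnerDl tproj_orth// add0r rinner_mull mulmxA.
rewrite (mulmx1C (unitarymxP uQ)) mul1mx /rinner mul_mx_diag.
rewrite /mxtrace big1// => i _.
by rewrite !mxE dO conjC0 mul0r.
Qed.

(* For Q unitary, the Riemannian gradient of the restriction of f to U(n). The
   same formula at arbitrary matrices is the smooth extension of that vector
   field which is differentiated in [unitary_hess]. *)
Definition unitary_grad f (Q : M) : M := tproj Q (egrad f Q).

(* The Levi-Civita connection of a Riemannian submanifold is the tangential
   part of the ambient derivative. *)
Definition unitary_hess f (Q xi : M) : M :=
  tproj Q (dirD (unitary_grad f) Q xi).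

(* The connection of a Riemannian quotient is, on horizontal lifts, the
   horizontal part of the connection upstairs; when f is constant on the
   classes, its gradient on U(n) is the horizontal lift of the gradient of the
   function induced on the quotient. *)
Definition flag_hess f (Q xi : M) : M := hproj Q (unitary_hess f Q xi).

Definition flag_hess_posdef f (Q : M) : Prop :=
  forall xi, horizontal Q xi -> xi != 0 -> 0 < rinner (flag_hess f Q xi) xi.

End FlagManifold.

Arguments unitary_group : clear implicits.
Arguments flag : clear implicits.

(* Main.v *)
Require Import Defs.
From HB Require Import structures.
From mathcomp Require Import all_boot all_order all_algebra.
From mathcomp Require Import all_fingroup spectral complex.
From mathcomp Require Import all_classical all_reals all_analysis.
From mathcomp Require Import ring lra zify.
Import Order.TTheory GRing.Theory Num.Theory.
Import numFieldNormedType.Exports.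
Local Open Scope classical_set_scope.
Local Open Scope ring_scope.
Local Open Scope sesquilinear_scope.

Set Implicit Arguments.
Unset Strict Implicit.
Unset Printing Implicit Defensive.

(** Write [B = Q^* A Q], let [D] be its diagonal part and [[X, Y]] a
    commutator.  The Frobenius norm of [B] does not depend on [Q], so
    minimizing [f_A] is the same as maximizing the norm of [D].  Along
    [Q exp (t W)], [W] skew-Hermitian, the first two derivatives of [f_A] are
    [2 <[D, W], B>] and
    [hessform B W = 2 <[D, W], [B, W]> - 2 |diag [B, W]|^2];
    the second one is the Riemannian Hessian of the flag manifold
    ([flag_hess_fA]), and at a local minimizer the first vanishes and the
    second is nonnegative ([second_order_necessary]).

    Normal form.  Such a second-order point satisfies
    [conj (d_i - d_j) B_ij = - (d_i - d_j) conj B_ji], and [B_ij = 0] whenever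
    [d_i = d_j].  Hence [B = D + [D, W]] for a Hermitian [W] with zero
    diagonal ([normal_form]), so that [A] is a value of the map
    [(Q, D, W) |-> Q (D + [D, W]) Q^*].  Its source, the flag manifold times
    the diagonal matrices times the Hermitian matrices with zero diagonal, has
    real dimension [n (n - 1) + 2 n + n (n - 1) = 2 n^2], the dimension of the
    target.  This count is what makes the theorem true.

    Exceptional set.  If [hessform B] vanishes at some [H <> 0], then
    [V = [D, H] - diag [B, H]] is nonzero and orthogonal to every velocity of
    the map at [(Q, D, W)] ([degenerate_conormal]): [A] is a critical value,
    and critical values in equal dimensions form a null set (Sard,
    [null_critical_values]).  If [d_i = d_j], then the entry [W_ij] does not
    influence the value and may be taken to be zero, so [A] is the image of a
    point of a hyperplane ([null_image_low]).  The exceptional set is the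
    union of these two kinds of values; outside it a second-order point has
    pairwise distinct [d_i] and a positive definite Hessian
    ([nonexceptional]).

    Finiteness.  A positive definite Hessian isolates the class of a critical
    point among the classes of critical points ([isolated]), the second-order
    conditions are closed ([second_order_closed]), and the unitary group is
    bounded, so finitely many neighbourhoods suffice ([finite_classes]).

    Two devices carry the analysis. Derivatives are first-order expansions
    with a quadratic remainder ([jet]), over an arbitrary index set with a
    size function; the index is a real parameter, a pair of points or a
    unitary matrix near the identity, as needed. Charts come from the LU
    factorization: after a permutation of rows and a choice of phases, [Q =
    L U] with [L] unit lower triangular, and [Q] is a Lipschitz function of
    [L] ([chart_exists], [chart_lip]); so [L], [D] and [W] fill one complex
    matrix, and the null sets are images of sets of matrices. *)

(* The name is also taken by the theory of sesquilinear forms. *)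
Local Notation skew := Defs.skew.

(** * Complex scalars *)

Section Scalars.
Context {R : realType}.
Implicit Types (z w : Cplx R) (t : R).

(** Equivalent to the modulus, and polynomial in absolute values of real and
    imaginary parts, so that linear arithmetic applies to it. *)
Definition cnorm z : R := `|re z| + `|im z|.

Lemma cplxP z w : re z = re w -> im z = im w -> z = w.
Proof. by case: z w => [a b] [c d] /= -> ->. Qed.

Lemma imD z w : im (z + w) = im z + im w.
Proof. by case: z w => [a b] [c d]. Qed.

Lemma imN z : im (- z) = - im z.
Proof. by case: z. Qed.

Lemma reM z w : re (z * w) = re z * re w - im z * im w.
Proof. by case: z w => [a b] [c d]. Qed.

Lemma imM z w : im (z * w) = re z * im w + im z * re w.
Proof. by case: z w => [a b] [c d]. Qed.

Lemma im_conj z : im (Num.conj z) = - im z.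
Proof. by case: z. Qed.

Lemma re_sum (I : Type) (r : seq I) (P : pred I) (F : I -> Cplx R) :
  re (\sum_(i <- r | P i) F i) = \sum_(i <- r | P i) re (F i).
Proof. exact: (big_morph re (@reD R) (erefl : re 0 = 0)). Qed.

Lemma cnorm_ge0 z : 0 <= cnorm z.
Proof. by rewrite addr_ge0. Qed.

Lemma cnormD z w : cnorm (z + w) <= cnorm z + cnorm w.
Proof.
rewrite /cnorm reD imD.
have := ler_normD (re z) (re w); have := ler_normD (im z) (im w); lra.
Qed.

Lemma cnormM z w : cnorm (z * w) <= cnorm z * cnorm w.
Proof.
rewrite /cnorm reM imM.
have h1 := ler_normB (re z * re w) (im z * im w).
have h2 := ler_normD (re z * im w) (im z * re w).
rewrite !normrM in h1 h2; nra.
Qed.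

Lemma cnormN z : cnorm (- z) = cnorm z.
Proof. by rewrite /cnorm reN imN !normrN. Qed.

Lemma cnorm_conj z : cnorm (Num.conj z) = cnorm z.
Proof. by rewrite /cnorm re_conj im_conj normrN. Qed.

Lemma cnorm_eq0 z : cnorm z = 0 -> z = 0.
Proof.
move=> h; have a := normr_ge0 (re z); have b := normr_ge0 (im z).
have : `|re z| = 0 by rewrite /cnorm in h; lra.
have : `|im z| = 0 by rewrite /cnorm in h; lra.
by move=> /normr0_eq0 e2 /normr0_eq0 e1; apply: cplxP.
Qed.

Lemma cnorm_sum (I : Type) (r : seq I) (P : pred I) (F : I -> Cplx R) :
  cnorm (\sum_(i <- r | P i) F i) <= \sum_(i <- r | P i) cnorm (F i).
Proof.
elim/big_rec2: _ => [|i y x _ h]; first by rewrite /cnorm /= !normr0 addr0.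
by apply: le_trans (cnormD _ _) _; rewrite lerD2l.
Qed.

Lemma mkCD (s t : R) : mkC (s + t) 0 = mkC s 0 + mkC t 0.
Proof. by apply: cplxP; rewrite ?reD ?imD //= addr0. Qed.

Lemma mkCM (s t : R) : mkC (s * t) 0 = mkC s 0 * mkC t 0.
Proof. by apply: cplxP; rewrite ?reM ?imM /=; ring. Qed.

Lemma mkC1 : mkC 1 0 = 1 :> Cplx R. Proof. by []. Qed.

Lemma mkC_half : mkC (2^-1) 0 = 2^-1 :> Cplx R.
Proof.
apply: (mulfI (_ : (2 : Cplx R) != 0)); first by rewrite pnatr_eq0.
rewrite divff ?pnatr_eq0 //.
have -> : (2 : Cplx R) = mkC 2 0 by rewrite -[2%:R in RHS]/(1+1) mkCD mkC1.
by rewrite -mkCM divff ?pnatr_eq0.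
Qed.

Lemma conj_mkC t : Num.conj (mkC t 0 : Cplx R) = mkC t 0.
Proof. by apply: cplxP; rewrite ?re_conj ?im_conj //= oppr0. Qed.

(** The squared modulus as an element of [R], where the order is total. *)
Definition sq z : R := re z ^+ 2 + im z ^+ 2.

Lemma conj_mul_sq z : Num.conj z * z = mkC (sq z) 0.
Proof.
by apply: cplxP; rewrite ?reM ?imM re_conj im_conj /= /sq; ring.
Qed.

Lemma sq_ge0 z : 0 <= sq z.
Proof. by rewrite addr_ge0 ?sqr_ge0. Qed.

Lemma sq_eq0 z : sq z = 0 -> z = 0.
Proof.
move=> /eqP; rewrite paddr_eq0 ?sqr_ge0 // !sqrf_eq0 => /andP[/eqP a /eqP b].
exact: cplxP.
Qed.

Lemma sq_le_cnorm z : sq z <= cnorm z ^+ 2.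
Proof.
rewrite /sq /cnorm -(real_normK (num_real (re z))) -(real_normK (num_real (im z))).
have := normr_ge0 (re z); have := normr_ge0 (im z); nra.
Qed.

Lemma cnorm_le_sq z (a : R) : 0 <= a -> sq z <= a ^+ 2 -> cnorm z <= 2 * a.
Proof.
move=> a0 h; have p x : x ^+ 2 <= a ^+ 2 -> `|x| <= a.
  by move=> hx; rewrite -(ler_pXn2r (n := 2)) ?nnegrE // real_normK ?num_real.
have := p (re z); have := p (im z); rewrite /sq in h; rewrite /cnorm.
have := sqr_ge0 (re z); have := sqr_ge0 (im z) => h1 h2.
move=> /(_ ltac:(lra)) h3 /(_ ltac:(lra)) h4; lra.
Qed.

End Scalars.

(** * Norm, inner product and linear operations on matrices *)

Section Norm.
Context {R : realType} {n : nat}.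
Local Notation M := 'M[Cplx R]_n.
Implicit Types (X Y Z A Q : M).

(** The sum norm is submultiplicative by mere rearrangement, and it bounds all
    entries. *)
Definition nrm X : R := \sum_i \sum_j cnorm (X i j).
Definition dg X : M := diag_mx (\row_i X i i).
Definition cm X Y : M := X *m Y - Y *m X.

Lemma nrmE X : nrm X = \sum_i \sum_j cnorm (X i j). Proof. by []. Qed.

Lemma offdiagE X : offdiag X = X - dg X. Proof. by []. Qed.

Lemma dgE X i j : dg X i j = if i == j then X i i else 0.
Proof. by rewrite !mxE; case: eqP => [->|]. Qed.

Lemma offdiag_ij X i j : offdiag X i j = if i == j then 0 else X i j.
Proof.
by rewrite mxE [X in _ + X]mxE -/(dg X) dgE; case: eqP => [->|_]; rewrite ?subrr ?subr0.
Qed.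

Lemma nrm_ge0 X : 0 <= nrm X.
Proof. by apply: sumr_ge0 => i _; apply: sumr_ge0 => j _; exact: cnorm_ge0. Qed.

Lemma nrm_entry X i j : cnorm (X i j) <= nrm X.
Proof.
rewrite /nrm (bigD1 i) //= (bigD1 j) //= -addrA lerDl.
by rewrite addr_ge0 ?sumr_ge0 // => k _; rewrite ?sumr_ge0 // => *; exact: cnorm_ge0.
Qed.

Lemma nrm_eq0 X : nrm X = 0 -> X = 0.
Proof.
move=> h; apply/matrixP => i j; rewrite mxE; apply: cnorm_eq0.
by apply: le_anti; rewrite cnorm_ge0 -{1}h nrm_entry.
Qed.

Lemma nrm_gt0 X : X != 0 -> 0 < nrm X.
Proof.
move=> X0; rewrite lt_def nrm_ge0 andbT; apply: contra_neq X0; exact: nrm_eq0.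
Qed.

Lemma nrm0 : nrm 0 = 0.
Proof.
by rewrite /nrm big1 // => i _; rewrite big1 // => j _; rewrite mxE /cnorm /= !normr0 addr0.
Qed.

Lemma nrmD X Y : nrm (X + Y) <= nrm X + nrm Y.
Proof.
rewrite /nrm -big_split /=; apply: ler_sum => i _.
by rewrite -big_split /=; apply: ler_sum => j _; rewrite mxE cnormD.
Qed.

Lemma nrmN X : nrm (- X) = nrm X.
Proof.
by apply: eq_bigr => i _; apply: eq_bigr => j _; rewrite mxE cnormN.
Qed.

Lemma nrmB X Y : nrm (X - Y) <= nrm X + nrm Y.
Proof. by rewrite -(nrmN Y) nrmD. Qed.

Lemma nrmC X Y : nrm (X - Y) = nrm (Y - X).
Proof. by rewrite -nrmN opprB. Qed.

Lemma nrmM X Y : nrm (X *m Y) <= nrm X * nrm Y.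
Proof.
rewrite /nrm mulr_suml; apply: ler_sum => i _.
apply: (@le_trans _ _ (\sum_k \sum_j cnorm (X i j) * cnorm (Y j k))).
  apply: ler_sum => k _; rewrite mxE; apply: le_trans (cnorm_sum _ _ _) _.
  by apply: ler_sum => j _; exact: cnormM.
rewrite exchange_big /= mulr_suml; apply: ler_sum => j _.
rewrite -mulr_sumr ler_wpM2l ?cnorm_ge0 //.
rewrite [leRHS](bigD1 j) //= lerDl sumr_ge0 // => *; apply: sumr_ge0 => *; exact: cnorm_ge0.
Qed.

Lemma nrm_adj X : nrm (X^t*) = nrm X.
Proof.
rewrite /nrm exchange_big /=; apply: eq_bigr => i _; apply: eq_bigr => j _.
by rewrite !mxE cnorm_conj.
Qed.

Lemma nrmZr (t : R) X : nrm (mkC t 0 *: X) = `|t| * nrm X.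
Proof.
rewrite /nrm mulr_sumr; apply: eq_bigr => i _; rewrite mulr_sumr.
apply: eq_bigr => j _; rewrite mxE /cnorm reM imM /= !mul0r subr0 addr0 !normrM; ring.
Qed.

Lemma nrm_dg X : nrm (dg X) <= nrm X.
Proof.
apply: ler_sum => i _; apply: ler_sum => j _; rewrite dgE.
by case: eqP => [->//|_]; rewrite {1}/cnorm /= !normr0 addr0 cnorm_ge0.
Qed.

Lemma nrm_offdiag X : nrm (offdiag X) <= nrm X.
Proof.
apply: ler_sum => i _; apply: ler_sum => j _; rewrite offdiag_ij.
by case: eqP => [_|//]; rewrite {1}/cnorm /= !normr0 addr0 cnorm_ge0.
Qed.

Lemma nrm_skew X : nrm (skew X) <= nrm X.
Proof.
rewrite /skew -mkC_half nrmZr ger0_norm ?invr_ge0 //.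
by rewrite ler_pdivrMl // mulr_natl mulr2n -{2}(nrm_adj X) nrmB.
Qed.

Lemma rinnerE X Y :
  rinner X Y = \sum_i \sum_j (re (X i j) * re (Y i j) + im (X i j) * im (Y i j)).
Proof.
rewrite /rinner /mxtrace re_sum exchange_big /=; apply: eq_bigr => j _.
rewrite mxE re_sum; apply: eq_bigr => i _; rewrite !mxE reM re_conj im_conj; ring.
Qed.

Lemma rinnerC X Y : rinner X Y = rinner Y X.
Proof.
by rewrite !rinnerE; apply: eq_bigr => i _; apply: eq_bigr => j _; ring.
Qed.

Lemma rinnerDr X Y Z : rinner X (Y + Z) = rinner X Y + rinner X Z.
Proof. by rewrite rinnerC rinnerDl 2!(rinnerC X). Qed.

Lemma rinnerBl X Y Z : rinner (X - Y) Z = rinner X Z - rinner Y Z.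
Proof. by rewrite rinnerDl rinnerNl. Qed.

Lemma rinnerBr X Y Z : rinner X (Y - Z) = rinner X Y - rinner X Z.
Proof. by rewrite rinnerDr rinnerNr. Qed.

Lemma rinner0l X : rinner 0 X = 0.
Proof. by rewrite -(subrr X) rinnerBl subrr. Qed.

Lemma rinner0r X : rinner X 0 = 0.
Proof. by rewrite rinnerC rinner0l. Qed.

Lemma rinnerZl (t : R) X Y : rinner (mkC t 0 *: X) Y = t * rinner X Y.
Proof.
rewrite !rinnerE mulr_sumr; apply: eq_bigr => i _; rewrite mulr_sumr.
by apply: eq_bigr => j _; rewrite !mxE reM imM /=; ring.
Qed.

Lemma rinnerZr (t : R) X Y : rinner X (mkC t 0 *: Y) = t * rinner X Y.
Proof. by rewrite rinnerC rinnerZl rinnerC. Qed.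

Lemma rinner_mullV X Y Z : rinner (Y *m X) Z = rinner X (Y^t* *m Z).
Proof. by rewrite rinner_mull trmxCK. Qed.

Lemma rinner_mulrV X Y Z : rinner (X *m Y) Z = rinner X (Z *m Y^t*).
Proof.
by rewrite -rinner_adj adjM rinner_mullV trmxCK -rinner_adj !(adjM, trmxCK).
Qed.

(** The bracket with a skew-Hermitian matrix differentiates a conjugation by
    unitary matrices, which is isometric; hence it is skew-adjoint. *)
Lemma rinner_cm X Y W : W^t* = - W -> rinner (cm X W) Y = - rinner X (cm Y W).
Proof.
move=> hW; rewrite /cm rinnerBl rinnerBr rinner_mulrV rinner_mullV hW.
by rewrite mulmxN mulNmx !rinnerNr; ring.
Qed.

Lemma rinner_dg X Y : rinner (dg X) Y = rinner X (dg Y).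
Proof.
rewrite !rinnerE; apply: eq_bigr => i _; apply: eq_bigr => j _.
by rewrite !dgE; case: eqP => [->|_] //=; rewrite !(mul0r, mulr0).
Qed.

Lemma dgK X : dg (dg X) = dg X.
Proof. by apply/matrixP => i j; rewrite !dgE eqxx. Qed.

Lemma rinner_ge0 X : 0 <= rinner X X.
Proof.
rewrite rinnerE; apply: sumr_ge0 => i _; apply: sumr_ge0 => j _.
by rewrite -!expr2 addr_ge0 ?sqr_ge0.
Qed.

Lemma rinner_sq X : rinner X X = \sum_i \sum_j sq (X i j).
Proof.
by rewrite rinnerE; apply: eq_bigr => i _; apply: eq_bigr => j _; rewrite -!expr2.
Qed.

Lemma rinner_eq0 X : rinner X X = 0 -> X = 0.
Proof.
move=> /eqP; rewrite rinner_sq psumr_eq0 => [/allP h|i _]; last first.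
  by apply: sumr_ge0 => *; exact: sq_ge0.
apply/matrixP => i j; rewrite mxE; apply: sq_eq0.
have /(_ (mem_index_enum i)) := h i; rewrite psumr_eq0 => [/allP/(_ j)|*]; last exact: sq_ge0.
by rewrite mem_index_enum => /(_ isT)/eqP.
Qed.

Lemma rinner_le X Y : `|rinner X Y| <= nrm X * nrm Y.
Proof.
rewrite rinnerE /nrm mulr_suml; apply: le_trans (ler_norm_sum _ _ _) _.
apply: ler_sum => i _; apply: le_trans (ler_norm_sum _ _ _) _.
rewrite mulr_suml; apply: ler_sum => j _.
apply: (@le_trans _ _ (cnorm (X i j) * cnorm (Y i j))); last first.
  by rewrite ler_wpM2l ?cnorm_ge0 // nrm_entry.
apply: le_trans (ler_normD _ _) _; rewrite !normrM /cnorm.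
have := normr_ge0 (re (X i j)); have := normr_ge0 (im (X i j)).
have := normr_ge0 (re (Y i j)); have := normr_ge0 (im (Y i j)); nra.
Qed.

Lemma adjD X Y : (X + Y)^t* = X^t* + Y^t*.
Proof. by apply/matrixP => i j; rewrite !mxE rmorphD. Qed.

Lemma adjN X : (- X)^t* = - X^t*.
Proof. by apply/matrixP => i j; rewrite !mxE rmorphN. Qed.

Lemma adjZ (t : R) X : (mkC t 0 *: X)^t* = mkC t 0 *: X^t*.
Proof. by apply/matrixP => i j; rewrite !mxE rmorphM /= conj_mkC. Qed.

Lemma adj1 : (1%:M : M)^t* = 1%:M.
Proof. by rewrite trmx1 map_mx1. Qed.

Lemma dgD X Y : dg (X + Y) = dg X + dg Y.
Proof. by apply/matrixP => i j; rewrite [RHS]mxE ?[(- dg _) _ _]mxE !dgE !mxE; case: eqP; rewrite ?addr0. Qed.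

Lemma dgN X : dg (- X) = - dg X.
Proof. by apply/matrixP => i j; rewrite [RHS]mxE ?[(- dg _) _ _]mxE !dgE !mxE; case: eqP; rewrite ?oppr0. Qed.

Lemma dgB X Y : dg (X - Y) = dg X - dg Y.
Proof. by rewrite dgD dgN. Qed.

Lemma dgZ (z : Cplx R) X : dg (z *: X) = z *: dg X.
Proof. by apply/matrixP => i j; rewrite [RHS]mxE ?[(- dg _) _ _]mxE !dgE !mxE; case: eqP; rewrite ?mulr0. Qed.

Lemma offdiagD X Y : offdiag (X + Y) = offdiag X + offdiag Y.
Proof. by rewrite !offdiagE dgD opprD addrACA. Qed.

Lemma offdiagN X : offdiag (- X) = - offdiag X.
Proof. by rewrite !offdiagE dgN opprD. Qed.

Lemma offdiagB X Y : offdiag (X - Y) = offdiag X - offdiag Y.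
Proof. by rewrite offdiagD offdiagN. Qed.

Lemma offdiagZ (z : Cplx R) X : offdiag (z *: X) = z *: offdiag X.
Proof. by rewrite !offdiagE dgZ scalerBr. Qed.

Lemma skewD X Y : skew (X + Y) = skew X + skew Y.
Proof. by rewrite /skew adjD -scalerDr opprD addrACA. Qed.

Lemma skewN X : skew (- X) = - skew X.
Proof. by rewrite /skew adjN -scalerN opprB opprK addrC. Qed.

Lemma skewB X Y : skew (X - Y) = skew X - skew Y.
Proof. by rewrite skewD skewN. Qed.

Lemma skewZ (t : R) X : skew (mkC t 0 *: X) = mkC t 0 *: skew X.
Proof. by rewrite /skew adjZ -scalerBr !scalerA mulrC. Qed.

Lemma skew_id X : X^t* = - X -> skew X = X.
Proof.
move=> h; rewrite /skew h opprK -[X in X + _]scale1r -[X in _ + X]scale1r.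
by rewrite -scalerDl scalerA mulVf ?scale1r // pnatr_eq0.
Qed.

(** The Hermitian part of [X] is orthogonal to [W]. *)
Lemma rinner_skew X W : W^t* = - W -> rinner (skew X) W = rinner X W.
Proof.
move=> hW; apply/eqP; rewrite eq_sym -subr_eq0 -rinnerBl; apply/eqP.
exact: rinner_herm_skew (sub_skew_herm X) hW.
Qed.

Lemma cmDl X Y Z : cm (X + Y) Z = cm X Z + cm Y Z.
Proof. by rewrite /cm mulmxDl mulmxDr opprD addrACA. Qed.
Lemma cmDr X Y Z : cm X (Y + Z) = cm X Y + cm X Z.
Proof. by rewrite /cm mulmxDl mulmxDr opprD addrACA. Qed.
Lemma cmNl X Z : cm (- X) Z = - cm X Z.
Proof. by rewrite /cm mulNmx mulmxN opprD. Qed.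
Lemma cmNr X Z : cm X (- Z) = - cm X Z.
Proof. by rewrite /cm mulNmx mulmxN opprD. Qed.
Lemma cmBl X Y Z : cm (X - Y) Z = cm X Z - cm Y Z.
Proof. by rewrite cmDl cmNl. Qed.
Lemma cmC X Y : cm X Y = - cm Y X.
Proof. by rewrite /cm opprB. Qed.
Lemma cmZr (z : Cplx R) X Y : cm X (z *: Y) = z *: cm X Y.
Proof. by rewrite /cm -scalemxAl -scalemxAr scalerBr. Qed.

Lemma dg_mull X Y i j : (dg X *m Y) i j = X i i * Y i j.
Proof. by rewrite mul_diag_mx !mxE. Qed.

Lemma dg_mulr X Y i j : (Y *m dg X) i j = Y i j * X j j.
Proof. by rewrite mul_mx_diag !mxE. Qed.

(** The equations [skewE], [cmE] and [mxDl] to [zeroE] restate definitions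
    and general laws at one fixed matrix type.  Rewriting with them leaves all
    products in the same syntactic form, which [mxab] relies on. *)
Lemma skewE X : skew X = 2^-1 *: (X - X^t*). Proof. by []. Qed.

Lemma cmE X Y : cm X Y = X *m Y - Y *m X. Proof. by []. Qed.

Lemma mxDl X Y Z : (X + Y) *m Z = X *m Z + Y *m Z. Proof. exact: mulmxDl. Qed.
Lemma mxDr X Y Z : Z *m (X + Y) = Z *m X + Z *m Y. Proof. exact: mulmxDr. Qed.
Lemma mxNl X Z : (- X) *m Z = - (X *m Z). Proof. exact: mulNmx. Qed.
Lemma mxNr X Z : Z *m (- X) = - (Z *m X). Proof. exact: mulmxN. Qed.
Lemma mxZl (z : Cplx R) X Y : (z *: X) *m Y = z *: (X *m Y).
Proof. by rewrite scalemxAl. Qed.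
Lemma mxZr (z : Cplx R) X Y : X *m (z *: Y) = z *: (X *m Y).
Proof. by rewrite scalemxAr. Qed.
Lemma mxA X Y Z : X *m (Y *m Z) = X *m Y *m Z. Proof. exact: mulmxA. Qed.
Definition mxdistr := (mxDl, mxDr, mxNl, mxNr).

Lemma addE X Y i j : (X + Y) i j = X i j + Y i j. Proof. by rewrite mxE. Qed.
Lemma oppE X i j : (- X) i j = - X i j. Proof. by rewrite mxE. Qed.
Lemma scaleE (z : Cplx R) X i j : (z *: X) i j = z * X i j. Proof. by rewrite mxE. Qed.
Lemma zeroE i j : (0 : M) i j = 0. Proof. by rewrite mxE. Qed.

End Norm.

(* Unification would otherwise unfold these to sums of entries. *)
#[global] Opaque cm dg rinner nrm offdiag skew.

(** Proves an identity of the abelian group of matrices, once distributivity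
    has been applied: products become atoms, and [ring] compares the
    entries. *)
Ltac mxab :=
  repeat match goal with
  | |- context [@mulmx ?r ?a ?b ?c ?X ?Y] => generalize (@mulmx r a b c X Y); intro
  end;
  apply/matrixP => ? ?; rewrite !(addE, oppE, scaleE, zeroE); ring.

(** * First-order expansions *)

Section BigO.
Context {R : realType} {n : nat}.
Local Notation M := 'M[Cplx R]_n.
Context {T : Type} (D : T -> Prop) (h : T -> R).
Hypothesis h01 : forall t, D t -> 0 <= h t <= 1.
Implicit Types (c d e : T -> M) (f g : T -> R).

(** [c = O(h^k)] uniformly on [D].  The index set is abstract since three kinds
    of indices occur: a time [t] with [h = |t|], a pair of parameters with
    their distance, and a unitary matrix with the norm of its off-diagonal
    part. *)
Definition isO (k : nat) c :=
  exists2 C : R, 0 <= C & forall t, D t -> nrm (c t) <= C * h t ^+ k.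

Definition isOr (k : nat) f :=
  exists2 C : R, 0 <= C & forall t, D t -> `|f t| <= C * h t ^+ k.

Lemma isO_eq k c d : (forall t, D t -> c t = d t) -> isO k c -> isO k d.
Proof. by move=> e [C C0 H]; exists C => // t Dt; rewrite -e ?H. Qed.

Lemma isOr_eq k f g : (forall t, D t -> f t = g t) -> isOr k f -> isOr k g.
Proof. by move=> e [C C0 H]; exists C => // t Dt; rewrite -e ?H. Qed.

Lemma isO_le k c d : (forall t, D t -> nrm (d t) <= nrm (c t)) -> isO k c -> isO k d.
Proof. by move=> e [C C0 H]; exists C => // t Dt; apply: le_trans (e t Dt) (H t Dt). Qed.

Lemma isOD k c d : isO k c -> isO k d -> isO k (fun t => c t + d t).
Proof.
move=> [C C0 hC] [C' C'0 hC']; exists (C + C'); rewrite ?addr_ge0 // => t Dt.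
by apply: le_trans (nrmD _ _) _; rewrite mulrDl lerD ?hC ?hC'.
Qed.

Lemma isON k c : isO k c -> isO k (fun t => - c t).
Proof. by apply: isO_le => t _; rewrite nrmN. Qed.

Lemma isOB k c d : isO k c -> isO k d -> isO k (fun t => c t - d t).
Proof. by move=> hc hd; exact: isOD hc (isON hd). Qed.

Lemma isO_adj k c : isO k c -> isO k (fun t => (c t)^t*).
Proof. by apply: isO_le => t _; rewrite nrm_adj. Qed.

Lemma isO_dg k c : isO k c -> isO k (fun t => dg (c t)).
Proof. by apply: isO_le => t _; exact: nrm_dg. Qed.

Lemma isO_offdiag k c : isO k c -> isO k (fun t => offdiag (c t)).
Proof. by apply: isO_le => t _; exact: nrm_offdiag. Qed.

Lemma isO_skew k c : isO k c -> isO k (fun t => skew (c t)).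
Proof. by apply: isO_le => t _; exact: nrm_skew. Qed.

Lemma isOM k l c d : isO k c -> isO l d -> isO (k + l) (fun t => c t *m d t).
Proof.
move=> [C C0 hC] [C' C'0 hC']; exists (C * C'); rewrite ?mulr_ge0 // => t Dt.
apply: le_trans (nrmM _ _) _; rewrite exprD mulrACA.
by rewrite ler_pM ?nrm_ge0 ?hC ?hC'.
Qed.

Lemma isO_cm k l c d : isO k c -> isO l d -> isO (k + l) (fun t => cm (c t) (d t)).
Proof.
move=> hc hd; apply: isOB; first exact: isOM.
by rewrite addnC; exact: isOM.
Qed.

Lemma isOZ k (a : R) c : isO k c -> isO k (fun t => mkC a 0 *: c t).
Proof.
move=> [C C0 hC]; exists (`|a| * C); rewrite ?mulr_ge0 // => t Dt.
by rewrite nrmZr -mulrA ler_wpM2l ?hC.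
Qed.

Lemma isO_cst (X : M) : isO 0 (fun _ => X).
Proof. by exists (nrm X); rewrite ?nrm_ge0 // => t _; rewrite expr0 mulr1. Qed.

Lemma isO0 k : isO k (fun _ => 0).
Proof. by exists 0 => // t _; rewrite nrm0 mul0r. Qed.

Lemma isO_weak k l c : (l <= k)%N -> isO k c -> isO l c.
Proof.
move=> lk [C C0 hC]; exists C => // t Dt; apply: le_trans (hC t Dt) _.
rewrite ler_wpM2l //; have /andP[a b] := h01 Dt.
by rewrite ler_wiXn2l.
Qed.

Lemma isO_rinner k l c d : isO k c -> isO l d ->
  isOr (k + l) (fun t => rinner (c t) (d t)).
Proof.
move=> [C C0 hC] [C' C'0 hC']; exists (C * C'); rewrite ?mulr_ge0 // => t Dt.
apply: le_trans (rinner_le _ _) _; rewrite exprD mulrACA.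
by rewrite ler_pM ?nrm_ge0 ?hC ?hC'.
Qed.

Lemma isOrD k f g : isOr k f -> isOr k g -> isOr k (fun t => f t + g t).
Proof.
move=> [C C0 hC] [C' C'0 hC']; exists (C + C'); rewrite ?addr_ge0 // => t Dt.
by apply: le_trans (ler_normD _ _) _; rewrite mulrDl lerD ?hC ?hC'.
Qed.

Lemma isOrN k f : isOr k f -> isOr k (fun t => - f t).
Proof. by move=> [C C0 hC]; exists C => // t /hC; rewrite normrN. Qed.

Lemma isOrB k f g : isOr k f -> isOr k g -> isOr k (fun t => f t - g t).
Proof. by move=> hf hg; exact: isOrD hf (isOrN hg). Qed.

(** [c = c0 + c1 + O(h^2)] with [c1 = O(h)]: [c0] is the value and [c1] the
    differential, both allowed to depend on the index, so that a jet is uniform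
    in the base point. *)
Definition jet c c0 c1 :=
  [/\ isO 0 c0, isO 1 c1 & isO 2 (fun t => c t - c0 t - c1 t)].

Lemma jet_eq c d c0 c1 d1 : (forall t, D t -> c t = d t) ->
  (forall t, D t -> c1 t = d1 t) ->
  jet c c0 c1 -> jet d c0 d1.
Proof.
move=> e e1 [a b H]; split => //; first exact: isO_eq b.
by apply: isO_eq H => t Dt; rewrite e ?e1.
Qed.

Lemma jet_bounded c c0 c1 : jet c c0 c1 -> isO 0 c.
Proof.
move=> [h0 h1 h2].
have h2' := isO_weak (leq0n 2) h2; have h1' := isO_weak (leq0n 1) h1.
apply: isO_eq (isOD h2' (isOD h0 h1')) => t _.
mxab.
Qed.

Lemma jet_lip c c0 c1 : jet c c0 c1 -> isO 1 (fun t => c t - c0 t).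
Proof.
move=> [_ h1 h2]; apply: isO_eq (isOD (isO_weak (leqnSn 1) h2) h1) => t _.
by rewrite subrK.
Qed.

Lemma jet_cst X : jet (fun _ => X) (fun _ => X) (fun _ => 0).
Proof.
split; [exact: isO_cst|exact: isO0|].
by apply: isO_eq (isO0 2) => t _; rewrite subrr subr0.
Qed.

Lemma jetD c c0 c1 d d0 d1 : jet c c0 c1 -> jet d d0 d1 ->
  jet (fun t => c t + d t) (fun t => c0 t + d0 t) (fun t => c1 t + d1 t).
Proof.
move=> [a b e] [a' b' e']; split; [exact: isOD|exact: isOD|].
apply: isO_eq (isOD e e') => t _; mxab.
Qed.

Lemma jetN c c0 c1 : jet c c0 c1 ->
  jet (fun t => - c t) (fun t => - c0 t) (fun t => - c1 t).
Proof.
move=> [a b e]; split; [exact: isON|exact: isON|].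
by apply: isO_eq (isON e) => t _; rewrite !opprD.
Qed.

Lemma jetB c c0 c1 d d0 d1 : jet c c0 c1 -> jet d d0 d1 ->
  jet (fun t => c t - d t) (fun t => c0 t - d0 t) (fun t => c1 t - d1 t).
Proof. by move=> hc hd; exact: jetD hc (jetN hd). Qed.

Lemma jet_adj c c0 c1 : jet c c0 c1 ->
  jet (fun t => (c t)^t*) (fun t => (c0 t)^t*) (fun t => (c1 t)^t*).
Proof.
move=> [a b e]; split; [exact: isO_adj|exact: isO_adj|].
by apply: isO_eq (isO_adj e) => t _; rewrite !adjB.
Qed.

Lemma jet_dg c c0 c1 : jet c c0 c1 ->
  jet (fun t => dg (c t)) (fun t => dg (c0 t)) (fun t => dg (c1 t)).
Proof.
move=> [a b e]; split; [exact: isO_dg|exact: isO_dg|].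
by apply: isO_eq (isO_dg e) => t _; rewrite !dgB.
Qed.

Lemma jet_offdiag c c0 c1 : jet c c0 c1 ->
  jet (fun t => offdiag (c t)) (fun t => offdiag (c0 t)) (fun t => offdiag (c1 t)).
Proof.
move=> [a b e]; split; [exact: isO_offdiag|exact: isO_offdiag|].
by apply: isO_eq (isO_offdiag e) => t _; rewrite !offdiagB.
Qed.

Lemma jet_skew c c0 c1 : jet c c0 c1 ->
  jet (fun t => skew (c t)) (fun t => skew (c0 t)) (fun t => skew (c1 t)).
Proof.
move=> [a b e]; split; [exact: isO_skew|exact: isO_skew|].
by apply: isO_eq (isO_skew e) => t _; rewrite !skewB.
Qed.

Lemma jetZ (a : R) c c0 c1 : jet c c0 c1 ->
  jet (fun t => mkC a 0 *: c t) (fun t => mkC a 0 *: c0 t) (fun t => mkC a 0 *: c1 t).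
Proof.
move=> [u b e]; split; [exact: isOZ|exact: isOZ|].
by apply: isO_eq (isOZ a e) => t _; rewrite !scalerBr.
Qed.

(** The product rule. *)
Lemma jetM c c0 c1 d d0 d1 : jet c c0 c1 -> jet d d0 d1 ->
  jet (fun t => c t *m d t) (fun t => c0 t *m d0 t)
      (fun t => c0 t *m d1 t + c1 t *m d0 t).
Proof.
move=> Jc Jd; have [c00 c11 rc] := Jc; have [d00 d11 rd] := Jd.
split; [exact: isOM c00 d00|apply: isOD; [exact: isOM c00 d11|exact: isOM c11 d00]|].
have h1 := isOM c11 d11.
have h2 := isOM (isOD c00 (isO_weak (leq0n 1) c11)) rd.
have h3 := isOM rc (jet_bounded Jd).
apply: isO_eq (isOD (isOD h1 h2) h3) => t _ /=.
by rewrite !mxdistr; mxab.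
Qed.

Lemma jet_cm c c0 c1 d d0 d1 : jet c c0 c1 -> jet d d0 d1 ->
  jet (fun t => cm (c t) (d t)) (fun t => cm (c0 t) (d0 t))
      (fun t => cm (c0 t) (d1 t) + cm (c1 t) (d0 t)).
Proof.
move=> hc hd; apply: jet_eq (jetB (jetM hc hd) (jetM hd hc)) => // t _.
by rewrite !cmE; mxab.
Qed.

Lemma jet_rinner c c0 c1 d d0 d1 : jet c c0 c1 -> jet d d0 d1 ->
  isOr 2 (fun t => rinner (c t) (d t) - rinner (c0 t) (d0 t) -
                 (rinner (c0 t) (d1 t) + rinner (c1 t) (d0 t))).
Proof.
move=> Jc Jd; have [c00 c11 rc] := Jc; have [d00 d11 rd] := Jd.
have h1 := isO_rinner c11 d11.
have h2 := isO_rinner (isOD c00 (isO_weak (leq0n 1) c11)) rd.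
have h3 := isO_rinner rc (jet_bounded Jd).
apply: isOr_eq (isOrD (isOrD h1 h2) h3) => t _ /=.
rewrite !(rinnerBl, rinnerBr, rinnerDl, rinnerDr).
move: (rinner (c0 t) (d0 t)) (rinner (c0 t) (d1 t)) (rinner (c1 t) (d0 t)).
move: (rinner (c1 t) (d1 t)) (rinner (c0 t) (d t)) (rinner (c1 t) (d t)).
move: (rinner (c t) (d t)) => *; ring.
Qed.

End BigO.

(** * Gradient and Hessian of the objective *)

Section Curves.
Context {R : realType} {n : nat}.
Local Notation M := 'M[Cplx R]_n.
Implicit Types (X Y Z A Q W : M).

Definition small (t : R) : Prop := `|t| <= 1.
Definition absv (t : R) : R := `|t|.

Lemma small01 t : small t -> 0 <= absv t <= 1.
Proof. by move=> h; rewrite normr_ge0. Qed.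

Local Notation tjet c c0 c1 :=
  (jet small absv c (fun _ => c0) (fun t => mkC t 0 *: c1)).

(** A quadratic remainder forces the derivative, so gradients and
    Hessians can be computed by calculating with jets. *)
Lemma derive1_isO (f : R -> R) a b :
  isOr small absv 2 (fun t => f t - a - t * b) -> derive1 f 0 = b.
Proof.
move=> [C C0 H].
have f0 : f 0 = a.
  have := H 0; rewrite /small /absv normr0 ler01 => /(_ isT).
  by rewrite expr2 mulr0 mulr0 mul0r subr0 normr_le0 subr_eq0 => /eqP.
rewrite derive1E /derive; apply: cvg_lim => //.
apply/cvgrPdist_le => e e0; near=> t.
have t0 : t != 0 by near: t; exact: nbhs_dnbhs_neq.
have tsm : `|t| < Num.min 1 (e / (C + 1)).
  near: t; apply: dnbhs0_lt; rewrite lt_min ltr01 divr_gt0 //; lra.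
move: tsm; rewrite lt_min ltr_pdivlMr; last lra.
move=> /andP[t1 te].
have tp : 0 < `|t| by rewrite normr_gt0.
have := H t (ltW t1); rewrite -f0 /absv => Ht.
rewrite /= addr0 /GRing.scale /= mulr1.
have -> : b - t^-1 * (f t - f 0) = - (t^-1 * (f t - f 0 - t * b)) by field.
rewrite normrN normrM normfV ler_pdivrMl //; nra.
Unshelve. all: by end_near. Qed.

Lemma jet_entry (c : R -> M) (c0 c1 : M) i j : tjet c c0 c1 ->
  isOr small absv 2 (fun t => re (c t i j) - re (c0 i j) - t * re (c1 i j)) /\
  isOr small absv 2 (fun t => im (c t i j) - im (c0 i j) - t * im (c1 i j)).
Proof.
move=> [_ _ [C C0 H]]; split; exists C => // t Dt; apply: le_trans (H t Dt);
  apply: le_trans (nrm_entry _ i j); rewrite !(addE, oppE, scaleE) /cnorm;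
  rewrite !(reD, imD, reN, imN, reM, imM) /= !mul0r ?subr0 ?addr0.
  by rewrite lerDl.
by rewrite lerDr.
Qed.

Lemma velocity_jet (c : R -> M) (c0 c1 : M) : tjet c c0 c1 -> velocity c = c1.
Proof.
move=> J; apply/matrixP => i j; rewrite mxE.
have [/derive1_isO -> /derive1_isO ->] := jet_entry i j J.
exact: cplxP.
Qed.

Lemma tjet_line X Z : tjet (fun t => X + mkC t 0 *: Z) X Z.
Proof.
split; [exact: isO_cst| |].
  by exists (nrm Z); rewrite ?nrm_ge0 // => t _; rewrite nrmZr mulrC.
by apply: isO_eq (isO0 _ _ 2) => t _; mxab.
Qed.

Lemma tjet_cst X : tjet (fun _ => X) X 0.
Proof.
by apply: jet_eq (jet_cst small absv X) => [//|t _]; rewrite scaler0.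
Qed.

Lemma tjetD (c : R -> M) (c0 c1 : M) (d : R -> M) (d0 d1 : M) : tjet c c0 c1 -> tjet d d0 d1 ->
  tjet (fun t => c t + d t) (c0 + d0) (c1 + d1).
Proof. by move=> hc hd; apply: jet_eq (jetD hc hd) => [//|t _]; rewrite scalerDr. Qed.

Lemma tjetM (c : R -> M) (c0 c1 : M) (d : R -> M) (d0 d1 : M) : tjet c c0 c1 -> tjet d d0 d1 ->
  tjet (fun t => c t *m d t) (c0 *m d0) (c0 *m d1 + c1 *m d0).
Proof.
move=> hc hd; apply: jet_eq (jetM small01 hc hd) => [//|t _].
by rewrite scalerDr -scalemxAl -scalemxAr.
Qed.

Lemma tjet_adj (c : R -> M) (c0 c1 : M) : tjet c c0 c1 -> tjet (fun t => (c t)^t*) (c0^t*) (c1^t*).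
Proof. by move=> hc; apply: jet_eq (jet_adj hc) => [//|t _]; rewrite adjZ. Qed.

Lemma tjet_offdiag (c : R -> M) (c0 c1 : M) : tjet c c0 c1 ->
  tjet (fun t => offdiag (c t)) (offdiag c0) (offdiag c1).
Proof. by move=> hc; apply: jet_eq (jet_offdiag hc) => [//|t _]; rewrite offdiagZ. Qed.

Lemma tjet_skew (c : R -> M) (c0 c1 : M) : tjet c c0 c1 ->
  tjet (fun t => skew (c t)) (skew c0) (skew c1).
Proof. by move=> hc; apply: jet_eq (jet_skew hc) => [//|t _]; rewrite skewZ. Qed.

Lemma tjetZ (a : R) (c : R -> M) (c0 c1 : M) : tjet c c0 c1 ->
  tjet (fun t => mkC a 0 *: c t) (mkC a 0 *: c0) (mkC a 0 *: c1).
Proof.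
move=> hc; apply: jet_eq (jetZ a hc) => [//|t _].
rewrite scalerA.
rewrite scalerA.
congr (_ *: _).
exact: mulrC.
Qed.

(** The Euclidean gradient of [fA A]: differentiating
    [|offdiag (X^* A X)|^2] in direction [Z] gives
    [2 <O, X^* A Z + Z^* A X>] with [O = offdiag (X^* A X)], and the adjoint of
    [Z |-> X^* A Z + Z^* A X] is applied to [O]. *)
Definition gradA A X : M :=
  mkC 2 0 *: (A *m X *m (offdiag (X^t* *m A *m X))^t* +
              A^t* *m X *m offdiag (X^t* *m A *m X)).

Lemma tjet_conj A (c : R -> M) (c0 c1 : M) : tjet c c0 c1 ->
  tjet (fun t => (c t)^t* *m A *m c t) (c0^t* *m A *m c0)
    (c0^t* *m A *m c1 + c1^t* *m A *m c0).
Proof.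
move=> hc; have h := tjetM (tjetM (tjet_adj hc) (tjet_cst A)) hc.
by apply: jet_eq h => [//|t _]; rewrite mulmx0 add0r.
Qed.

Lemma rinner_offdiag X Y : rinner (offdiag X) (offdiag Y) = rinner (offdiag X) Y.
Proof.
rewrite [in LHS](offdiagE Y) rinnerBr -rinner_dg offdiagE dgB dgK subrr.
by rewrite rinner0l subr0.
Qed.

Lemma gradA_rinner A X Z : let O := offdiag (X^t* *m A *m X) in
  rinner O (offdiag (X^t* *m A *m Z + Z^t* *m A *m X)) *+ 2 =
  rinner (gradA A X) Z.
Proof.
move=> O; rewrite rinner_offdiag /gradA -/O rinnerZl -[LHS]mulr_natl; congr (_ * _).
move: O => O; rewrite rinnerDr rinnerDl [RHS]addrC; congr (_ + _).
  by rewrite rinner_mull adjM trmxCK.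
by rewrite -rinner_adj !adjM trmxCK mulmxA rinner_mull adjM !trmxCK.
Qed.

Lemma fA_deriv A X Z :
  derive1 (fun t => fA A (X + mkC t 0 *: Z)) 0 = rinner (gradA A X) Z.
Proof.
rewrite -gradA_rinner; set B1 := X^t* *m A *m Z + _.
have J := tjet_offdiag (tjet_conj A (tjet_line X Z)).
have := jet_rinner small01 J J; rewrite -/B1 => H.
apply: (derive1_isO (a := fA A X)).
apply: isOr_eq H => t _; rewrite rinnerZl rinnerZr /fA -/B1.
rewrite (rinnerC (offdiag B1)) mulr2n -mulrDr.
move: (rinner (offdiag (_ *m _)) _) (rinner _ _) => x y.
by rewrite [in RHS]mulrDr [in LHS]mulrDr.
Qed.

Lemma rinner_delta X i j : rinner X (delta_mx i j) = re (X i j).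
Proof.
rewrite rinnerE (bigD1 i) //= (bigD1 j) //= !mxE !eqxx /= mulr1 mulr0 addr0.
rewrite big1 ?addr0 => [|k kj]; last by rewrite mxE (negPf kj) andbF /= !mulr0 addr0.
rewrite big1 ?addr0 // => k ki; rewrite big1 // => l _.
by rewrite mxE (negPf ki) /= !mulr0 addr0.
Qed.

Lemma rinner_deltai X i j : rinner X (mkC 0 1 *: delta_mx i j) = im (X i j).
Proof.
have -> : mkC 0 1 *: delta_mx i j = (mkC 0 (-1) *: (1%:M))^t* *m delta_mx i j :> M.
  rewrite -[LHS]mul1mx -scalemxAr scalemxAl; congr (_ *m _).
  apply/matrixP => a b; rewrite !mxE rmorphM /= eq_sym conjC_nat; congr (_ * _).
  by apply: cplxP; rewrite ?re_conj ?im_conj /= ?opprK.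
rewrite rinner_mull trmxCK -scalemxAl mul1mx rinner_delta mxE reM /=; ring.
Qed.

Lemma egrad_fA A X : egrad (fA A) X = gradA A X.
Proof.
apply/matrixP => i j; apply: cplxP; rewrite mxE /=.
  exact: etrans (fA_deriv A X _) (rinner_delta _ i j).
transitivity (derive1 (fun t => fA A (X + mkC t 0 *: (mkC 0 1 *: delta_mx i j))) 0); last first.
  exact: etrans (fA_deriv A X _) (rinner_deltai _ i j).
apply: (congr1 (fun f => derive1 f 0)); apply/funext => t.
rewrite scalerA.
suff -> : mkC t 0 * mkC 0 1 = mkC 0 t :> Cplx R by [].
by apply: cplxP; rewrite ?reM ?imM /=; ring.
Qed.

Lemma unitary_grad_fA A X : let B := X^t* *m A *m X in
  unitary_grad (fA A) X =
  X *m skew (mkC 2 0 *: (B *m (offdiag B)^t* + B^t* *m offdiag B)).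
Proof.
move=> B; rewrite /unitary_grad /tproj egrad_fA /gradA -/B.
have -> : B^t* = X^t* *m A^t* *m X by rewrite /B !adjM trmxCK mulmxA.
move: (offdiag B) => O; congr (X *m skew _).
by rewrite -scalemxAr mulmxDr {}/B !mulmxA.
Qed.

(** The second derivative of [f_A] along [Q exp (t W)], where
    [B = Q^* A Q]. *)
Definition hessform (B W : M) : R :=
  2 * rinner (cm (dg B) W) (cm B W) - 2 * rinner (dg (cm B W)) (cm B W).

(** The left side is half the derivative of the gradient in the horizontal
    direction [W], paired with [W].  Transposing the products turns it into
    [<offdiag B1, [B, W]> + <offdiag B, [B1, W]>]; the terms without a diagonal
    part, [|B1|^2] and [<B, [B1, W]> = - |B1|^2], cancel, because the norm of
    [B] is constant. *)
Lemma second_variation B W : W^t* = - W -> let B1 := cm B W in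
  rinner (B *m (offdiag B1)^t* + B1 *m (offdiag B)^t* +
          (B^t* *m offdiag B1 + B1^t* *m offdiag B)) W =
  rinner (cm (dg B) W) B1 - rinner (dg B1) B1.
Proof.
move=> hW B1.
have e Y Z : rinner (Y *m Z^t* + Y^t* *m Z) W = rinner Z (cm Y W).
  rewrite rinnerDl [X in _ + X]rinner_mullV trmxCK cmE rinnerBr addrC; congr (_ + _).
  by rewrite -rinner_adj adjM trmxCK hW rinnerNr rinner_mulrV trmxCK.
have e1 : rinner B (cm B1 W) = - rinner B1 B1.
  by apply: oppr_inj; rewrite opprK -(rinner_cm B B1 hW).
have e2 : rinner (dg B) (cm B1 W) = - rinner (cm (dg B) W) B1.
  by apply: oppr_inj; rewrite opprK -(rinner_cm (dg B) B1 hW).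
have e3 : cm B W = B1 by [].
clearbody B1.
rewrite addrACA rinnerDl e e e3 !offdiagE 2!rinnerBl e1 e2.
by rewrite opprK addrACA subrr add0r addrC.
Qed.

(** The two projections in the Riemannian Hessian are invisible against the
    horizontal vector [Q W], so that only the derivative of the gradient
    field [X skew (G X)] remains; the term that differentiates the factor
    [X] vanishes, as it pairs a skew-Hermitian matrix with the Hermitian
    matrix [W^* W]. *)
Lemma flag_hess_fA A Q W : Q \is unitarymx -> W^t* = - W -> (forall i, W i i = 0) ->
  rinner (flag_hess (fA A) Q (Q *m W)) (Q *m W) = hessform (Q^t* *m A *m Q) W.
Proof.
move=> uQ hW dW; have hQ : Q^t* *m Q = 1%:M by apply: mulmx1C; apply/unitarymxP.
have horQ : horizontal Q (Q *m W) by exists W.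
have proj_h Z : rinner (hproj Q Z) (Q *m W) = rinner Z (Q *m W).
  by have := hproj_orth Z uQ horQ; rewrite rinnerBl => /eqP; rewrite subr_eq0 => /eqP.
have proj_t Z : rinner (tproj Q Z) (Q *m W) = rinner Z (Q *m W).
  by have := tproj_orth Z uQ hW; rewrite rinnerBl => /eqP; rewrite subr_eq0 => /eqP.
rewrite /flag_hess /unitary_hess proj_h proj_t.
set B := Q^t* *m A *m Q.
set B1 := cm B W.
have JX := tjet_line Q (Q *m W).
have JB : tjet (fun t => (Q + mkC t 0 *: (Q *m W))^t* *m A *m (Q + mkC t 0 *: (Q *m W))) B B1.
  apply: jet_eq (tjet_conj A JX) => [//|t _]; congr (_ *: _).
  by rewrite /B1 cmE adjM hW !mulNmx !mulmxA.
have JO := tjet_offdiag JB.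
have JG := tjetZ 2 (tjetD (tjetM JB (tjet_adj JO)) (tjetM (tjet_adj JB) JO)).
have := velocity_jet (jet_eq _ (fun _ _ => erefl) (tjetM JX (tjet_skew JG))).
rewrite /dirD => -> => [|t _]; last first.
  by rewrite unitary_grad_fA.
have key (S0 S1 : M) : S0^t* = - S0 ->
    rinner (Q *m S1 + (Q *m W) *m S0) (Q *m W) = rinner S1 W.
  move=> hS; rewrite rinnerDl -mulmxA ![rinner (Q *m _) _]rinner_mullV !mulmxA hQ !mul1mx.
  rewrite [X in _ + X]rinner_mullV [X in _ + X]rinnerC [X in _ + X]rinner_herm_skew ?addr0 //.
  by rewrite adjM trmxCK.
rewrite (key _ _ (skew_adj _)) (rinner_skew _ hW) rinnerZl /hessform -/B1 -[in RHS]mulrBr.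
congr (_ * _); exact: second_variation.
Qed.

End Curves.

(** * Second-order conditions at a local minimizer *)

Section LocalMin.
Context {R : realType} {n : nat}.
Local Notation M := 'M[Cplx R]_n.
Implicit Types (z : Cplx R).

Lemma norm_le_cnorm z : `|z| <= mkC (cnorm z) 0.
Proof.
case: z => a b; rewrite /Num.norm /= /Order.le /= /ComplexField.Normc.normc.
rewrite eqxx /= /cnorm /=.
rewrite -[leRHS]ger0_norm ?addr_ge0 // -sqrtr_sqr ler_sqrt ?sqr_ge0 //.
rewrite sqrrD !real_normK ?num_real // lerD2r lerDl mulrn_wge0 // mulr_ge0 //.
Qed.

Lemma gt0_Cplx z : 0 < z -> 0 < re z /\ im z = 0.
Proof. by case: z => a b; rewrite /Order.lt /= => /andP[/eqP b0 a0]; split. Qed.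

Lemma lt_Cplx (x : R) z : x < re z -> im z = 0 -> mkC x 0 < z.
Proof. by case: z => a b /= h ->; rewrite /Order.lt /= eqxx h. Qed.

(** The quotient map is continuous, so the neighbourhood in the flag manifold
    pulls back to one in the unitary group, and that contains a ball for
    [nrm]. *)
Lemma local_min_ball (F : flag R n -> R) (Q : unitary_group R n) :
  local_minimizer F (flag_class Q) ->
  exists2 e : R, 0 < e & forall P : unitary_group R n,
    nrm (mx_of P - mx_of Q) < e -> F (flag_class Q) <= F (flag_class P).
Proof.
move=> H.
have : nbhs Q (fun P : unitary_group R n => F (flag_class Q) <= F (flag_class P)).
  exact: (@pi_continuous (unitary_group R n) _ Q _ H).
move=> [_ [[U oU <-] UQ sub]].
have : nbhs (mx_of Q) U by apply: open_nbhs_nbhs.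
rewrite -nbhs_ballE => -[e /= /gt0_Cplx[e0 ei] He]; exists (re e) => // P hP.
apply: sub; apply: He; split; first exact: lt_Cplx.
move=> i j; rewrite -ball_normE /ball_ /=.
apply: le_lt_trans (norm_le_cnorm _) (lt_Cplx _ ei).
apply: le_lt_trans hP; rewrite nrmC; apply: le_trans (nrm_entry _ i j) => //.
by rewrite !mxE.
Qed.

Local Notation tO k c := (isO small absv k c).

(** Second-order expansion at time zero; the coefficient [c2] is half the
    second derivative. *)
Definition tjet2 (c : R -> M) (c0 c1 c2 : M) :=
  tO 3 (fun t => c t - (c0 + mkC t 0 *: c1 + mkC (t ^+ 2) 0 *: c2)).

Lemma isO_tpow k (X : M) : tO k (fun t => mkC (t ^+ k) 0 *: X).
Proof.
exists (nrm X); rewrite ?nrm_ge0 // => t _.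
by rewrite nrmZr normrX mulrC.
Qed.

Lemma isO_tpowM k l (c : R -> M) : tO l c -> tO (k + l) (fun t => mkC (t ^+ k) 0 *: c t).
Proof.
move=> [C C0 H]; exists C => // t Dt.
by rewrite nrmZr normrX exprD mulrCA ler_wpM2l ?exprn_ge0 ?H.
Qed.

Lemma isO_poly (c0 c1 c2 : M) : tO 0 (fun t => c0 + mkC t 0 *: c1 + mkC (t ^+ 2) 0 *: c2).
Proof.
apply: isOD; first apply: isOD; first exact: isO_cst.
  exact: (isO_weak small01 (leq0n 1) (isO_tpow 1 c1)).
exact: (isO_weak small01 (leq0n 2) (isO_tpow 2 c2)).
Qed.

Lemma tjet2_bounded (c : R -> M) (c0 c1 c2 : M) : tjet2 c c0 c1 c2 -> tO 0 c.
Proof.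
move=> H; apply: isO_eq (isOD (isO_weak small01 (leq0n 3) H) (isO_poly c0 c1 c2)) => t _.
by rewrite subrK.
Qed.

Lemma tjet2_cst (X : M) : tjet2 (fun _ => X) X 0 0.
Proof.
by apply: isO_eq (isO0 _ _ 3) => t _; rewrite !scaler0 !addr0 subrr.
Qed.

Lemma tjet2_adj (c : R -> M) (c0 c1 c2 : M) : tjet2 c c0 c1 c2 ->
  tjet2 (fun t => (c t)^t*) (c0^t*) (c1^t*) (c2^t*).
Proof. by move=> h; apply: isO_eq (isO_adj h) => t _; rewrite adjB !adjD !adjZ. Qed.

Lemma tjet2_dg (c : R -> M) (c0 c1 c2 : M) : tjet2 c c0 c1 c2 ->
  tjet2 (fun t => dg (c t)) (dg c0) (dg c1) (dg c2).
Proof. by move=> h; apply: isO_eq (isO_dg h) => t _; rewrite dgB !dgD !dgZ. Qed.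

Lemma quad_mulmx (t : R) (c0 c1 c2 d0 d1 d2 : M) :
  (c0 + mkC t 0 *: c1 + mkC (t ^+ 2) 0 *: c2) *m
  (d0 + mkC t 0 *: d1 + mkC (t ^+ 2) 0 *: d2) =
  (c0 *m d0 + mkC t 0 *: (c0 *m d1 + c1 *m d0) +
   mkC (t ^+ 2) 0 *: (c0 *m d2 + c1 *m d1 + c2 *m d0)) +
  (mkC (t ^+ 3) 0 *: (c1 *m d2 + c2 *m d1) + mkC (t ^+ 4) 0 *: (c2 *m d2)).
Proof.
rewrite !mulmxDl !mulmxDr -!scalemxAl -!scalemxAr.
move: (c0 *m d0) (c0 *m d1) (c0 *m d2) (c1 *m d0) (c1 *m d1) (c1 *m d2)
  (c2 *m d0) (c2 *m d1) (c2 *m d2) => x00 x01 x02 x10 x11 x12 x20 x21 x22.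
have -> : mkC (t ^+ 4) 0 = mkC (t ^+ 2) 0 * mkC (t ^+ 2) 0 by rewrite -mkCM -exprD.
have -> : mkC (t ^+ 3) 0 = mkC (t ^+ 2) 0 * mkC t 0 by rewrite -mkCM -exprSr.
have -> : mkC (t ^+ 2) 0 = mkC t 0 * mkC t 0 by rewrite -mkCM.
move: (mkC t 0) => u; mxab.
Qed.

Lemma tjet2M (c : R -> M) (c0 c1 c2 : M) (d : R -> M) (d0 d1 d2 : M) :
  tjet2 c c0 c1 c2 -> tjet2 d d0 d1 d2 ->
  tjet2 (fun t => c t *m d t) (c0 *m d0) (c0 *m d1 + c1 *m d0)
    (c0 *m d2 + c1 *m d1 + c2 *m d0).
Proof.
move=> hc hd.
have h1 := isOM hc (tjet2_bounded hd).
have h2 := isOM (isO_poly c0 c1 c2) hd.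
have h3 := isO_tpow 3 (c1 *m d2 + c2 *m d1).
have h4 := isO_weak small01 (leqnSn 3) (isO_tpow 4 (c2 *m d2)).
apply: isO_eq (isOD (isOD h1 h2) (isOD h3 h4)) => t _ /=.
have e p q : (c t - p) *m d t + p *m (d t - q) = c t *m d t - p *m q.
  by rewrite mulmxBl mulmxBr addrA subrK.
rewrite e quad_mulmx; set X := mkC (t ^+ 3) 0 *: _ + _; move: X => X.
by rewrite opprD addrA subrK.
Qed.

Lemma tjet2_rinner (c : R -> M) (c0 c1 c2 : M) : tjet2 c c0 c1 c2 ->
  isOr small absv 3 (fun t => rinner (c t) (c t) - rinner c0 c0
    - t * (2 * rinner c0 c1) - t ^+ 2 * (rinner c1 c1 + 2 * rinner c0 c2)).
Proof.
move=> hc.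
have h1 := isO_rinner hc (tjet2_bounded hc).
have h2 := isO_rinner (isO_poly c0 c1 c2) hc.
have h3 := isO_rinner (isO_tpow 1 c1) (isO_tpow 2 c2).
have h4 := isO_weak small01 (leqnSn 3) (isO_tpowM 2 (isO_tpow 2 c2)).
have {}h4 := isO_rinner (isO_cst _ _ c2) h4.
apply: isOr_eq (isOrD (isOrD h1 h2) (isOrD (isOrD h3 h3) h4)) => t _ /=.
rewrite !(rinnerBl, rinnerBr, rinnerDl, rinnerDr, rinnerZl, rinnerZr).
rewrite ?(rinnerC c1 c0) ?(rinnerC c2 c0) ?(rinnerC c2 c1).
move: (rinner (c t) (c t)) (rinner c0 (c t)) (rinner c1 (c t)) (rinner c2 (c t)).
move: (rinner c0 c0) (rinner c0 c1) (rinner c0 c2) (rinner c1 c1).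
move: (rinner c1 c2) (rinner c2 c2) => *; ring.
Qed.

Lemma unitary_KV (Q : M) : Q^t* *m Q = 1%:M -> Q \is unitarymx.
Proof. by move=> h; apply/unitarymxP; apply: mulmx1C. Qed.

Lemma unitary_col (Q : M) j : Q^t* *m Q = 1%:M -> \sum_i sq (Q i j) = 1.
Proof.
move=> /matrixP/(_ j j); rewrite !mxE eqxx => /(congr1 re) /=.
by rewrite re_sum => <-; apply: eq_bigr => i _; rewrite !mxE conj_mul_sq.
Qed.

(** A bound for the norm of all unitary matrices: each entry has [cnorm] at
    most 2, because its column has unit length. *)
Definition ubound : R := (2 * n%:R * n%:R).

Lemma nrm_le_entry (X : M) (a : R) : (forall i j, cnorm (X i j) <= a) ->
  nrm X <= n%:R * n%:R * a.
Proof.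
move=> h; apply: (@le_trans _ _ (\sum_(i < n) \sum_(j < n) a)).
  by apply: ler_sum => i _; apply: ler_sum => j _.
by rewrite sumr_const sumr_const !card_ord -[leRHS]mulrA !mulr_natl.
Qed.

Lemma unitary_nrm (Q : M) : Q^t* *m Q = 1%:M -> nrm Q <= ubound.
Proof.
move=> hQ; rewrite /ubound -mulrA mulrC; apply: nrm_le_entry => i j.
rewrite -[leRHS]mulr1; apply: cnorm_le_sq => //; rewrite expr1n -(unitary_col j hQ).
by rewrite (bigD1 i) //= lerDl sumr_ge0 // => *; exact: sq_ge0.
Qed.

(** The norm of [Q^* A Q] is that of [A], so that the objective only depends
    on the diagonal of [Q^* A Q]. *)
Lemma fA_dg (A Q : M) : Q^t* *m Q = 1%:M ->
  fA A Q = rinner A A - rinner (dg (Q^t* *m A *m Q)) (dg (Q^t* *m A *m Q)).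
Proof.
move=> hQ; have hQ' := mulmx1C hQ; rewrite /fA rinner_offdiag.
rewrite (rinner_dg _ (dg _)) dgK -rinner_dg offdiagE rinnerBl; congr (_ - _).
by rewrite rinner_mulrV -mulmxA rinner_mullV trmxCK -!mulmxA hQ' mulmx1 mulmxA hQ' mul1mx.
Qed.

(** A curve of unitary matrices with prescribed velocity.  The Cayley
    transform [(1 + t S) (1 - t S)^-1] stands in for the exponential: it is
    unitary for algebraic reasons, and its expansion follows from the identity
    [N = 1 + t S N] for [N = (1 - t S)^-1], once [N] is known to be bounded. *)
Section Cayley.
Variable S : M.
Hypothesis hS : S^t* = - S.

Let st (t : R) : M := mkC t 0 *: S.
Lemma adj_st t : (st t)^t* = - st t.
Proof. by rewrite /st adjZ hS scalerN. Qed.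

Let N t := invmx (1%:M - st t).
Let cay t : M := (1%:M + st t) *m N t.

(** [1 - t S] is injective: [K = K (t S)] makes [|K|^2] equal to its
    opposite. *)
Lemma cayN t : (1%:M - st t) *m N t = 1%:M.
Proof.
apply: mulmxV; rewrite -row_free_unit -kermx_eq0; apply/eqP.
have := mulmx_ker (1%:M - st t); move: (kermx _) => K.
rewrite mulmxBr mulmx1 => /eqP; rewrite subr_eq0 => /eqP hK.
apply: rinner_eq0; have : rinner K K = - rinner K K.
  by rewrite -rinnerNr {1 4}hK rinner_mulrV adj_st mulmxN.
lra.
Qed.

Lemma cay_unitary t : (cay t)^t* *m cay t = 1%:M.
Proof.
have h : (N t)^t* *m (1%:M + st t) = 1%:M.
  have := congr1 (fun X : M => X^t*) (cayN t).
  by rewrite adjM adjB adj1 adj_st opprK.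
rewrite /cay adjM adjD adj1 adj_st.
have comm : (1%:M - st t) *m (1%:M + st t) = (1%:M + st t) *m (1%:M - st t).
  by rewrite !mxdistr !mul1mx !mulmx1; mxab.
rewrite mulmxA -[_ *m (1%:M + st t)]mulmxA comm mulmxA h mul1mx.
by rewrite cayN.
Qed.

Lemma cayE t : cay t = N t + N t - 1%:M.
Proof.
by rewrite -(cayN t) /cay !mxdistr !mul1mx; mxab.
Qed.

(** The bound comes from [2 N - 1] being unitary. *)
Lemma N_bounded : tO 0 N.
Proof.
have h : tO 0 cay.
  exists ubound => [|t _]; first by rewrite !mulr_ge0.
  by rewrite expr0 mulr1 unitary_nrm ?cay_unitary.
apply: isO_eq (isOZ (2^-1) (isOD h (isO_cst _ _ 1%:M))) => t _.
rewrite cayE subrK scalerDr -scalerDl -mkCD.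
by rewrite (_ : 2^-1 + 2^-1 = 1) ?scale1r //; lra.
Qed.

Lemma tjet2_cay : tjet2 cay 1%:M (mkC 2 0 *: S) (mkC 2 0 *: (S *m S)).
Proof.
have h := isOZ 2 (isO_tpowM 3 (isOM (isO_cst _ _ (S *m S *m S)) N_bounded)).
apply: isO_eq h => t _ /=; rewrite cayE.
(* Substituting N = 1 + t S N into itself three times leaves t^3 S^3 N as
   the remainder. *)
have e1 : N t = 1%:M + mkC t 0 *: (S *m N t).
  by rewrite scalemxAl -/(st t) -{1}(cayN t) mulmxBl mul1mx subrK.
have e2 X : mkC t 0 *: (X *m N t) = mkC t 0 *: X + mkC (t ^+ 2) 0 *: (X *m S *m N t).
  by rewrite [in LHS]e1 mulmxDr mulmx1 scalerDr -scalemxAr scalerA -mkCM mulmxA.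
have e3 X : mkC (t ^+ 2) 0 *: (X *m N t) = mkC (t ^+ 2) 0 *: X + mkC (t ^+ 3) 0 *: (X *m S *m N t).
  by rewrite [in LHS]e1 mulmxDr mulmx1 scalerDr -scalemxAr scalerA -mkCM mulmxA -exprSr.
have double (Y Nt : M) : Nt = 1%:M + (mkC t 0 *: S + (mkC (t ^+ 2) 0 *: (S *m S) + Y)) ->
    mkC 2 0 *: Y = Nt + Nt - 1%:M -
      (1%:M + mkC t 0 *: (mkC 2 0 *: S) + mkC (t ^+ 2) 0 *: (mkC 2 0 *: (S *m S))).
  by move=> ->; rewrite (_ : mkC 2 0 = 2); [mxab|rewrite mkCD mkC1].
by apply: double; rewrite {1}e1 e2 e3.
Qed.

End Cayley.
End LocalMin.
Section SecondOrder.
Context {R : realType} {n : nat}.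
Local Notation M := 'M[Cplx R]_n.
Implicit Types (X Y Z A B Q W S : M).

(** [2 <[D, W], B>] is the derivative of [f_A] in direction [W]. *)
Definition critical B : Prop :=
  forall W, W^t* = - W -> rinner (cm (dg B) W) B = 0.

(** All skew-Hermitian directions are admitted, also those tangent to a class,
    because the comparison curves are curves in the unitary group. *)
Definition psd B : Prop := forall W, W^t* = - W -> 0 <= hessform B W.

(** The first- and second-derivative tests for a function of one real
    variable known up to a cubic error. *)
Lemma second_order_test (a b C d : R) : 0 < d -> 0 <= C ->
  (forall t, `|t| < d -> 0 <= t * a + t ^+ 2 * b + C * `|t| ^+ 3) ->
  a = 0 /\ 0 <= b.
Proof.
have ge0 a' b' : 0 < d -> 0 <= C ->
  (forall t, 0 < t -> t < d -> 0 <= t * a' + t ^+ 2 * b' + C * t ^+ 3) -> 0 <= a'.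
  move=> d0 C0 h; rewrite leNgt; apply/negP => a0.
  set k := `|b'| + C + 1.
  have k0 : 0 < k by rewrite /k; have := normr_ge0 b'; lra.
  set t := Num.min (Num.min (d / 2) 1) (- a' / (2 * k)).
  have t0 : 0 < t.
    rewrite /t !lt_min ltr01 !divr_gt0 ?oppr_gt0 //; lra.
  have td : t < d.
    by apply: le_lt_trans (_ : d / 2 < _); [rewrite /t !ge_min lexx|lra].
  have t1 : t <= 1 by rewrite /t !ge_min lexx orbT.
  have tk : t * k <= - a' / 2.
    have : t <= - a' / (2 * k) by rewrite /t !ge_min lexx !orbT.
    rewrite ler_pdivlMr; last by rewrite mulr_gt0.
    lra.
  have h2 : 0 <= a' + t * b' + C * (t * t).
    have -> : a' + t * b' + C * (t * t) = t^-1 * (t * a' + t ^+ 2 * b' + C * t ^+ 3).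
      by field; exact: lt0r_neq0.
    by rewrite mulr_ge0 ?h // invr_ge0 ltW.
  have h3 : t * b' <= t * `|b'| by rewrite ler_pM2l ?ler_norm.
  have h4 : C * (t * t) <= C * t by rewrite ler_wpM2l // ger_pMr.
  rewrite /k in tk; nra.
move=> d0 C0 h.
have a0 : a = 0.
  apply: le_anti; apply/andP; split.
    rewrite -oppr_ge0; apply: (ge0 _ b) => // t t0 td.
    by have := h (- t); rewrite normrN gtr0_norm // => /(_ td); rewrite sqrrN mulNr mulrN.
  by apply: (ge0 _ b) => // t t0 td; have := h t; rewrite gtr0_norm // => /(_ td).
split => //; apply: (ge0 _ C) => // t t0 td.
have := h t; rewrite gtr0_norm // a0 => /(_ td) h1.
have -> : t * b + t ^+ 2 * C + C * t ^+ 3 =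
    t^-1 * (t * 0 + t ^+ 2 * b + C * t ^+ 3) + C * t ^+ 3.
  by field; exact: lt0r_neq0.
by rewrite addr_ge0 ?mulr_ge0 ?invr_ge0 ?exprn_ge0 ?(ltW t0).
Qed.

Lemma tjet2_eq (c : R -> M) (c0 c1 c2 d0 d1 d2 : M) : c0 = d0 -> c1 = d1 -> c2 = d2 ->
  tjet2 c c0 c1 c2 -> tjet2 c d0 d1 d2.
Proof. by move=> -> -> ->. Qed.

Lemma tjet2_conj (c : R -> M) B W X : W^t* = - W -> X^t* = X -> tjet2 c 1%:M W X ->
  tjet2 (fun t => (c t)^t* *m B *m c t) B (cm B W) (B *m X - W *m B *m W + X *m B).
Proof.
move=> hW hX Jc.
apply: tjet2_eq (tjet2M (tjet2M (tjet2_adj Jc) (tjet2_cst B)) Jc).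
- by rewrite adj1 mul1mx mulmx1.
- by rewrite adj1 mul1mx mulmx0 add0r mulmx1 hW mulNmx.
- by rewrite hX adj1 hW mul1mx !mulmx0 add0r add0r add0r mulmx1 mulNmx mulNmx.
Qed.

(** For [X = W^2 / 2] the second-order coefficient of [c^* B c] is half the
    double bracket, as it is for the exponential. *)
Lemma cm_cm B W X : mkC 2 0 *: X = W *m W ->
  mkC 2 0 *: (B *m X - W *m B *m W + X *m B) = cm (cm B W) W.
Proof.
move=> hX; rewrite scalerDr scalerBr -(mxZr _ B X) -(mxZl _ X B) hX.
rewrite (_ : mkC 2 0 = 2); last by rewrite mkCD mkC1.
by rewrite !cmE !mxdistr !mxA; mxab.
Qed.

(** By [fA_dg] the objective is a constant minus [|diag (c^* B c)|^2] along the
    Cayley curve [c] through [W]; its expansion to second order has the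
    coefficients [2 <[D, W], B>] and [hessform B W / 2]. *)
Lemma second_order_necessary A Q (e : R) : 0 < e -> Q^t* *m Q = 1%:M ->
  (forall P : M, P^t* *m P = 1%:M -> nrm (P - Q) < e -> fA A Q <= fA A P) ->
  critical (Q^t* *m A *m Q) /\ psd (Q^t* *m A *m Q).
Proof.
move=> e0 hQ hmin; set B := Q^t* *m A *m Q.
suff H W : W^t* = - W -> rinner (cm (dg B) W) B = 0 /\ 0 <= hessform B W.
  by split=> W /H[].
move=> hW; have [S hS SW] : exists2 S : M, S^t* = - S & mkC 2 0 *: S = W.
  exists (mkC (2^-1) 0 *: W); first by rewrite adjZ hW scalerN.
  by rewrite scalerA -mkCM divff ?pnatr_eq0 // mkC1 scale1r.
pose c t := (1%:M + mkC t 0 *: S) *m invmx (1%:M - mkC t 0 *: S).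
have cU t : (c t)^t* *m c t = 1%:M by exact: cay_unitary.
have Jc : tjet2 c 1%:M W (mkC 2 0 *: (S *m S)) by rewrite -[X in tjet2 _ _ X]SW; exact: tjet2_cay.
have adjSS : (mkC 2 0 *: (S *m S))^t* = mkC 2 0 *: (S *m S).
  by rewrite adjZ adjM hS mulNmx mulmxN opprK.
have JB := tjet2_conj B hW adjSS Jc.
pose B1 := cm B W.
set B2 := B *m (mkC 2 0 *: (S *m S)) - _ + _ in JB.
have B2E : mkC 2 0 *: B2 = cm B1 W.
  by apply: cm_cm; rewrite -[in RHS]SW -scalemxAl -scalemxAr.
move: B2 JB B2E => B2 JB B2E.
have [C C0 HC] := tjet2_rinner (tjet2_dg JB).
have [C' C'0 HC'] : isO small absv 1 (fun t => c t - 1%:M).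
  have h3 := isO_weak small01 (_ : 1 <= 3)%N Jc.
  have h2 := isO_weak small01 (_ : 1 <= 2)%N (isO_tpow 2 (mkC 2 0 *: (S *m S))).
  have h1 := isO_tpow 1 W.
  apply: isO_eq (isOD (h3 isT) (isOD h1 (h2 isT))) => t _.
  by rewrite expr1; mxab.
pose K := nrm Q * C' + 1.
have K0 : 0 < K by rewrite /K ltr_wpDl // mulr_ge0 // nrm_ge0.
have [g0 h0] : 2 * rinner (cm (dg B) W) B = 0 /\ 0 <= 2^-1 * hessform B W.
  apply: (@second_order_test _ _ C (Num.min 1 (e / K))) => //.
    by rewrite lt_min ltr01 divr_gt0.
  move=> t; rewrite lt_min ltr_pdivlMr // => /andP[t1 te].
  have Dt : small t by exact: ltW.
  have uP : (Q *m c t)^t* *m (Q *m c t) = 1%:M.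
    by rewrite adjM mulmxA -[_ *m Q]mulmxA hQ mulmx1 cU.
  have near_Q : nrm (Q *m c t - Q) < e.
    rewrite -{2}[Q]mulmx1 -mulmxBr; apply: le_lt_trans (nrmM _ _) _.
    apply: le_lt_trans te.
    have := HC' t Dt; rewrite expr1 /absv => h.
    have := ler_wpM2l (nrm_ge0 Q) h; have := normr_ge0 t; rewrite /K; nra.
  have hB : (Q *m c t)^t* *m A *m (Q *m c t) = (c t)^t* *m B *m c t.
    by rewrite adjM /B !mulmxA.
  have := hmin _ uP near_Q; rewrite fA_dg // fA_dg // hB -/B lerD2l lerN2.
  have dg2 X Y : rinner (dg X) (dg Y) = rinner (dg X) Y by rewrite -rinner_dg dgK.
  (* The brackets are moved from B1 and B2 to the diagonal of B. *)
  have eg : rinner (dg B) (dg B1) = - rinner (cm (dg B) W) B.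
    by rewrite dg2 (rinner_cm _ _ hW) opprK.
  have eh : 2 * rinner (dg B) (dg B2) = - rinner (cm (dg B) W) B1.
    by rewrite dg2 -rinnerZr B2E (rinner_cm _ _ hW) opprK.
  have := HC t Dt; rewrite eg eh (dg2 B1) /absv /hessform -/B1.
  move: (rinner (dg (_ *m _)) _) (rinner (dg B) (dg B)) (rinner (dg B1) B1) => x y q.
  move: (rinner _ B) (rinner _ B1) => g r; rewrite ler_norml => /andP[h1 h2] h3.
  lra.
split; first by move: g0; lra.
by move: h0; lra.
Qed.

End SecondOrder.

(** * Normal form and degenerate Hessians *)

Section NormalForm.
Context {R : realType} {n : nat}.
Local Notation M := 'M[Cplx R]_n.
Implicit Types (X Y Z A B Q W V D E : M).

Lemma adj_cm X Y : (cm X Y)^t* = cm (Y^t*) (X^t*).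
Proof. by rewrite !cmE adjB !adjM. Qed.

Lemma rinner_cml X Y Z : rinner (cm X Y) Z = rinner Y (cm (X^t*) Z).
Proof. by rewrite !cmE rinnerBl rinnerBr rinner_mullV rinner_mulrV. Qed.

Lemma jacobi X Y Z : cm (cm X Y) Z - cm (cm X Z) Y = cm X (cm Y Z).
Proof.
rewrite !cmE !mxdistr.
by rewrite !mxA; mxab.
Qed.

(** Brackets with commuting matrices commute. *)
Lemma cm_comm X Y Z : cm X Y = 0 -> cm X (cm Y Z) = cm Y (cm X Z).
Proof.
by move=> h; rewrite -jacobi h [RHS]cmC [cm 0 _]cmE mul0mx mulmx0 subrr sub0r.
Qed.

Lemma cm_dgE X Y i j : cm (dg X) Y i j = (X i i - X j j) * Y i j.
Proof.
rewrite cmE addE oppE dg_mull dg_mulr; ring.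
Qed.

Lemma cm_dg_dg X Y : cm (dg X) (dg Y) = 0.
Proof.
apply/matrixP => i j; rewrite cm_dgE dgE zeroE.
by case: eqP => [->|_]; rewrite ?subrr ?mul0r ?mulr0.
Qed.

Lemma dg_cm_dg X Y : dg (cm (dg X) Y) = 0.
Proof. by apply/matrixP => i j; rewrite dgE cm_dgE subrr mul0r zeroE if_same. Qed.

Lemma offdiag_cm_dg X Y : offdiag (cm (dg X) Y) = cm (dg X) Y.
Proof. by rewrite offdiagE dg_cm_dg subr0. Qed.

Lemma offdiag_dg X : offdiag (dg X) = 0.
Proof. by rewrite offdiagE dgK subrr. Qed.

Lemma offdiag0 : offdiag (0 : M) = 0.
Proof. by apply/matrixP => i j; rewrite offdiag_ij zeroE if_same. Qed.

Lemma dg_adj X : (dg X)^t* = dg (X^t*).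
Proof.
apply/matrixP => i j; rewrite mxE mxE !dgE eq_sym.
by case: eqP => [->|_]; rewrite ?conjC0 // !mxE.
Qed.

Lemma rinner_dg0 X Y : dg Y = 0 -> rinner (dg X) Y = 0.
Proof. by move=> h; rewrite rinner_dg h rinner0r. Qed.

(** Entrywise, [W_ij conj H_ij] is the opposite of the conjugate of its mirror
    [W_ji conj H_ji], and the two factors [d_i - d_j] and [e_i - e_j] both
    change sign; so exchanging [W] and [H] changes the sign of the sum of real
    parts. *)
Lemma rinner_cm_swap D E W H : dg D = D -> dg E = E -> W^t* = - W -> H^t* = H ->
  rinner (cm D W) (cm E H) = - rinner (cm D H) (cm E W).
Proof.
move=> hD hE hW hH.
have comm : cm D (cm (E^t*) H) = cm (E^t*) (cm D H).
  by apply: cm_comm; rewrite -hE -hD dg_adj cm_dg_dg.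
rewrite -rinner_adj !adj_cm hW hH cmNl rinnerNl; congr (- _).
rewrite cmC rinnerNl [cm H _]cmC rinnerNr opprK rinner_cml trmxCK comm rinnerC.
by rewrite rinner_cml trmxCK.
Qed.

(** [<[D, W], B> = <W, [D^*, B]>] vanishes for all skew-Hermitian [W]. *)
Lemma critical_herm B : critical B ->
  (cm ((dg B)^t*) B)^t* = cm ((dg B)^t*) B.
Proof.
move=> hc; set G := cm _ B.
have hs : skew G = 0.
  apply: rinner_eq0; have hsk := skew_adj G.
  by rewrite (rinner_skew _ hsk) rinnerC /G -(rinner_cml (dg B)) hc.
apply/esym/eqP; rewrite -subr_eq0; apply/eqP.
move: hs => /(congr1 (fun X : M => (2 : Cplx R) *: X)).
by rewrite skewE scalerA divff ?pnatr_eq0 // scale1r scaler0.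
Qed.

Lemma critical_entry B i j : critical B ->
  Num.conj (B i i - B j j) * B i j = - ((B i i - B j j) * Num.conj (B j i)).
Proof.
move=> /critical_herm/matrixP/(_ i j); rewrite mxE mxE dg_adj !cm_dgE !mxE.
rewrite !rmorphM !rmorphB /= !conjCK => <-; ring.
Qed.

(** For [W] supported on the positions [(i, j)] and [(j, i)] the bracket
    [[D, W]] vanishes, since [d_i = d_j]; the second variation reduces to
    [- 2 |diag [B, W]|^2], which must vanish.  The two directions [z = 1] and
    [z = i] give [B_ij + B_ji = 0] and [B_ij - B_ji = 0]. *)
Lemma psd_entry B i j : psd B -> i != j -> B i i = B j j -> B i j = 0.
Proof.
move=> hp ij dij.
have key (z : Cplx R) : B i j * Num.conj z + z * B j i = 0.
  pose W : M := z *: delta_mx i j - Num.conj z *: delta_mx j i.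
  have hW : W^t* = - W.
    apply/matrixP => a b; rewrite !mxE rmorphB !rmorphM /= conjCK !conjC_nat.
    by rewrite (andbC (b == i)) (andbC (b == j)); ring.
  have h0 : cm (dg B) W = 0.
    apply/matrixP => a b; rewrite cm_dgE addE oppE !scaleE !(mxE, zeroE).
    have [/andP[/eqP -> /eqP ->]|_] := boolP ((a == i) && (b == j)).
      by rewrite dij subrr mul0r.
    have [/andP[/eqP -> /eqP ->]|_] := boolP ((a == j) && (b == i)).
      by rewrite dij subrr mul0r.
    by rewrite !mulr0 subr0 mulr0.
  have := hp W hW; rewrite /hessform h0 rinner0l mulr0 add0r oppr_ge0.
  have -> : rinner (dg (cm B W)) (cm B W) = rinner (dg (cm B W)) (dg (cm B W)).
    by rewrite -rinner_dg dgK.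
  move=> hle; have hz : dg (cm B W) = 0.
    by apply: rinner_eq0; have := rinner_ge0 (dg (cm B W)); lra.
  move/matrixP: hz => /(_ i i); rewrite dgE eqxx zeroE cmE addE oppE !mxE.
  rewrite (bigD1 j) 1?eq_sym //= big1 => [|k kj]; last first.
    by rewrite !mxE (negPf kj) (negPf ij) andbF /=; ring.
  rewrite (bigD1 j) 1?eq_sym //= big1 => [|k kj]; last first.
    by rewrite !mxE (negPf kj) (negPf ij) andbF /=; ring.
  rewrite !mxE !eqxx (negPf ij) [j == i]eq_sym (negPf ij) /= => h.
  by apply: oppr_inj; rewrite oppr0 -[RHS]h; ring.
have k1 := key 1; have ki := key (mkC 0 1).
rewrite conjC1 mulr1 mul1r in k1.
have ci : Num.conj (mkC 0 1) = - mkC 0 1 :> Cplx R.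
  by apply: cplxP; rewrite ?re_conj ?im_conj ?reN ?imN /= ?oppr0.
have i0 : mkC 0 1 != 0 :> Cplx R.
  by apply/eqP => /(congr1 im) /= /eqP; rewrite oner_eq0.
move: ki; rewrite ci => /eqP.
have -> : B i j * - mkC 0 1 + mkC 0 1 * B j i = - (2 * mkC 0 1 * B i j) + mkC 0 1 * (B i j + B j i).
  by ring.
by rewrite k1 mulr0 addr0 oppr_eq0 !mulf_eq0 pnatr_eq0 (negPf i0) /= => /eqP.
Qed.

(** [W_ij = B_ij / (d_i - d_j)], Hermitian by [critical_entry].  Since the
    inverse of zero is zero, the formula also covers equal diagonal entries,
    where [B_ij] vanishes. *)
Lemma normal_form B : critical B -> psd B -> exists W : M,
  [/\ W^t* = W, dg W = 0 & B = dg B + cm (dg B) W].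
Proof.
move=> hc hp; exists (\matrix_(i, j) (B i j / (B i i - B j j))); split.
- apply/matrixP => i j; rewrite !mxE rmorphM fmorphV.
  have h := critical_entry i j hc; set d := B i i - B j j in h *.
  have -> : B j j - B i i = - d by rewrite /d opprB.
  rewrite rmorphN /= invrN mulrN.
  have [d0|d0] := eqVneq d 0; first by rewrite d0 conjC0 !invr0 !mulr0 oppr0.
  have cd0 : Num.conj d != 0 by rewrite conjC_eq0.
  apply: (mulfI d0); apply: (mulfI cd0).
  transitivity (- (d * Num.conj (B j i))); first by field.
  by rewrite -h; field.
- apply/matrixP => i j; rewrite dgE zeroE; case: eqP => // ->.
  by rewrite mxE subrr invr0 mulr0.
apply/matrixP => i j; rewrite addE cm_dgE dgE mxE.
case: (eqVneq i j) => [->|ij]; first by rewrite subrr invr0 mul0r addr0.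
have [d0|d0] := eqVneq (B i i - B j j) 0.
  by rewrite d0 invr0 mulr0 mulr0 addr0 psd_entry //; apply/eqP; rewrite -subr_eq0 d0.
by rewrite add0r mulrCA divff // mulr1.
Qed.

(** [V] is orthogonal to the three kinds of velocities of the map
    [(Q, D, W) |-> Q (D + [D, W]) Q^*], read in the frame [Q]: moving [Q] along
    a skew-Hermitian [H], [D] along a diagonal [E], [W] along a
    Hermitian [H]. *)
Definition conormal D W V : Prop :=
  [/\ forall H, H^t* = - H -> rinner V (cm (D + cm D W) H) = 0,
      forall E, dg E = E -> rinner V (E + cm E W) = 0 &
      forall H, H^t* = H -> rinner V (cm D H) = 0].

Lemma hessform_line B W H (t : R) :
  hessform B (W + mkC t 0 *: H) = hessform B W +
    (t * (2 * rinner (cm (dg B) W) (cm B H) + 2 * rinner (cm (dg B) H) (cm B W)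
          - 4 * rinner (dg (cm B W)) (cm B H)) + t ^+ 2 * hessform B H).
Proof.
rewrite /hessform !(cmDr, cmZr).
move: (cm (dg B) W) (cm (dg B) H) (cm B W) (cm B H) => DW DH BW BH.
rewrite dgD dgZ !(rinnerDl, rinnerDr, rinnerZl, rinnerZr).
rewrite (rinner_dg BH BW) [rinner BH _]rinnerC.
move: (rinner DW BW) (rinner DW BH) (rinner DH BW) (rinner DH BH).
move: (rinner (dg BW) BW) (rinner (dg BW) BH) (rinner (dg BH) BH) => *; ring.
Qed.

(** A null vector [H] of a nonnegative form lies in its radical, so
    [V = [D, H] - diag [B, H]] is orthogonal to all [[B, K]]; that the bilinear
    form is symmetric is the Jacobi identity together with criticality.  The
    other two orthogonality relations follow from [rinner_cm_swap].  [V] is not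
    zero because its off-diagonal entries are [(d_i - d_j) H_ij]. *)
Lemma degenerate_conormal B W (H : M) : critical B -> psd B ->
  (forall i j, i != j -> B i i != B j j) ->
  W^t* = W -> B = dg B + cm (dg B) W ->
  H^t* = - H -> dg H = 0 -> H != 0 -> hessform B H = 0 ->
  exists2 V, V != 0 & conormal (dg B) W V.
Proof.
move=> hc hp dB hW BE hH dH H0 hz.
have [D DE] : exists D, D = dg B by exists (dg B).
have DK : dg D = D by rewrite DE dgK.
have dgD_ X : dg (cm D X) = 0 by rewrite DE dg_cm_dg.
have {}hc K : K^t* = - K -> rinner (cm D K) B = 0 by move=> hK; rewrite DE hc.
rewrite -DE in BE *; exists (cm D H - dg (cm B H)).
  apply: contra_neq H0 => /(congr1 offdiag).
  rewrite offdiagB offdiag_dg subr0 DE offdiag_cm_dg offdiag0 => h.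
  apply/matrixP => i j; rewrite zeroE.
  have [<-|ij] := eqVneq i j.
    by move/matrixP: dH => /(_ i i); rewrite dgE eqxx zeroE.
  move/matrixP: h => /(_ i j); rewrite cm_dgE zeroE => /eqP.
  by rewrite mulf_eq0 subr_eq0 (negPf (dB i j ij)) => /eqP.
split.
- move=> K hK; rewrite -BE.
  have sym : rinner (cm D K) (cm B H) = rinner (cm D H) (cm B K).
    have hHK : (cm H K)^t* = - cm H K by rewrite adj_cm hH hK cmNl cmNr opprK cmC.
    have arith (a b x y : R) : a = - x -> b = - y -> a - b = 0 -> y = x by lra.
    have e := hc _ hHK; rewrite -jacobi rinnerBl in e.
    exact: arith (rinner_cm (cm D H) B hK) (rinner_cm (cm D K) B hH) e.
  (* Nonnegativity along H + t K, whose constant term vanishes, kills the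
     linear term. *)
  have [/eqP h4 _] : 4 * rinner (cm D H - dg (cm B H)) (cm B K) = 0 /\ 0 <= hessform B K.
    apply: (second_order_test (C := 0) (d := 1)) => [||t _]; [exact: ltr01|exact: lexx|].
    rewrite mul0r addr0; have hHK : (H + mkC t 0 *: K)^t* = - (H + mkC t 0 *: K).
      by rewrite adjD adjZ hH hK scalerN opprD.
    have := hp _ hHK; rewrite hessform_line hz -DE sym rinnerBl add0r.
    move: (rinner _ _) (rinner _ _) (hessform _ _) => x y z.
    by congr (0 <= _ + _); congr (_ * _); ring.
  by move: h4; rewrite mulf_eq0 pnatr_eq0 /= => /eqP.
- move=> E hE.
  have dgE_ X : dg (cm E X) = 0 by rewrite -hE dg_cm_dg.
  have e1 : rinner (cm D H) E = 0 by rewrite rinnerC -hE rinner_dg0.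
  have e2 : rinner (dg (cm B H)) (cm E W) = 0 by rewrite rinner_dg0.
  have e3 : rinner D (cm E H) = 0 by rewrite -DK rinner_dg0.
  have e4 : rinner (dg (cm B H)) E = rinner (cm D H) (cm E W).
    rewrite rinner_dg hE (rinner_cm B E hH) {1}BE rinnerDl e3 add0r.
    by rewrite (rinner_cm_swap DK hE hH hW).
  by rewrite rinnerDr rinnerBl rinnerBl e1 e2 e4 sub0r subr0 addrC subrr.
move=> K hK; rewrite rinnerBl (rinner_dg0 _ (dgD_ K)) subr0.
have := rinner_cm_swap DK DK hH hK; rewrite [in RHS]rinnerC.
by move: (rinner _ _) => x; lra.
Qed.

End NormalForm.

(** * Null sets *)

Section Null.
Context {R : realType}.

Lemma ler_sum_sub (I : eqType) (s s' : seq I) (w : I -> R) :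
  uniq s -> uniq s' -> {subset s <= s'} -> (forall i, 0 <= w i) ->
  \sum_(i <- s) w i <= \sum_(i <- s') w i.
Proof.
move=> us us' ss' w0; rewrite [leRHS](bigID (mem s)) /=.
have ps : perm_eq s [seq x <- s' | x \in s].
  apply: uniq_perm; rewrite ?filter_uniq // => i.
  by rewrite mem_filter andb_idr // => /ss'.
by rewrite (perm_big _ ps) /= big_filter lerDl sumr_ge0.
Qed.

Lemma sum_half (m : nat) (e : R) : 0 <= e ->
  \sum_(0 <= k < m) e / 2 ^+ k.+1 <= e.
Proof.
move=> e0; suff -> : \sum_(0 <= k < m) e / 2 ^+ k.+1 = e - e / 2 ^+ m.
  by rewrite gerBl divr_ge0 // exprn_ge0.
elim: m => [|m IH]; first by rewrite big_nil expr0 divr1 subrr.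
rewrite big_nat_recr //= IH exprS; field.
by rewrite expf_neq0.
Qed.

(** Finitely many positions of the enumeration of pairs lie in a square, where
    the double sum can be taken row by row. *)
Lemma sum_pickle (w : nat -> nat -> R) (u : nat -> R) (n : nat) :
  (forall K k, 0 <= w K k) -> (forall K m, \sum_(0 <= k < m) w K k <= u K) ->
  exists m, \sum_(0 <= i < n) oapp (fun p : nat * nat => w p.1 p.2) 0 (pickle_inv i)
    <= \sum_(0 <= K < m) u K.
Proof.
move=> w0 wu; set s := pmap (@pickle_inv (nat * nat)%type) (iota 0 n).
have [m hm] : exists m, forall p : nat * nat, p \in s -> (p.1 < m)%N && (p.2 < m)%N.
  exists (\max_(p <- s) (maxn p.1 p.2)).+1 => p ps; rewrite !ltnS -geq_max.
  exact: (@leq_bigmax_seq _ _ xpredT (fun p : nat * nat => maxn p.1 p.2) p ps isT).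
exists m; rewrite /index_iota subn0 -big_pmap -/s.
apply: le_trans (_ : \sum_(p <- [seq (i, j) | i <- iota 0 m, j <- iota 0 m]) w p.1 p.2 <= _).
  apply: ler_sum_sub => //.
  - by apply: pmap_uniq (iota_uniq _ _); exact: pickle_invK.
  - by apply: allpairs_uniq; rewrite ?iota_uniq // => -[a b] [c d].
  - move=> [a b] /hm /= /andP[ha hb]; apply/allpairsP; exists (a, b).
    by rewrite /= !mem_iota !add0n.
rewrite big_allpairs /= subn0; apply: ler_sum => K _.
by have := wu K m; rewrite /index_iota subn0.
Qed.

Context {n : nat}.
Hypothesis n_gt0 : (0 < n)%N.
Local Notation M := 'M[Cplx R]_n.
Implicit Types (X Y A : M) (E : set M).

(** Finite covers by boxes of arbitrarily small total volume.  All null sets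
    below are countable unions of such sets, and no series occurs before that
    union is taken. *)
Definition jordan_null E : Prop := forall e : R, 0 < e -> exists s : seq (M * M),
  E `<=` [set X | exists2 b, b \in s & box b.1 b.2 X] /\
  \sum_(b <- s) box_volume b.1 b.2 <= e.

Lemma box_volume_ge0 X Y : 0 <= box_volume X Y.
Proof.
apply: prodr_ge0 => i _; apply: prodr_ge0 => j _.
by rewrite mulr_ge0 // le_max lexx.
Qed.

Lemma box_volume0 X : box_volume X X = 0.
Proof.
case: n n_gt0 X => // k _ X; rewrite /box_volume big_ord_recl big_ord_recl.
by rewrite !subrr maxxx !mul0r.
Qed.

(** The [K]-th set gets volume [e / 2^(K+1)].  The boxes form a family indexed
    by pairs, enumerated by [pickle]; positions that encode no pair get a box
    reduced to a point. *)
Lemma null_bigcup (E : nat -> set M) : (forall K, jordan_null (E K)) ->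
  lebesgue_null (\bigcup_K E K).
Proof.
move=> hE; apply/eqP; rewrite eq_le; apply/andP; split; last first.
  apply: le_ereal_inf_tmp => _ [lo [hi [_ ->]]]; apply: nneseries_ge0 => k _ _.
  by rewrite lee_fin box_volume_ge0.
apply/lee_addgt0Pr => e e0; rewrite add0e.
have pe K : 0 < e / 2 ^+ K.+1 by rewrite divr_gt0 // exprn_gt0.
have /choice[S hS] K := hE K _ (pe K).
pose b K k := nth ((0 : M), (0 : M)) (S K) k.
pose w K k := box_volume (b K k).1 (b K k).2.
pose bb i := oapp (fun p : nat * nat => b p.1 p.2) (0, 0) (pickle_inv i).
have w0 K k : 0 <= w K k by exact: box_volume_ge0.
have wu K m : \sum_(0 <= k < m) w K k <= e / 2 ^+ K.+1.
  apply: le_trans (hS K).2; rewrite (big_nth (0, 0)) -/(b K).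
  have [mS|Sm] := leqP m (size (S K)).
    rewrite (big_cat_nat _ mS) //= lerDl sumr_ge0 // => k _; exact: box_volume_ge0.
  have tail0 : \sum_(size (S K) <= k < m) w K k = 0.
    rewrite big_nat big1 // => k /andP[hk _].
    by rewrite /w /b nth_default // box_volume0.
  by rewrite (big_cat_nat (leq0n _) (ltnW Sm)) /= tail0 addr0.
apply: ge_ereal_inf.
exists (\sum_(0 <= k <oo) (box_volume (bb k).1 (bb k).2)%:E)%E.
  exists (fun i => (bb i).1), (fun i => (bb i).2); split=> // X [K _ EX].
  have [[lo hi] /= bS bX] := (hS K).1 X EX.
  exists (pickle (K, index (lo, hi) (S K))) => //=.
  by rewrite /bb pickleK_inv /= /b nth_index.
apply: lime_le; first by apply: is_cvg_nneseries => k _ _; rewrite lee_fin box_volume_ge0.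
apply: nearW => N; rewrite sumEFin lee_fin.
have [m hm] := sum_pickle N w0 wu.
apply: le_trans (le_trans hm (sum_half m (ltW e0))).
apply: ler_sum => i _; rewrite /bb; case: (pickle_inv i) => [p|] //=.
by rewrite box_volume0.
Qed.

Definition rdim : nat := #|{: 'I_n * 'I_n * bool}|.

(** The real coordinates, numbered so that a coordinate can be singled out with
    [lift]. *)
Definition co (k : 'I_rdim) X : R :=
  let: (i, j, b) := enum_val k in if b then im (X i j) else re (X i j).

Lemma rdimE : rdim = (n * n * 2)%N.
Proof. by rewrite /rdim !card_prod !card_ord card_bool. Qed.

Lemma rdim_gt0 : (0 < rdim)%N.
Proof. by rewrite rdimE !muln_gt0 n_gt0. Qed.

Lemma coB k X Y : co k (X - Y) = co k X - co k Y.
Proof.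
by rewrite /co; case: (enum_val k) => [[i j] []]; rewrite !(addE, oppE) ?imD ?imN ?reD ?reN.
Qed.

Lemma sum_co (F : R -> R -> R) X Y :
  \sum_k F (co k X) (co k Y) =
  \sum_i \sum_j (F (re (X i j)) (re (Y i j)) + F (im (X i j)) (im (Y i j))).
Proof.
pose G (p : 'I_n * 'I_n * bool) := let: (i, j, b) := p in
  if b then F (im (X i j)) (im (Y i j)) else F (re (X i j)) (re (Y i j)).
transitivity (\sum_(p : 'I_n * 'I_n * bool) G p).
  rewrite (reindex (enum_val : 'I_rdim -> _)) /=; last exact/onW_bij/enum_val_bij.
  by apply: eq_bigr => k _; rewrite /co /G; case: (enum_val k) => [[i j] []].
have e p : G p = G ((p.1.1, p.1.2), p.2) by case: p => [[i j] b].
rewrite (eq_bigr _ (fun p _ => e p)).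
rewrite -(pair_bigA _ (fun ij b => G ((ij.1, ij.2), b))) /=.
rewrite -(pair_bigA _ (fun i j => \sum_b G ((i, j), b))) /=.
apply: eq_bigr => i _; apply: eq_bigr => j _.
by rewrite big_bool /= addrC.
Qed.

Lemma nrm_co X : nrm X = \sum_k `|co k X|.
Proof. by rewrite (sum_co (fun x _ => `|x|) X X). Qed.

Lemma rinner_co X Y : rinner X Y = \sum_k co k X * co k Y.
Proof. by rewrite (sum_co *%R X Y) rinnerE. Qed.

Lemma co_le k X : `|co k X| <= nrm X.
Proof. by rewrite nrm_co (bigD1 k) //= lerDl sumr_ge0. Qed.

Lemma nrm_le_co X (a : R) : (forall k, `|co k X| <= a) -> nrm X <= rdim%:R * a.
Proof.
move=> h; rewrite nrm_co; apply: (@le_trans _ _ (\sum_(k < rdim) a)).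
  by apply: ler_sum => k _.
by rewrite sumr_const card_ord mulr_natl.
Qed.

Definition mkmx (f : R -> R) X : M := \matrix_(i, j) mkC (f (re (X i j))) (f (im (X i j))).

Lemma box_volume_cube X (r : R) : 0 <= r ->
  box_volume (mkmx (fun x => x - r) X) (mkmx (fun x => x + r) X) = (2 * r) ^+ rdim.
Proof.
move=> r0; rewrite /box_volume.
have e i j : Num.max 0 (re (mkmx (fun x => x + r) X i j) - re (mkmx (fun x => x - r) X i j)) *
   Num.max 0 (im (mkmx (fun x => x + r) X i j) - im (mkmx (fun x => x - r) X i j)) = (2 * r) ^+ 2.
  have h x : Num.max 0 (x + r - (x - r)) = 2 * r.
    by rewrite (_ : x + r - (x - r) = 2 * r) ?max_r ?mulr_ge0 //; ring.
  by rewrite !mxE /= !h expr2.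
rewrite (eq_bigr (fun _ => (2 * r) ^+ (2 * n))) => [|i _]; last first.
  by rewrite (eq_bigr _ (fun j _ => e i j)) prodr_const card_ord -exprM.
by rewrite prodr_const card_ord -exprM rdimE mulnC mulnA [(n * n * 2)%N]mulnC mulnA (mulnC n 2).
Qed.

Lemma in_cube X Y (r : R) : nrm (Y - X) <= r ->
  box (mkmx (fun x => x - r) X) (mkmx (fun x => x + r) X) Y.
Proof.
move=> h i j; rewrite !mxE /=.
have := le_trans (nrm_entry (Y - X) i j) h; rewrite /cnorm !(addE, oppE) reD reN imD imN => hr.
have a := normr_ge0 (re (Y i j) - re (X i j)); have b := normr_ge0 (im (Y i j) - im (X i j)).
have hre : `|re (Y i j) - re (X i j)| <= r by lra.
have him : `|im (Y i j) - im (X i j)| <= r by lra.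
move: hre him; rewrite !ler_norml => /andP[h1 h2] /andP[h3 h4].
by split; apply/andP; split; lra.
Qed.

(** A set of diameter [C / N^2] lies in a cube of volume [O (N^(- 2 d))], where
    [d] is the real dimension; hence [C N^(2 d - 1)] such sets have total
    volume [O (1 / N)].  Describing the sets by labels avoids constructing
    covers by hand: one has to say which finite data determines a point up to
    an error of [C / N^2]. *)
Lemma jordan_labels E (C : R) : 0 <= C ->
  (forall N : nat, (0 < N)%N -> exists (T : finType) (L : T -> set M),
    [/\ forall X, E X -> exists t, L t X,
        forall t X Y, L t X -> L t Y -> nrm (X - Y) <= C / N%:R ^+ 2 &
        #|T|%:R <= C * N%:R ^+ (rdim.*2.-1)]) ->
  jordan_null E.
Proof.
move=> C0 H e e0.
pose c := C * (2 * C) ^+ rdim / e.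
have c0 : 0 <= c by rewrite divr_ge0 ?mulr_ge0 ?exprn_ge0 ?mulr_ge0 // ltW.
pose N := (Num.Def.archi_bound c).+1.
have cN : c <= N%:R by apply: ltW; apply: lt_trans (archi_boundP c0) _; rewrite ltr_nat.
have N0 : (0 < N%:R :> R) by rewrite ltr0n.
have [T [L [Lcov Ldiam Tcard]]] := H N isT.
set r := C / N%:R ^+ 2.
have r0 : 0 <= r by rewrite divr_ge0 ?exprn_ge0 // ltW.
have /choice[rep hrep] (t : T) : exists X, (exists Y, L t Y) -> L t X.
  by have [[Y h]|h] := pselect (exists Y, L t Y); [exists Y|exists 0].
pose cube t := (mkmx (fun x => x - r) (rep t), mkmx (fun x => x + r) (rep t)).
exists [seq cube t | t <- enum T]; split.
  move=> X /Lcov[t LtX]; exists (cube t); first by apply: map_f; rewrite mem_enum.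
  by apply: in_cube; apply: (Ldiam t) => //; apply: hrep; exists X.
rewrite big_map big_enum /= (eq_bigr (fun _ => (2 * r) ^+ rdim)) => [|t _]; last first.
  exact: box_volume_cube.
rewrite sumr_const -[leLHS]mulr_natl.
apply: (@le_trans _ _ (C * N%:R ^+ (rdim.*2.-1) * (2 * r) ^+ rdim)).
  by rewrite ler_wpM2r ?exprn_ge0 ?mulr_ge0.
have -> : C * N%:R ^+ (rdim.*2.-1) * (2 * r) ^+ rdim = c * e / N%:R.
  have -> : (2 * r) ^+ rdim = (2 * C) ^+ rdim / N%:R ^+ (rdim.*2).
    by rewrite /r mulrA expr_div_n -exprM mul2n.
  rewrite /c divfK ?lt0r_neq0 //.
  have -> : rdim.*2 = (rdim.*2.-1).+1 by rewrite prednK // double_gt0 rdim_gt0.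
  move: (N%:R) N0 => a a0; rewrite [in LHS]exprS /=; field.
  by rewrite expf_neq0 ?lt0r_neq0.
by rewrite ler_pdivrMr // mulrC ler_pM2l.
Qed.

End Null.

Section Sard.
Context {R : realType} {n : nat}.
Hypothesis n_gt0 : (0 < n)%N.
Local Notation M := 'M[Cplx R]_n.
Local Notation d := (@rdim n).
Implicit Types (X Y A P V : M) (E : set M).

(** The label of [x] on a grid of width [1 / s] in [[- a, a]]. *)
Definition rnd (q : nat) (a s x : R) : 'I_q.+1 := inord (Num.truncn ((x + a) * s)).

Lemma rnd_eq (q : nat) (a s x y : R) : 0 < s -> `|x| <= a -> `|y| <= a ->
  2 * a * s <= q%:R -> rnd q a s x = rnd q a s y -> `|x - y| <= s^-1.
Proof.
move=> s0 xa ya aq.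
have P z : `|z| <= a -> [/\ 0 <= (z + a) * s & (Num.truncn ((z + a) * s) < q.+1)%N].
  rewrite ler_norml => /andP[z1 z2].
  have h0 : 0 <= (z + a) * s by rewrite mulr_ge0 ?(ltW s0) //; lra.
  split=> //; have /andP[h _] := truncn_itv h0.
  rewrite ltnS -(ler_nat R); apply: le_trans h (le_trans _ aq).
  by rewrite ler_pM2r //; lra.
have [x0 xq] := P x xa; have [y0 yq] := P y ya.
move=> /(congr1 val) /=; rewrite !inordK // => exy.
have /andP[x1 x2] := truncn_itv x0; have /andP[y1 y2] := truncn_itv y0.
rewrite exy in x1 x2; rewrite -natr1 in x2 y2.
rewrite -[s^-1]mul1r ler_pdivlMr //.
suff : `|(x - y) * s| <= 1 by rewrite normrM (gtr0_norm s0).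
rewrite ler_norml mulrBl; move: x1 x2 y1 y2; rewrite !mulrDl.
by move: (Num.truncn _)%:R => T; move=> *; apply/andP; split; lra.
Qed.

(** A point in a slab orthogonal to [V] whose other coordinates are small has
    a small [k]-th coordinate, provided that [k] is the largest coordinate
    of [V]. *)
Lemma slab_coord (V Z : M) (k : 'I_d) (a b : R) : 0 <= a -> 0 <= b ->
  (forall l, `|co l V| <= `|co k V|) -> V != 0 ->
  (forall l, l != k -> `|co l Z| <= a) -> `|rinner V Z| <= b * nrm V ->
  `|co k Z| <= d%:R * (a + b).
Proof.
move=> a0 b0 kmax V0 hZ hV.
have nV : nrm V <= d%:R * `|co k V| by apply: nrm_le_co.
have vk : 0 < `|co k V|.
  have nV0 := nrm_gt0 V0; rewrite normr_gt0; apply/eqP => h.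
  by move: nV; rewrite h normr0 mulr0; lra.
rewrite -(ler_pM2l vk) -normrM.
have -> : co k V * co k Z = rinner V Z - \sum_(l | l != k) co l V * co l Z.
  by rewrite rinner_co (bigD1 k) //= addrK.
apply: le_trans (ler_normB _ _) _.
have h1 : `|rinner V Z| <= `|co k V| * (d%:R * b).
  apply: le_trans hV _; rewrite mulrA mulrC ler_wpM2r // mulrC //.
have h2 : `|\sum_(l | l != k) co l V * co l Z| <= `|co k V| * (d%:R * a).
  apply: le_trans (ler_norm_sum _ _ _) _.
  apply: (@le_trans _ _ (\sum_(l < d) `|co k V| * a)).
    rewrite [leRHS](bigD1 k) //= -[leLHS]add0r lerD ?mulr_ge0 //.
    by apply: ler_sum => l lk; rewrite normrM ler_pM ?kmax ?hZ.
  by rewrite sumr_const card_ord -[leLHS]mulr_natl mulrCA.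
by move: h1 h2; lra.
Qed.

Lemma jordan_nullU E1 E2 : jordan_null E1 -> jordan_null E2 -> jordan_null (E1 `|` E2).
Proof.
move=> h1 h2 e e0; have e2 : 0 < e / 2 by rewrite divr_gt0.
have [s1 [c1 v1]] := h1 _ e2; have [s2 [c2 v2]] := h2 _ e2.
exists (s1 ++ s2); split; last by rewrite big_cat /=; lra.
by move=> X [/c1|/c2] [b bs bX]; exists b => //; rewrite mem_cat bs ?orbT.
Qed.

Lemma jordan_null_sub E1 E2 : E1 `<=` E2 -> jordan_null E2 -> jordan_null E1.
Proof.
by move=> h12 h2 e e0; have [s [c v]] := h2 e e0; exists s; split=> // X /h12/c.
Qed.

Lemma leq_exp2 a b k : (a <= b)%N -> (a ^ k <= b ^ k)%N.
Proof. by case: k => // k ab; rewrite leq_exp2r. Qed.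

(** A Lipschitz image of a bounded piece of a coordinate hyperplane: the grid of
    width [1 / N^2] on the remaining [d - 1] coordinates needs
    [O (N^(2 (d - 1)))] labels.  The map is given by its graph [G], which is
    only required to be Lipschitz on its domain. *)
Lemma null_image_low (F : finType) (G : F -> 'I_d -> M -> M -> Prop) (K C : nat) :
  (forall s k P A, G s k P A -> co k P = 0 /\ forall l, `|co l P| <= K%:R) ->
  (forall s k P A P' A', G s k P A -> G s k P' A' -> nrm (P' - P) <= 1 ->
     nrm (A' - A) <= C%:R * nrm (P' - P)) ->
  jordan_null [set A | exists s k P, G s k P A].
Proof.
move=> hK hC.
have d0 : (0 < d)%N by rewrite rdim_gt0.
pose c0 := (#|F| * d * (2 * K * d + 1) ^ d.-1 + C)%N.
apply: (@jordan_labels R n n_gt0 _ c0%:R) => // N N0.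
have N1 : 1 <= N%:R :> R by rewrite ler1n.
have Np : 0 < N%:R :> R by rewrite ltr0n.
have dp : 0 < d%:R :> R by rewrite ltr0n.
pose q := (2 * K * d * N ^ 2)%N.
pose s : R := d%:R * N%:R ^+ 2.
have s0 : 0 < s by rewrite mulr_gt0 // exprn_gt0.
have sq : 2 * K%:R * s <= q%:R by rewrite /q /s expr2 !natrM !mulrA.
pose T := (F * 'I_d * {ffun 'I_d.-1 -> 'I_q.+1})%type.
pose L (t : T) (A : M) := exists P, G t.1.1 t.1.2 P A /\
  t.2 = [ffun l => rnd q K%:R s (co (lift t.1.2 l) P)].
exists T, L; split.
- move=> A [f [k [P GP]]].
  by exists (f, k, [ffun l => rnd q K%:R s (co (lift k l) P)]), P.
- move=> [[f k] r] A A' [P [/= GP ->]] [P' [/= GP' /ffunP e]].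
  have [Pk PK] := hK _ _ _ _ GP; have [Pk' PK'] := hK _ _ _ _ GP'.
  have dPP : nrm (P - P') <= (N%:R ^+ 2)^-1.
    have -> : (N%:R ^+ 2)^-1 = d%:R * s^-1 :> R.
      by rewrite /s; field; rewrite !lt0r_neq0.
    apply: nrm_le_co => l; rewrite coB.
    have [l'|->] := unliftP k l.
      move=> ->; have := e l'; rewrite !ffunE.
      by apply: rnd_eq.
    by rewrite Pk Pk' subrr normr0 invr_ge0 ltW.
  have dPP1 : nrm (P - P') <= 1.
    by apply: le_trans dPP _; rewrite invf_le1 ?exprn_gt0 // exprn_ege1.
  apply: le_trans (hC _ _ _ _ _ _ GP' GP dPP1) _.
  rewrite ler_pM ?nrm_ge0 //; first by rewrite ler_nat /c0 leq_addl.
rewrite !card_prod card_ffun !card_ord -natrX -natrM ler_nat.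
apply: (@leq_trans (#|F| * d * ((2 * K * d + 1) * N ^ 2) ^ d.-1)).
  rewrite leq_mul2l; apply/orP; right; apply: leq_exp2 => //.
  by rewrite /q mulnDl mul1n -addn1 leq_add2l sqrn_gt0.
rewrite expnMn -expnM mulnA leq_mul //; first by rewrite /c0 leq_addr.
rewrite leq_pexp2l // mul2n; by move: d0; case: (d).
Qed.

Lemma max_coord V : exists k : 'I_d, forall l, `|co l V| <= `|co k V|.
Proof.
have k0 : 'I_d := Ordinal (rdim_gt0 n_gt0).
by case: (@Order.TotalTheory.arg_maxP _ _ _ k0 xpredT (fun k => `|co k V|) isT) => k _ h; exists k => l; exact: h.
Qed.

(** Sard's theorem between spaces of the same dimension [d].  On a cell of width
    [1 / N] the values stay within [C / N] of a base value, and within [C / N^2]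
    of the hyperplane orthogonal to the conormal [V] of the base point.  A label
    therefore consists of the cell, [O (N^d)] choices, and of the position of
    the value on a grid of width [1 / N^2] for all coordinates but the largest
    one of [V], [O (N^(d - 1))] choices. *)
Lemma null_critical_values (F : finType) (G : F -> M -> M -> Prop) (K C : nat) :
  (forall s P A, G s P A -> forall l, `|co l P| <= K%:R) ->
  (forall s P A P' A', G s P A -> G s P' A' -> nrm (P' - P) <= 1 ->
     nrm (A' - A) <= C%:R * nrm (P' - P)) ->
  (forall s P A, G s P A -> exists2 V, V != 0 & forall P' A', G s P' A' ->
     nrm (P' - P) <= 1 ->
     `|rinner V (A' - A)| <= C%:R * nrm (P' - P) ^+ 2 * nrm V) ->
  jordan_null [set A | exists s P, G s P A].
Proof.
move=> hK hC hV.
have d0 : (0 < d)%N by rewrite rdim_gt0.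
have dp : 0 < d%:R :> R by rewrite ltr0n.
pose c0 := (#|F| * (2 * K * d + 1) ^ d * d * (2 * C + 1) ^ d.-1 + d * d * (1 + 2 * C))%N.
apply: (@jordan_labels R n n_gt0 _ c0%:R) => // N N0.
have N1 : 1 <= N%:R :> R by rewrite ler1n.
have Np : 0 < N%:R :> R by rewrite ltr0n.
pose q1 := (2 * K * d * N)%N; pose s1 : R := d%:R * N%:R.
have s10 : 0 < s1 by rewrite mulr_gt0.
have sq1 : 2 * K%:R * s1 <= q1%:R by rewrite /q1 /s1 !natrM !mulrA.
pose q2 := (2 * C * N)%N; pose s2 : R := N%:R ^+ 2; pose a2 : R := C%:R / N%:R.
have s20 : 0 < s2 by rewrite exprn_gt0.
have sq2 : 2 * a2 * s2 <= q2%:R.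
  rewrite /a2 /s2 /q2 !natrM le_eqVlt; apply/orP; left; apply/eqP.
  by field; rewrite lt0r_neq0.
pose rd P : {ffun 'I_d -> 'I_q1.+1} := [ffun l => rnd q1 K%:R s1 (co l P)].
pose good (t : F * {ffun 'I_d -> 'I_q1.+1}) (r : M * M * 'I_d) :=
  (exists P A, G t.1 P A /\ t.2 = rd P) ->
  exists P, [/\ G t.1 P r.1.1, t.2 = rd P, r.1.2 != 0,
    forall l, `|co l r.1.2| <= `|co r.2 r.1.2| &
    forall P' A', G t.1 P' A' -> nrm (P' - P) <= 1 ->
     `|rinner r.1.2 (A' - r.1.1)| <= C%:R * nrm (P' - P) ^+ 2 * nrm r.1.2].
(* A base point is chosen in every nonempty cell. *)
have /choice[rep hrep] t : exists r, good t r.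
  have [[P [A [GP tP]]]|h] := pselect (exists P A, G t.1 P A /\ t.2 = rd P).
    have [V V0 hVV] := hV _ _ _ GP; have [k kmax] := max_coord V.
    by exists (A, V, k) => _; exists P.
  by exists (0, 0, Ordinal d0) => /h.
pose T := (F * {ffun 'I_d -> 'I_q1.+1} * 'I_d * {ffun 'I_d.-1 -> 'I_q2.+1})%type.
pose L (t : T) (A : M) := let r := rep t.1.1 in
  [/\ exists P, G t.1.1.1 P A /\ t.1.1.2 = rd P, t.1.2 = r.2 &
   t.2 = [ffun l => rnd q2 a2 s2 (co (lift r.2 l) (A - r.1.1))]].
have cell P P' : (forall l, `|co l P| <= K%:R) -> (forall l, `|co l P'| <= K%:R) ->
    rd P = rd P' -> nrm (P - P') <= N%:R^-1.
  move=> hP hP' /ffunP e.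
  have -> : N%:R^-1 = d%:R * s1^-1 :> R by rewrite /s1; field; rewrite !lt0r_neq0.
  apply: nrm_le_co => l; rewrite coB.
  by have := e l; rewrite !ffunE; apply: rnd_eq.
have Ninv1 : N%:R^-1 <= 1 :> R by rewrite invf_le1.
exists T, L; split.
- move=> A [f [P GP]].
  pose r := rep (f, rd P).
  exists (f, rd P, r.2, [ffun l => rnd q2 a2 s2 (co (lift r.2 l) (A - r.1.1))]).
  by split=> //; exists P.
- move=> [[[f g] k] z] A A' [/= [P [GP gP]] -> ->] [/= [P' [GP' gP']] _ /ffunP ez].
  have [P0 [G0 g0 V0 kmax hV0]] : exists P0, [/\ G f P0 (rep (f, g)).1.1, g = rd P0,
    (rep (f, g)).1.2 != 0, forall l, `|co l (rep (f, g)).1.2| <= `|co (rep (f, g)).2 (rep (f, g)).1.2| &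
    forall P' A', G f P' A' -> nrm (P' - P0) <= 1 ->
     `|rinner (rep (f, g)).1.2 (A' - (rep (f, g)).1.1)| <= C%:R * nrm (P' - P0) ^+ 2 * nrm (rep (f, g)).1.2].
    by apply: (hrep (f, g)); exists P, A.
  move: (rep (f, g)) G0 V0 kmax hV0 ez => [[A0 V] k0] /= G0 V0 kmax hV0 ez.
  have hP : nrm (P - P0) <= N%:R^-1.
    by apply: cell; [exact: hK GP|exact: hK G0|rewrite -gP].
  have hP' : nrm (P' - P0) <= N%:R^-1.
    by apply: cell; [exact: hK GP'|exact: hK G0|rewrite -gP'].
  have hP1 := le_trans hP Ninv1; have hP1' := le_trans hP' Ninv1.
  have hA : nrm (A - A0) <= a2.
    by apply: le_trans (hC _ _ _ _ _ G0 GP hP1) _; rewrite ler_wpM2l.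
  have hA' : nrm (A' - A0) <= a2.
    by apply: le_trans (hC _ _ _ _ _ G0 GP' hP1') _; rewrite ler_wpM2l.
  have coords l : l != k0 -> `|co l (A - A')| <= s2^-1.
    have [l' ->|-> /eqP//] := unliftP k0 l => _.
    have := ez l'; rewrite !ffunE => /rnd_eq h.
    have -> : co (lift k0 l') (A - A') =
        co (lift k0 l') (A - A0) - co (lift k0 l') (A' - A0) by rewrite !coB; ring.
    apply: h => //; [exact: le_trans (co_le _ _) hA|exact: le_trans (co_le _ _) hA'].
  have quad P1 : nrm (P1 - P0) <= N%:R^-1 -> C%:R * nrm (P1 - P0) ^+ 2 * nrm V <= C%:R * s2^-1 * nrm V.
    move=> h; rewrite ler_wpM2r ?nrm_ge0 // ler_wpM2l // /s2 -exprVn.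
    by rewrite ler_pXn2r ?nnegrE ?nrm_ge0 ?invr_ge0.
  have hVA : `|rinner V (A - A')| <= 2 * C%:R * s2^-1 * nrm V.
    have -> : A - A' = (A - A0) - (A' - A0) by mxab.
    rewrite rinnerBr; apply: le_trans (ler_normB _ _) _.
    have h1 := le_trans (hV0 _ _ GP hP1) (quad _ hP).
    have h2 := le_trans (hV0 _ _ GP' hP1') (quad _ hP').
    suff -> : 2 * C%:R * s2^-1 * nrm V = C%:R * s2^-1 * nrm V + C%:R * s2^-1 * nrm V by exact: (lerD h1 h2).
    by ring.
  have i0 : 0 <= s2^-1 by rewrite invr_ge0 ltW.
  have hk := slab_coord i0 (mulr_ge0 (mulr_ge0 (ler0n _ 2) (ler0n R C)) i0) kmax V0 coords hVA.
  have all_le l : `|co l (A - A')| <= d%:R * (1 + 2 * C%:R) * s2^-1.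
    have [->|lk] := eqVneq l k0.
      suff -> : d%:R * (1 + 2 * C%:R) * s2^-1 = d%:R * (s2^-1 + 2 * C%:R * s2^-1) by [].
      by ring.
    apply: le_trans (coords l lk) _; rewrite ler_peMl //.
    have d1 : 1 <= d%:R :> R by rewrite ler1n.
    have c1 : 0 <= C%:R :> R by [].
    nra.
  apply: le_trans (nrm_le_co all_le) _; rewrite /s2 mulrA ler_wpM2r //.
  have -> : d%:R * (d%:R * (1 + 2 * C%:R)) = (d * d * (1 + 2 * C))%:R :> R.
    by rewrite !natrM natrD natrM; ring.
  by rewrite ler_nat /c0 leq_addl.
rewrite !card_prod !card_ffun !card_ord -natrX -natrM ler_nat.
have e1 : (q1.+1 <= (2 * K * d + 1) * N)%N by rewrite /q1 mulnDl mul1n -addn1 leq_add2l.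
have e2 : (q2.+1 <= (2 * C + 1) * N)%N by rewrite /q2 mulnDl mul1n -addn1 leq_add2l.
apply: (@leq_trans (#|F| * ((2 * K * d + 1) * N) ^ d * d * ((2 * C + 1) * N) ^ d.-1)).
  by rewrite leq_mul ?leq_exp2 // leq_mul // leq_mul ?leq_exp2.
have -> : (N ^ d.*2.-1 = N ^ d * N ^ d.-1)%N.
  by rewrite -expnD; congr (_ ^ _)%N; move: d0; case: (d) => // k _; rewrite doubleS /= -addnn addSn.
rewrite !expnMn /c0 mulnDl; apply: leq_trans (leq_addr _ _).
rewrite leq_eqVlt; apply/orP; left; apply/eqP; move: (_ ^ _)%N (_ ^ _)%N (_ ^ _)%N (_ ^ _)%N => a b c e.
ring.
Qed.

End Sard.

(** * Charts of the flag manifold *)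

Section Chart.
Context {R : realType}.

Section Lip.
Context {n : nat}.
Local Notation M := 'M[Cplx R]_n.
Implicit Types (X Y A P V L U Q E : M).

Definition unit_lower L := forall i j : 'I_n, (i <= j)%N -> L i j = (i == j)%:R.
Definition pos_upper U := (forall i j : 'I_n, (j < i)%N -> U i j = 0) /\
  (forall i, 0 < re (U i i) /\ im (U i i) = 0).

(** Back substitution: the rows of [Y] are determined from the last one
    upwards. *)
Lemma upper_quotient U U' Y : pos_upper U -> pos_upper U' -> U *m Y = U' -> pos_upper Y.
Proof.
move=> [up dp] [up' dp'] /matrixP e.
have U0 i : U i i != 0.
  by apply/eqP => h; have [] := dp i; rewrite h ltxx.
have Y0 (m : nat) (i j : 'I_n) : (n - i <= m)%N -> (j < i)%N -> Y i j = 0.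
  elim: m i j => [|m IH] i j him ji.
    by move: him; rewrite leqn0 subn_eq0 leqNgt ltn_ord.
  have := e i j; rewrite mxE up' // (bigD1 i) //= big1 => [|k ki].
    by rewrite addr0 => /eqP; rewrite mulf_eq0 (negPf (U0 i)) => /eqP.
  have [ltki|leik] := ltnP k i; first by rewrite up // mul0r.
  have ltik : (i < k)%N by rewrite ltn_neqAle leik andbT eq_sym.
  rewrite IH ?mulr0 //; last exact: ltn_trans ji ltik.
  by move: him ltik; have := ltn_ord k; lia.
split=> [i j|i]; first exact: (Y0 (n - i)%N).
have := e i i; rewrite mxE (bigD1 i) //= big1 => [|k ki].
  rewrite addr0 => h; have [u u0] := dp i; have [u' u'0] := dp' i.
  have hre : re (U' i i) = re (U i i) * re (Y i i) by rewrite -h reM u0 mul0r subr0.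
  have him : im (U' i i) = re (U i i) * im (Y i i) by rewrite -h imM u0 mul0r addr0.
  split; first by rewrite -(pmulr_rgt0 _ u) -hre.
  by move: him; rewrite u'0 => /esym/eqP; rewrite mulf_eq0 gt_eqF //= => /eqP.
have [ltki|leik] := ltnP k i; first by rewrite up // mul0r.
have ltik : (i < k)%N by rewrite ltn_neqAle leik andbT eq_sym.
by rewrite (Y0 (n - k)%N) ?mulr0.
Qed.

Lemma unitary_row (X : M) i : X^t* *m X = 1%:M -> \sum_j sq (X i j) = 1.
Proof.
move=> /mulmx1C hX; have hX' : (X^t*)^t* *m X^t* = 1%:M by rewrite trmxCK.
rewrite -(unitary_col i hX'); apply: eq_bigr => j _.
by rewrite !mxE /sq re_conj im_conj sqrrN.
Qed.

(** Rows and columns have square norm one; the rows up to [k] and the columns up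
    to [k] have the same number and share the diagonal block. *)
Lemma unitary_blocks (X : M) (k : nat) : X^t* *m X = 1%:M ->
  \sum_(i < n | (i <= k)%N) \sum_(j < n | ~~ (j <= k)%N) sq (X i j) =
  \sum_(i < n | ~~ (i <= k)%N) \sum_(j < n | (j <= k)%N) sq (X i j).
Proof.
move=> hX.
have e1 : \sum_(i < n | (i <= k)%N) \sum_j sq (X i j) = \sum_(i < n | (i <= k)%N) 1.
  by apply: eq_bigr => i _; exact: unitary_row.
have e2 : \sum_(j < n | (j <= k)%N) \sum_i sq (X i j) = \sum_(i < n | (i <= k)%N) 1.
  by apply: eq_bigr => i _; exact: unitary_col.
rewrite exchange_big /= (bigID (fun i : 'I_n => (i <= k)%N)) /= in e2.
have e3 : \sum_(i < n | (i <= k)%N) \sum_j sq (X i j) =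
   \sum_(i < n | (i <= k)%N) \sum_(j < n | (j <= k)%N) sq (X i j) +
   \sum_(i < n | (i <= k)%N) \sum_(j < n | ~~ (j <= k)%N) sq (X i j).
  by rewrite -big_split; apply: eq_bigr => i _; rewrite (bigID (fun j : 'I_n => (j <= k)%N)).
by apply: (addrI (\sum_(i < n | (i <= k)%N) \sum_(j < n | (j <= k)%N) sq (X i j)));
  rewrite -e3 e1 -e2.
Qed.

Lemma sum_sq_part (X : M) (P S : pred 'I_n) :
  \sum_(i | P i) \sum_(j | S j) sq (X i j) <= nrm X ^+ 2.
Proof.
apply: le_trans (_ : rinner X X <= _); last first.
  by rewrite expr2; apply: le_trans (ler_norm _) (rinner_le _ _).
rewrite rinner_sq [leRHS](bigID P) /=.
rewrite -[leLHS]addr0 lerD //; last by do 2 (apply: sumr_ge0 => ? _); exact: sq_ge0.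
apply: ler_sum => i _; rewrite [leRHS](bigID S) /= lerDl.
by apply: sumr_ge0 => ? _; exact: sq_ge0.
Qed.

(** If [X] is within [dl] of an upper triangular matrix, then its strictly lower
    part is small, hence by [unitary_blocks] its strictly upper part is small
    too; the diagonal entries are then almost of modulus one, and they are
    near positive numbers. *)
Lemma unitary_near_upper (X Y : M) : X^t* *m X = 1%:M -> pos_upper Y ->
  nrm (X - 1%:M) <= n%:R * n%:R * ((4 * n%:R + 6) * nrm (X - Y)).
Proof.
move=> hX [up dp]; set dl := nrm (X - Y); have dl0 : 0 <= dl by exact: nrm_ge0.
have ent i j : cnorm (X i j - Y i j) <= dl.
  by have := nrm_entry (X - Y) i j; rewrite addE oppE.
have low (i j : 'I_n) : (j < i)%N -> sq (X i j) = sq ((X - Y) i j).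
  by move=> ji; rewrite addE oppE up // subr0.
have off i j : i != j -> cnorm (X i j) <= 2 * dl.
  move=> ij; have [ji|] := ltnP j i.
    by have := ent i j; rewrite up // subr0; lra.
  rewrite leq_eqVlt => /orP[/eqP/val_inj e|lij]; first by rewrite e eqxx in ij.
  apply: cnorm_le_sq => //.
  apply: le_trans (sum_sq_part (X - Y) (fun a : 'I_n => ~~ (a <= i)%N) (fun b : 'I_n => (b <= i)%N)).
  have -> : \sum_(a < n | ~~ (a <= i)%N) \sum_(b < n | (b <= i)%N) sq ((X - Y) a b) =
      \sum_(a < n | ~~ (a <= i)%N) \sum_(b < n | (b <= i)%N) sq (X a b).
    apply: eq_bigr => a ha; apply: eq_bigr => b hb; rewrite low //.
    by rewrite -ltnNge in ha; exact: leq_ltn_trans hb ha.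
  rewrite -unitary_blocks // (bigD1 i) //= (bigD1 j) -?ltnNge //= -addrA lerDl.
  by rewrite addr_ge0 ?sumr_ge0 // => *; rewrite ?sumr_ge0 // => *; exact: sq_ge0.
have diag i : cnorm (X i i - 1) <= (4 * n%:R + 6) * dl.
  have [y0 y1] := dp i; have := ent i i; rewrite /cnorm !(reD, imD, reN, imN) y1 /= !oppr0 addr0 => he.
  set r := re (X i i) in he *; set m := im (X i i) in he *.
  have im_le : `|m| <= dl by apply: le_trans he; rewrite lerDr.
  have re_ge : - dl <= r.
    have : `|r - re (Y i i)| <= dl by apply: le_trans he; rewrite lerDl.
    by rewrite ler_norml => /andP[h _]; lra.
  have n0 : 0 <= n%:R :> R by [].
  have sum1 : r ^+ 2 + m ^+ 2 + \sum_(a | a != i) sq (X a i) = 1.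
    by have := unitary_col i hX; rewrite (bigD1 i) //= => <-.
  have sum_ge0 : 0 <= \sum_(a | a != i) sq (X a i) by apply: sumr_ge0 => *; exact: sq_ge0.
  have sum_le : \sum_(a | a != i) sq (X a i) <= n%:R * (2 * dl) ^+ 2.
    apply: (@le_trans _ _ (\sum_(a < n) (2 * dl) ^+ 2)).
      rewrite [leRHS](bigID (fun a => a != i)) /= -[leLHS]addr0 lerD //; last first.
        by apply: sumr_ge0 => *; exact: sqr_ge0.
      apply: ler_sum => a ai; apply: le_trans (sq_le_cnorm _) _.
      by rewrite ler_pXn2r ?nnegrE ?cnorm_ge0 ?mulr_ge0 // off.
    by rewrite sumr_const card_ord [leRHS]mulr_natl.
  have m2 : m ^+ 2 <= dl ^+ 2.
    by rewrite -(real_normK (num_real m)) ler_pXn2r ?nnegrE.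
  have r1 : r <= 1.
    have : r ^+ 2 <= 1 by have := sqr_ge0 m; lra.
    by move=> r2; nra.
  suff h : 1 - r <= (4 * n%:R + 5) * dl.
    rewrite ler0_norm ?subr_le0 //; lra.
  have [dl1|dl1] := leP (1 / 2) dl; first by nra.
  have h2 : 1 - r ^+ 2 <= (4 * n%:R + 1) * dl ^+ 2 by move: sum1 sum_le m2; nra.
  have h3 : (1 - r) * (1 / 2) <= 1 - r ^+ 2 by nra.
  have h4 : (4 * n%:R + 1) * dl ^+ 2 <= (4 * n%:R + 1) * (dl * (1 / 2)).
    by rewrite ler_wpM2l ?expr2 ?ler_wpM2l //; lra.
  by nra.
apply: nrm_le_entry => i j; rewrite addE oppE mxE.
have [->|ij] := eqVneq i j; first by rewrite mulr1n; exact: diag.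
rewrite mulr0n subr0; apply: le_trans (off i j ij) _.
by rewrite ler_wpM2r //; have : 0 <= n%:R :> R by []; lra.
Qed.

Lemma perm_mx_unitary (s : 'S_n) : (perm_mx s : M)^t* *m perm_mx s = 1%:M.
Proof.
have -> : (perm_mx s : M)^t* = perm_mx (s^-1)%g.
  by rewrite tr_perm_mx map_perm_mx.
by rewrite -perm_mxM mulVg perm_mx1.
Qed.

(** [Q^* Q'] is unitary and near the matrix [U^-1 U'], which is upper triangular
    with positive diagonal and would be equal to it if [L = L']. *)
Lemma chart_lip (K : R) : 0 <= K -> exists2 C : R, 0 <= C &
  forall (s : 'S_n) (Q Q' L L' U U' : M),
  Q^t* *m Q = 1%:M -> Q'^t* *m Q' = 1%:M ->
  perm_mx s *m Q = L *m U -> perm_mx s *m Q' = L' *m U' ->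
  L \in unitmx -> L' \in unitmx -> pos_upper U -> pos_upper U' -> nrm (invmx L') <= K ->
  nrm (Q' - Q) <= C * nrm (L' - L).
Proof.
move=> K0; pose u := @ubound R n; have u0 : 0 <= u by rewrite !mulr_ge0.
pose c := u * u * (K * (u * u)).
have c0 : 0 <= c by rewrite !mulr_ge0.
exists (u * (n%:R * n%:R * ((4 * n%:R + 6) * c))).
  by rewrite !mulr_ge0 // addr_ge0 // mulr_ge0.
move=> s Q Q' L L' U U' hQ hQ' e e' uL uL' pU pU' hK.
have hP := perm_mx_unitary s; set P : M := perm_mx s in hP e e'.
pose X := Q^t* *m Q'.
have hX : X^t* *m X = 1%:M.
  by rewrite /X adjM trmxCK mulmxA -[_ *m Q *m _]mulmxA (mulmx1C hQ) mulmx1.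
pose V := Q^t* *m P^t* *m L.
have VU : V *m U = 1%:M.
  by rewrite /V -[_ *m L *m U]mulmxA -e !mulmxA -[_ *m P^t* *m P]mulmxA hP mulmx1.
have pY : pos_upper (V *m U').
  by apply: (upper_quotient pU pU'); rewrite mulmxA (mulmx1C VU) mul1mx.
have XY : X - V *m U' = Q^t* *m P^t* *m (L' - L) *m U'.
  rewrite mulmxBr mulmxBl; congr (_ - _).
  by rewrite -[_ *m L' *m U']mulmxA -e' !mulmxA -[_ *m P^t* *m P]mulmxA hP mulmx1.
have nU' : nrm U' <= K * (u * u).
  have -> : U' = invmx L' *m (P *m Q') by rewrite e' mulKmx.
  apply: le_trans (nrmM _ _) _; rewrite ler_pM ?nrm_ge0 //.
  apply: le_trans (nrmM _ _) _; rewrite ler_pM ?nrm_ge0 //; exact: unitary_nrm.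
have nXY : nrm (X - V *m U') <= c * nrm (L' - L).
  rewrite XY; apply: le_trans (nrmM _ _) _.
  rewrite /c mulrAC ler_pM ?nrm_ge0 //.
  apply: le_trans (nrmM _ _) _; rewrite ler_wpM2r ?nrm_ge0 //.
  apply: le_trans (nrmM _ _) _; rewrite !nrm_adj ler_pM ?nrm_ge0 //; exact: unitary_nrm.
have -> : Q' - Q = Q *m (X - 1%:M).
  by rewrite mulmxBr mulmx1 /X mulmxA (mulmx1C hQ) mul1mx.
apply: le_trans (nrmM _ _) _; rewrite -[leRHS]mulrA ler_pM ?nrm_ge0 //; first exact: unitary_nrm.
apply: le_trans (unitary_near_upper hX pY) _.
have h46 : 0 <= 4 * n%:R + 6 :> R by rewrite addr_ge0 // mulr_ge0.
rewrite -[leRHS]mulrA ler_wpM2l ?mulr_ge0 // -[leRHS]mulrA ler_wpM2l //.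
Qed.

End Lip.

(** Column phases make the diagonal positive; this picks one representative in
    a class of the flag manifold. *)
Lemma diag_phase (n : nat) (U : 'M[Cplx R]_n) : (forall i, U i i != 0) ->
  exists E : 'M[Cplx R]_n, [/\ dg E = E, E^t* *m E = 1%:M &
    forall i, 0 < re ((U *m E) i i) /\ im ((U *m E) i i) = 0].
Proof.
move=> U0; pose f i : Cplx R := Num.conj (U i i) * mkC (Num.sqrt (sq (U i i)))^-1 0.
have sqU i : 0 < sq (U i i).
  rewrite lt_def sq_ge0 andbT; apply: contra_neq (U0 i); exact: sq_eq0.
have r0 i : 0 < Num.sqrt (sq (U i i)) by rewrite sqrtr_gt0.
have fU i : U i i * f i = mkC (Num.sqrt (sq (U i i))) 0.
  rewrite /f mulrA [U i i * _]mulrC conj_mul_sq -mkCM; congr (mkC _ 0).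
  by rewrite -{1}(sqr_sqrtr (sq_ge0 (U i i))) expr2 mulfK ?lt0r_neq0.
have ff i : Num.conj (f i) * f i = 1.
  rewrite /f rmorphM /= conjCK conj_mkC mulrACA [U i i * _]mulrC conj_mul_sq -!mkCM.
  rewrite -{1}(sqr_sqrtr (sq_ge0 (U i i))) expr2 -mkC1; congr (mkC _ 0).
  by field; rewrite lt0r_neq0.
exists (dg (\matrix_(i, j) f i)); split; first exact: dgK.
  apply/matrixP => i j; rewrite dg_adj dg_mull dgE !mxE.
  by case: (eqVneq i j) => [->|_]; rewrite ?mulr0 // ff.
by move=> i; rewrite dg_mulr mxE fU; split; [exact: r0|].
Qed.

Lemma chart_exists (n : nat) (Q : 'M[Cplx R]_n) : (0 < n)%N -> Q^t* *m Q = 1%:M ->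
  exists s : 'S_n, exists L U E : 'M[Cplx R]_n,
  [/\ unit_lower L, L \in unitmx, pos_upper U, dg E = E /\ E^t* *m E = 1%:M &
     perm_mx s *m (Q *m E) = L *m U].
Proof.
case: n Q => // n Q _ hQ.
have := cormen_lup_perm Q; have := cormen_lup_correct Q; have := cormen_lup_detL Q.
have := @cormen_lup_lower _ n Q; have := @cormen_lup_upper _ n Q.
case: (cormen_lup Q) => [[P L] U] /= hU hL dL hPQ /is_perm_mxP[s Ps].
have uL : L \in unitmx by rewrite unitmxE dL unitr1.
have {}hPQ : perm_mx s *m Q = L *m U by rewrite -Ps.
have uU : U \in unitmx.
  have -> : U = invmx L *m (perm_mx s *m Q) by rewrite hPQ mulKmx.
  rewrite !unitmx_mul unitmx_inv uL unitmx_perm /=.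
  by have := mulmx1_unit hQ => -[].
have trigU : is_trig_mx U^T by apply/is_trig_mxP => i j ij; rewrite mxE hU.
have U0 i : U i i != 0.
  move: uU; rewrite unitmxE -det_tr det_trig // unitfE => /prodf_neq0/(_ i isT).
  by rewrite mxE.
have [E [dE hE pE]] := diag_phase U0.
exists s, L, (U *m E), E; split=> //; last by rewrite !mulmxA hPQ.
by split=> // i j ji; rewrite -dE dg_mulr hU ?mul0r.
Qed.

End Chart.

(** * The singular values of the normal form *)

Section SingularValues.
Context {R : realType} {n : nat}.
Hypothesis n_gt0 : (0 < n)%N.
Local Notation M := 'M[Cplx R]_n.
Implicit Types (X Y A P V L U Q E D W H : M).

Record point := Point { pQ : M; pL : M; pU : M; pD : M; pW : M }.

(** Strictly lower [L], diagonal [D] and strictly upper [W] determine the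
    parameters, and fill one complex matrix: source and target of [value] have
    the same real dimension.  Given the permutation, [L] determines
    [U] and [Q]. *)
Definition param (p : point) : M :=
  \matrix_(i, j) if (j < i)%N then pL p i j else if i == j then pD p i i else pW p i j.

Definition core (p : point) : M := pD p + cm (pD p) (pW p).

Definition value (p : point) : M := pQ p *m core p *m (pQ p)^t*.

(** [K] bounds the parameters, and the inverse of [L], which enters the
    Lipschitz constant of the chart. *)
Record chart_point (K : R) (s : 'S_n) (p : point) : Prop := ChartPoint {
  cpQ : (pQ p)^t* *m pQ p = 1%:M;
  cpLU : perm_mx s *m pQ p = pL p *m pU p;
  cpL : unit_lower (pL p);
  cpLunit : pL p \in unitmx;
  cpU : pos_upper (pU p);
  cpD : dg (pD p) = pD p;
  cpWherm : (pW p)^t* = pW p;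
  cpW0 : dg (pW p) = 0;
  cpLK : nrm (pL p) <= K;
  cpiLK : nrm (invmx (pL p)) <= K;
  cpDK : nrm (pD p) <= K;
  cpWK : nrm (pW p) <= K }.

Lemma nrm_entrywise X Y : (forall i j, cnorm (X i j) <= cnorm (Y i j)) -> nrm X <= nrm Y.
Proof. by move=> h; apply: ler_sum => i _; apply: ler_sum => j _. Qed.

Lemma cnorm0 : cnorm (0 : Cplx R) = 0.
Proof. by rewrite /cnorm /= normr0 addr0. Qed.

Section Pair.
Variables (K : R) (s : 'S_n) (p q : point).
Hypotheses (hp : chart_point K s p) (hq : chart_point K s q).

Lemma dL_param : nrm (pL q - pL p) <= nrm (param q - param p).
Proof.
apply: nrm_entrywise => i j; rewrite !(addE, oppE) !mxE.
have [ji|ij] := ltnP j i; first by [].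
by rewrite (cpL hp) // (cpL hq) // subrr cnorm0 cnorm_ge0.
Qed.

Lemma diag_offdiag0 (D : M) i j : dg D = D -> i != j -> D i j = 0.
Proof. by move=> <- ij; rewrite dgE (negPf ij). Qed.

Lemma dD_param : nrm (pD q - pD p) <= nrm (param q - param p).
Proof.
apply: nrm_entrywise => i j; rewrite !(addE, oppE) !mxE.
have [<-|ij] := eqVneq i j; first by rewrite ltnn.
by rewrite (diag_offdiag0 (cpD hq) ij) (diag_offdiag0 (cpD hp) ij) subrr cnorm0 cnorm_ge0.
Qed.

(** The factor 2 is due to [W] being stored only above the diagonal. *)
Lemma dW_param : nrm (pW q - pW p) <= 2 * nrm (param q - param p).
Proof.
pose Z : M := \matrix_(i, j) if (i < j)%N then (pW q - pW p) i j else 0.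
have hZ : nrm Z <= nrm (param q - param p).
  apply: nrm_entrywise => i j; rewrite !(addE, oppE) !mxE.
  have [ij|ji] := ltnP i j; last by rewrite cnorm0 cnorm_ge0.
  by rewrite ltnNge (ltnW ij) /= -(inj_eq val_inj) ltn_eqF //= !mxE.
have hW : (pW q - pW p)^t* = pW q - pW p by rewrite adjB (cpWherm hp) (cpWherm hq).
have dW : dg (pW q - pW p) = 0 by rewrite dgB (cpW0 hp) (cpW0 hq) subrr.
have -> : pW q - pW p = Z + Z^t*.
  move: hW dW; rewrite /Z; move: (pW q - pW p) => W hW dW.
  apply/matrixP => i j; rewrite addE !mxE.
  have [ij|ji|/val_inj ->] := ltngtP i j; rewrite ?conjC0 ?addr0 ?add0r //.
    by rewrite -{1}hW !mxE.
  by move/matrixP: dW => /(_ j j); rewrite dgE eqxx zeroE.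
by apply: le_trans (nrmD _ _) _; rewrite nrm_adj; lra.
Qed.

End Pair.

Lemma nrm_param K s p : chart_point K s p -> nrm (param p) <= K + K + K.
Proof.
move=> hp; apply: le_trans (_ : nrm (pL p) + nrm (pD p) + nrm (pW p) <= _); last first.
  by rewrite !lerD ?(cpLK hp) ?(cpDK hp) ?(cpWK hp).
rewrite !nrmE -!big_split; apply: ler_sum => i _.
rewrite -!big_split; apply: ler_sum => j _ /=; rewrite mxE.
have := cnorm_ge0 (pL p i j); have := cnorm_ge0 (pD p i j); have := cnorm_ge0 (pW p i j).
case: ifP => _; first by lra.
by case: eqP => [->|_]; lra.
Qed.

Lemma tangent_shuffle (B S E F1 F2 : M) :
  B *m (- S) + ((E + (F1 + F2)) + S *m B) = cm S B + (E + F2 + F1).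
Proof. by rewrite cmE mxNr; mxab. Qed.

Section Expansion.
Variable K : R.
Hypothesis K0 : 0 <= K.

Let T : Type := 'S_n * point * point.
Let dom (t : T) : Prop := [/\ chart_point K t.1.1 t.1.2, chart_point K t.1.1 t.2 &
  nrm (param t.2 - param t.1.2) <= 1].
Let dist (t : T) : R := nrm (param t.2 - param t.1.2).
Local Notation O k c := (isO dom dist k c).

Let dist01 t : dom t -> 0 <= dist t <= 1.
Proof. by move=> [_ _ h]; rewrite /dist nrm_ge0. Qed.

(** Values are compared in the frame of the first point: [trans p q] is the
    second frame seen from the first, close to the identity. *)
Definition trans (p q : point) : M := (pQ p)^t* *m pQ q.
Definition tangent (p : point) H E F : M :=
  cm H (core p) + (E + cm E (pW p) + cm (pD p) F).

Let dQ : O 1 (fun t => pQ t.2 - pQ t.1.2).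
Proof.
have [C C0 h] := @chart_lip R n K K0.
exists C => // t [hp hq _]; rewrite expr1.
apply: le_trans (ler_wpM2l C0 (dL_param hp hq)).
exact: h (cpQ hp) (cpQ hq) (cpLU hp) (cpLU hq) (cpLunit hp) (cpLunit hq) (cpU hp) (cpU hq) (cpiLK hq).
Qed.

Let dD : O 1 (fun t => pD t.2 - pD t.1.2).
Proof.
by exists 1 => // t [hp hq _]; rewrite mul1r expr1; exact: dD_param hp hq.
Qed.

Let dW : O 1 (fun t => pW t.2 - pW t.1.2).
Proof.
by exists 2 => // t [hp hq _]; rewrite expr1; exact: dW_param hp hq.
Qed.

Let bQ : O 0 (fun t => pQ t.1.2).
Proof.
exists (@ubound R n) => [|t [hp _ _]]; first by rewrite !mulr_ge0.
by rewrite expr0 mulr1 unitary_nrm ?(cpQ hp).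
Qed.

Let bD : O 0 (fun t => pD t.1.2).
Proof. by exists K => // t [hp _ _]; rewrite expr0 mulr1 (cpDK hp). Qed.

Let bW : O 0 (fun t => pW t.1.2).
Proof. by exists K => // t [hp _ _]; rewrite expr0 mulr1 (cpWK hp). Qed.

Let jD : jet dom dist (fun t => pD t.2) (fun t => pD t.1.2) (fun t => pD t.2 - pD t.1.2).
Proof. split; [exact: bD|exact: dD|]; by apply: isO_eq (isO0 _ _ 2) => t _; rewrite subrr. Qed.

Let jW : jet dom dist (fun t => pW t.2) (fun t => pW t.1.2) (fun t => pW t.2 - pW t.1.2).
Proof. split; [exact: bW|exact: dW|]; by apply: isO_eq (isO0 _ _ 2) => t _; rewrite subrr. Qed.

Let trans_unitary t : dom t -> (trans t.1.2 t.2)^t* *m trans t.1.2 t.2 = 1%:M.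
Proof.
move=> [hp hq _]; rewrite /trans adjM trmxCK mulmxA -[_ *m pQ t.1.2 *m _]mulmxA.
by rewrite (mulmx1C (cpQ hp)) mulmx1 (cpQ hq).
Qed.

Lemma skew1 : skew (1%:M : M) = 0.
Proof. by rewrite skewE adj1 subrr scaler0. Qed.

(** A unitary [X = 1 + Z] satisfies [Z + Z^* = - Z^* Z], so that [Z] is
    skew-Hermitian up to second order. *)
Lemma unitary_skew X : X^t* *m X = 1%:M ->
  X - 1%:M - skew X = - (mkC (2^-1) 0 *: ((X - 1%:M)^t* *m (X - 1%:M))).
Proof.
have [Z ->] : exists Z, X = Z + (1%:M : M) by exists (X - 1%:M); rewrite subrK.
move=> hX; have hZ : Z^t* *m Z = - (Z + Z^t*).
  move: hX; rewrite adjD adj1 mulmxDl mulmxDr !mulmx1 mul1mx.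
  move: (Z^t* *m Z) (Z^t*) => Y Z' e; apply/eqP; rewrite -subr_eq0 opprK; apply/eqP.
  by apply: (addIr (1%:M : M)); rewrite add0r -[RHS]e; mxab.
rewrite skewE -mkC_half addrK hZ adjD adj1; move: (Z^t*) => Z'.
have h2 : mkC (2^-1) 0 + mkC (2^-1) 0 = 1 :> Cplx R by rewrite -mkCD -mkC1; congr (mkC _ 0); lra.
apply/matrixP => i j; rewrite !(addE, oppE, scaleE).
by rewrite -[Z i j in LHS]mul1r -{1}h2; ring.
Qed.

Let jX : jet dom dist (fun t => trans t.1.2 t.2) (fun _ => 1%:M) (fun t => skew (trans t.1.2 t.2)).
Proof.
have d1 : O 1 (fun t => trans t.1.2 t.2 - 1%:M).
  apply: isO_eq (isOM (isO_adj bQ) dQ) => t [hp _ _].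
  by rewrite mulmxBr (cpQ hp).
split; first exact: isO_cst.
  by apply: isO_eq (isO_skew d1) => t _; rewrite skewB skew1 subr0.
apply: isO_eq (isON (isOZ (2^-1) (isOM (isO_adj d1) d1))) => t dt.
by rewrite -unitary_skew // trans_unitary.
Qed.

(** The map [value] read in the frame of the base point, at an arbitrary pair of
    points of a chart; the constants depend on [K] alone. *)
Lemma value_jet :
  jet dom dist (fun t => (trans t.1.2 t.2) *m core t.2 *m (trans t.1.2 t.2)^t*)
    (fun t => core t.1.2)
    (fun t => tangent t.1.2 (skew (trans t.1.2 t.2)) (pD t.2 - pD t.1.2) (pW t.2 - pW t.1.2)).
Proof.
have jB := jetD jD (jet_cm dist01 jD jW).
have J := jetM dist01 (jetM dist01 jX jB) (jet_adj jX).
have [J0 J1 J2] := J; split.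
- by apply: isO_eq J0 => t _; rewrite mul1mx adj1 mulmx1.
- by apply: isO_eq J1 => t _; rewrite !mul1mx adj1 !mulmx1 skew_adj; exact: tangent_shuffle.
apply: isO_eq J2 => t _; rewrite !mul1mx adj1 !mulmx1 skew_adj; congr (_ - _).
exact: tangent_shuffle.
Qed.

Lemma value_isO : isO dom dist 1 (fun t =>
  trans t.1.2 t.2 *m core t.2 *m (trans t.1.2 t.2)^t* - core t.1.2).
Proof. have h := jet_lip dist01 value_jet. exact: h. Qed.

End Expansion.
End SingularValues.

Section NullSets.
Context {R : realType} {n : nat}.
Hypothesis n_gt0 : (0 < n)%N.
Local Notation M := 'M[Cplx R]_n.
Local Notation point := (@point R n).
Implicit Types (X Y A P V L U Q E D W H : M) (p q : point).

Lemma value_diff p q : (pQ p)^t* *m pQ p = 1%:M ->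
  value q - value p =
  pQ p *m (trans p q *m core q *m (trans p q)^t* - core p) *m (pQ p)^t*.
Proof.
move=> hp; have hp' := mulmx1C hp.
rewrite mulmxBr mulmxBl /value; congr (_ - _).
rewrite /trans adjM trmxCK !mulmxA hp' mul1mx.
by rewrite -[_ *m pQ p *m _]mulmxA hp' mulmx1.
Qed.

Lemma rinner_conj Q V X : Q^t* *m Q = 1%:M ->
  rinner (Q *m V *m Q^t*) (Q *m X *m Q^t*) = rinner V X.
Proof.
move=> hQ; rewrite rinner_mulrV trmxCK -[_ *m Q^t* *m Q]mulmxA hQ mulmx1.
by rewrite rinner_mullV mulmxA hQ mul1mx.
Qed.

Lemma conormal_tangent p V S E F : conormal (pD p) (pW p) V ->
  S^t* = - S -> dg E = E -> F^t* = F -> rinner V (tangent p S E F) = 0.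
Proof.
move=> [h1 h2 h3] hS hE hF; rewrite /tangent rinnerDr [cm S _]cmC rinnerNr (h1 S hS) oppr0 add0r.
by rewrite rinnerDr (h2 E hE) (h3 F hF) addr0.
Qed.

Lemma value_lip (K : nat) : exists C : nat, forall s p q,
  chart_point K%:R s p -> chart_point K%:R s q ->
  nrm (param q - param p) <= 1 ->
  nrm (value q - value p) <= C%:R * nrm (param q - param p).
Proof.
have [C C0 h] := value_isO (n := n) (ler0n R K).
pose c := @ubound R n * C * @ubound R n.
have u0 : 0 <= @ubound R n by rewrite !mulr_ge0.
have c0 : 0 <= c by rewrite !mulr_ge0.
exists (Num.Def.archi_bound c) => s p q hp hq h1.
rewrite (value_diff _ (cpQ hp)).
apply: le_trans (_ : c * nrm (param q - param p) <= _); last first.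
  by rewrite ler_wpM2r ?nrm_ge0 // ltW // archi_boundP.
apply: le_trans (nrmM _ _) _; rewrite nrm_adj /c mulrAC.
rewrite ler_pM ?nrm_ge0 ?unitary_nrm ?(cpQ hp) //.
apply: le_trans (nrmM _ _) _; rewrite -mulrA.
rewrite ler_pM ?nrm_ge0 ?unitary_nrm ?(cpQ hp) //.
by have := h (s, p, q); rewrite expr1; apply.
Qed.

(** The first-order part of [value q - value p] is a velocity of the map, which
    is orthogonal to the conormal. *)
Lemma value_conormal (K : nat) : exists C : nat, forall s p V,
  chart_point K%:R s p -> conormal (pD p) (pW p) V ->
  forall q, chart_point K%:R s q -> nrm (param q - param p) <= 1 ->
  `|rinner (pQ p *m V *m (pQ p)^t*) (value q - value p)| <=
    C%:R * nrm (param q - param p) ^+ 2 * nrm (pQ p *m V *m (pQ p)^t*).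
Proof.
have [_ _ [C C0 h]] := value_jet (n := n) (ler0n R K).
have u0 : 0 <= @ubound R n by rewrite !mulr_ge0.
pose c := @ubound R n * @ubound R n * C.
have c0 : 0 <= c by rewrite !mulr_ge0.
exists (Num.Def.archi_bound c) => s p V hp hV q hq h1.
rewrite (value_diff _ (cpQ hp)) rinner_conj ?(cpQ hp) //.
set Y := trans p q *m core q *m (trans p q)^t* - core p.
set VV := pQ p *m V *m (pQ p)^t*.
have nV : nrm V <= @ubound R n * @ubound R n * nrm VV.
  have -> : V = (pQ p)^t* *m VV *m pQ p.
    rewrite /VV !mulmxA (cpQ hp) mul1mx -mulmxA (cpQ hp) mulmx1 //.
  apply: le_trans (nrmM _ _) _; rewrite mulrC -mulrA.
  rewrite ler_pM ?nrm_ge0 ?unitary_nrm ?(cpQ hp) //.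
  apply: le_trans (nrmM _ _) _; rewrite nrm_adj.
  by rewrite ler_pM ?nrm_ge0 ?unitary_nrm ?(cpQ hp).
have t0 : rinner V (tangent p (skew (trans p q)) (pD q - pD p) (pW q - pW p)) = 0.
  apply: conormal_tangent hV _ _ _; first exact: skew_adj.
    by rewrite dgB (cpD hp) (cpD hq).
  by rewrite adjB (cpWherm hp) (cpWherm hq).
have -> : rinner V Y = rinner V (Y - tangent p (skew (trans p q)) (pD q - pD p) (pW q - pW p)).
  by rewrite [RHS]rinnerBr t0 subr0.
apply: le_trans (rinner_le _ _) _.
have := h (s, p, q); rewrite /= => /(_ (And3 hp hq h1)) hY.
apply: le_trans (_ : (@ubound R n * @ubound R n * nrm VV) * (C * nrm (param q - param p) ^+ 2) <= _).
  by rewrite ler_pM ?nrm_ge0.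
have -> : @ubound R n * @ubound R n * nrm VV * (C * nrm (param q - param p) ^+ 2) =
  c * (nrm (param q - param p) ^+ 2 * nrm VV) by rewrite /c; ring.
rewrite -mulrA ler_wpM2r ?mulr_ge0 ?exprn_ge0 ?nrm_ge0 //.
by rewrite ltW // archi_boundP.
Qed.

Lemma param_bound (K : nat) s p l : chart_point K%:R s p ->
  `|co l (param p)| <= (3 * K)%:R :> R.
Proof.
move=> hp; apply: le_trans (co_le _ _) (le_trans (nrm_param hp) _).
by rewrite natrM; lra.
Qed.

Lemma critical_null (K : nat) : jordan_null [set A : M | exists s p V,
  [/\ chart_point K%:R s p, V != 0, conormal (pD p) (pW p) V & A = value p]].
Proof.
have [C1 h1] := value_lip K; have [C2 h2] := value_conormal K.
have C1C2 : C1%:R <= (C1 + C2)%:R :> R by rewrite ler_nat leq_addr.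
have C2C1 : C2%:R <= (C1 + C2)%:R :> R by rewrite ler_nat leq_addl.
pose G s (P A : M) := exists p V,
  [/\ chart_point K%:R s p, V != 0, conormal (pD p) (pW p) V & P = param p /\ A = value p].
apply: (@jordan_null_sub _ _ _ [set A | exists s P, G s P A]).
  by move=> A [s [p [V [hp V0 hV ->]]]]; exists s, (param p), p, V.
apply: (@null_critical_values R n n_gt0 _ G (3 * K) (C1 + C2)).
- by move=> s P A [p [V [hp _ _ [-> _]]]] l; apply: param_bound hp.
- move=> s P A P' A' [p [V [hp _ _ [-> ->]]]] [q [V' [hq _ _ [-> ->]]]] hpq.
  by apply: le_trans (h1 _ _ _ hp hq hpq) _; rewrite ler_wpM2r ?nrm_ge0.
move=> s P A [p [V [hp V0 hV [-> ->]]]].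
exists (pQ p *m V *m (pQ p)^t*).
  apply: contra_neq V0 => h; have : rinner V V = 0.
    by rewrite -(rinner_conj _ _ (cpQ hp)) h rinner0l.
  exact: rinner_eq0.
move=> P' A' [q [V' [hq _ _ [-> ->]]]] hpq.
apply: le_trans (h2 _ _ _ hp hV _ hq hpq) _.
by rewrite ler_wpM2r ?nrm_ge0 // ler_wpM2r ?exprn_ge0 ?nrm_ge0.
Qed.

Lemma coincident_null (K : nat) : jordan_null [set A : M | exists s p (i j : 'I_n),
  [/\ chart_point K%:R s p, (i < j)%N, pW p i j = 0 & A = value p]].
Proof.
have [C h] := value_lip K.
pose G s (k : 'I_(@rdim n)) (P A : M) := exists p (i j : 'I_n),
  [/\ chart_point K%:R s p, (i < j)%N, pW p i j = 0 & 
    [/\ k = enum_rank (i, j, false), P = param p & A = value p]].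
apply: (@jordan_null_sub _ _ _ [set A | exists s k P, G s k P A]).
  move=> A [s [p [i [j [hp ij w0 ->]]]]].
  by exists s, (enum_rank (i, j, false)), (param p), p, i, j.
(* The constraint is the vanishing of the real part of one entry of the
   packed matrix: a coordinate hyperplane. *)
apply: (@null_image_low R n n_gt0 _ G (3 * K) C).
- move=> s k P A [p [i [j [hp ij w0 [-> -> _]]]]]; split; last by move=> l; apply: param_bound hp.
  by rewrite /co enum_rankK mxE ltnNge (ltnW ij) /= -(inj_eq val_inj) ltn_eqF //= w0.
move=> s k P A P' A' [p [i [j [hp _ _ [_ -> ->]]]]] [q [i' [j' [hq _ _ [_ -> ->]]]]] hpq.
exact: h hp hq hpq.
Qed.

End NullSets.

(** * The exceptional set *)

Section Singular.
Context {R : realType} {n : nat}.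
Hypothesis n_gt0 : (0 < n)%N.
Local Notation M := 'M[Cplx R]_n.
Implicit Types (X Y A P V L U Q E D W H B : M) (p q : @point R n).

Definition critical_values (K : nat) : set M := [set A : M | exists s p V,
  [/\ chart_point K%:R s p, V != 0, conormal (pD p) (pW p) V & A = value p]].

Definition coincident_values (K : nat) : set M := [set A : M | exists s p (i j : 'I_n),
  [/\ chart_point K%:R s p, (i < j)%N, pW p i j = 0 & A = value p]].

Definition exceptional : set M := \bigcup_K (critical_values K `|` coincident_values K).

Lemma exceptional_null : lebesgue_null exceptional.
Proof.
apply: null_bigcup => // K.
exact: jordan_nullU (critical_null n_gt0 K) (coincident_null n_gt0 K).
Qed.

Lemma conj_cm E X Y : E^t* *m E = 1%:M ->
  E *m cm X Y *m E^t* = cm (E *m X *m E^t*) (E *m Y *m E^t*).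
Proof.
move=> hE; have e Z Z' : E *m (Z *m Z') *m E^t* = (E *m Z *m E^t*) *m (E *m Z' *m E^t*).
  by rewrite !mulmxA -[_ *m E^t* *m E]mulmxA hE mulmx1.
by rewrite !cmE -!e mulmxBr mulmxBl.
Qed.

Lemma conj_diag E D : E^t* *m E = 1%:M -> dg E = E -> dg D = D -> E *m D *m E^t* = D.
Proof.
move=> hE dE dD; have := cm_dg_dg E D; rewrite dE dD cmE => /eqP; rewrite subr_eq0 => /eqP ->.
by rewrite -mulmxA (mulmx1C hE) mulmx1.
Qed.

Lemma rinner_conjV E V Y : rinner (E^t* *m V *m E) Y = rinner V (E *m Y *m E^t*).
Proof. by rewrite rinner_mulrV rinner_mullV trmxCK mulmxA. Qed.

Lemma conjVK E W : E^t* *m E = 1%:M -> E *m (E^t* *m W *m E) *m E^t* = W.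
Proof.
move=> hE; have hE' := mulmx1C hE.
by rewrite !mulmxA hE' mul1mx -mulmxA hE' mulmx1.
Qed.

(** The chart at [Q] requires a change of representative [Q E].  The map is
    equivariant: conjugating [W] and [V] by the diagonal unitary [E] leaves the
    value and the conormal condition unchanged. *)
Lemma conormal_conj E D W V : E^t* *m E = 1%:M -> dg E = E -> dg D = D ->
  conormal D W V -> conormal D (E^t* *m W *m E) (E^t* *m V *m E).
Proof.
move=> hE dE dD [h1 h2 h3]; have hE' := mulmx1C hE.
have eW := conjVK W hE.
have eD F : dg F = F -> E *m F *m E^t* = F by exact: conj_diag.
have eDD Y : E *m (cm D Y) *m E^t* = cm D (E *m Y *m E^t*).
  by rewrite conj_cm // eD.
split.
- move=> H hH; rewrite rinner_conjV conj_cm // mulmxDr mulmxDl eDD eW eD //.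
  by apply: h1; rewrite !adjM trmxCK hH mulNmx mulmxN mulmxA.
- move=> F hF; rewrite rinner_conjV mulmxDr mulmxDl conj_cm // eW eD //.
  exact: h2.
move=> H hH; rewrite rinner_conjV eDD; apply: h3.
by rewrite !adjM trmxCK hH mulmxA.
Qed.

Lemma conj_value Q E D W : E^t* *m E = 1%:M -> dg E = E -> dg D = D ->
  (Q *m E) *m (D + cm D (E^t* *m W *m E)) *m (Q *m E)^t* = Q *m (D + cm D W) *m Q^t*.
Proof.
move=> hE dE dD; set X := D + _.
have e : E *m X *m E^t* = D + cm D W.
  by rewrite /X mulmxDr mulmxDl (conj_cm D _ hE) (conj_diag hE dE dD) (conjVK W hE).
by rewrite -e adjM; move: X {e} => X; rewrite !mulmxA.
Qed.

Lemma dg_conj_diag E W : dg E = E -> dg W = 0 -> dg (E^t* *m W *m E) = 0.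
Proof.
move=> dE dW; apply/matrixP => i j; rewrite dgE zeroE; case: eqP => // _.
have w0 : W i i = 0 by move/matrixP: dW => /(_ i i); rewrite dgE eqxx zeroE.
by rewrite -dE dg_mulr dg_adj dg_mull w0 mulr0 mul0r.
Qed.

Lemma nat_bound (a b c d : R) : exists K : nat, [/\ a <= K%:R, b <= K%:R, c <= K%:R & d <= K%:R].
Proof.
pose m := `|a| + `|b| + `|c| + `|d|.
have m0 : 0 <= m by rewrite !addr_ge0.
exists (Num.Def.archi_bound m); have := archi_boundP m0; rewrite /m => h.
have := ler_norm a; have := ler_norm b; have := ler_norm c; have := ler_norm d.
have := normr_ge0 a; have := normr_ge0 b; have := normr_ge0 c; have := normr_ge0 d.
by split; lra.
Qed.

Lemma critical_exceptional Q D W V : Q^t* *m Q = 1%:M -> dg D = D -> W^t* = W ->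
  dg W = 0 -> V != 0 -> conormal D W V -> exceptional (Q *m (D + cm D W) *m Q^t*).
Proof.
move=> hQ dD hW dW V0 hV.
have [s [L [U [E [uL LL pU [dE hE] e]]]]] := chart_exists n_gt0 hQ.
pose W' := E^t* *m W *m E; have hE' := mulmx1C hE.
have [K [K1 K2 K3 K4]] := nat_bound (nrm L) (nrm (invmx L)) (nrm D) (nrm W').
exists K => //; left; exists s, (Point (Q *m E) L U D W'), (E^t* *m V *m E); split.
- split=> //=; first by rewrite adjM mulmxA -[_ *m Q]mulmxA hQ mulmx1.
    by rewrite /W' !adjM trmxCK hW mulmxA.
  exact: dg_conj_diag.
- apply: contra_neq V0 => h.
  by rewrite -(conjVK V hE) h mulmx0 mul0mx.
- exact: conormal_conj.
exact/esym/conj_value.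
Qed.

(** The entries of [W] at the positions [(i, j)] and [(j, i)] do not contribute
    to [[D, W]], so they are replaced by zero. *)
Lemma coincident_exceptional Q D W (i j : 'I_n) : Q^t* *m Q = 1%:M -> dg D = D -> W^t* = W ->
  dg W = 0 -> i != j -> D i i = D j j -> exceptional (Q *m (D + cm D W) *m Q^t*).
Proof.
move=> hQ dD hW dW; wlog ij : i j / (i < j)%N.
  move=> hw; have [ij|ji|/val_inj ->] := ltngtP i j; last by rewrite eqxx.
    exact: hw.
  by move=> nij e; apply: (hw j i) => //; rewrite eq_sym.
move=> _ eD.
have [s [L [U [E [uL LL pU [dE hE] e]]]]] := chart_exists n_gt0 hQ.
have [W' W'E] : exists W', W' = E^t* *m W *m E by exists (E^t* *m W *m E).
have hW' : W'^t* = W' by rewrite W'E !adjM trmxCK hW mulmxA.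
have dW' : dg W' = 0 by rewrite W'E; exact: dg_conj_diag.
pose T (a b : 'I_n) := ((a == i) && (b == j)) || ((a == j) && (b == i)).
pose W2 : M := \matrix_(a, b) if T a b then 0 else W' a b.
have hW2 : W2^t* = W2.
  apply/matrixP => a b; rewrite !mxE /T orbC andbC [(b == i) && _]andbC.
  case: ifP => _; first by rewrite conjC0.
  by rewrite -{2}hW' !mxE.
have dW2 : dg W2 = 0.
  apply/matrixP => a b; rewrite dgE zeroE mxE; case: eqP => // _; case: ifP => // _.
  by move/matrixP: dW' => /(_ a a); rewrite dgE eqxx zeroE.
have eW2 : cm D W2 = cm D W'.
  apply/matrixP => a b; rewrite -dD !cm_dgE mxE.
  case: ifP => // /orP[]/andP[/eqP -> /eqP ->]; by rewrite eD subrr !mul0r.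
have [K [K1 K2 K3 K4]] := nat_bound (nrm L) (nrm (invmx L)) (nrm D) (nrm W2).
exists K => //; right; exists s, (Point (Q *m E) L U D W2), i, j; split=> //.
- by split=> //=; rewrite adjM mulmxA -[_ *m Q]mulmxA hQ mulmx1.
- by rewrite /= mxE /T !eqxx.
rewrite /value /core /= eW2 W'E; exact/esym/conj_value.
Qed.

(** Distinctness comes first: it is what makes the conormal of a degenerate
    Hessian nonzero. *)
Lemma nonexceptional A Q : ~ exceptional A -> Q^t* *m Q = 1%:M ->
  let B := Q^t* *m A *m Q in critical B -> psd B ->
  (forall i j, i != j -> B i i != B j j) /\
  (forall H, H^t* = - H -> dg H = 0 -> H != 0 -> 0 < hessform B H).
Proof.
move=> nJ hQ B hc hp; have [W [hW dW BE]] := normal_form hc hp.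
have AE : A = Q *m (dg B + cm (dg B) W) *m Q^t*.
  by rewrite -BE /B !mulmxA (mulmx1C hQ) mul1mx -mulmxA (mulmx1C hQ) mulmx1.
have dist i j : i != j -> B i i != B j j.
  move=> ij; apply/eqP => e; apply: nJ; rewrite AE.
  apply: (coincident_exceptional hQ (dgK B) hW dW ij).
  by rewrite (dgE B i i) (dgE B j j) !eqxx.
split=> // H hH dH H0; rewrite lt_def hp // andbT; apply/eqP => hz.
have [V V0 hV] := degenerate_conormal hc hp dist hW BE hH dH H0 hz.
by apply: nJ; rewrite AE; exact: (critical_exceptional hQ (dgK B) hW dW V0 hV).
Qed.

End Singular.

(** * Continuity and compactness *)

Section Compactness.
Context {R : realType} {n : nat}.
Local Notation M := 'M[Cplx R]_n.
Local Notation d := (@rdim n).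
Implicit Types (X Y Q : M).

Definition of_co (v : 'rV[R]_d) : M :=
  \matrix_(i, j) mkC (v 0 (enum_rank (i, j, false))) (v 0 (enum_rank (i, j, true))).

Lemma co_of_co v k : co k (of_co v) = v 0 k.
Proof.
rewrite /co; case e: (enum_val k) => [[i j] b].
have -> : k = enum_rank (i, j, b) by rewrite -e enum_valK.
by rewrite mxE; case: b {e}.
Qed.

Lemma nrm_of_co v Q : nrm (of_co v - Q) = \sum_k `|v 0 k - co k Q|.
Proof. by rewrite nrm_co; apply: eq_bigr => k _; rewrite coB co_of_co. Qed.

Lemma of_coK X : of_co (\row_k co k X) = X.
Proof.
apply/matrixP => i j; rewrite !mxE; apply: cplxP => /=; rewrite /co enum_rankK //.
Qed.

(** Boxes of real coordinates are compact, and the sum of the coordinate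
    distances is continuous. *)
Lemma finite_ball_cover (C : R) (e : M -> R) : (forall Q, 0 < e Q) ->
  exists s : seq M, forall X, nrm X <= C -> exists2 Q, Q \in s & nrm (X - Q) < e Q.
Proof.
move=> e0; pose K := [set v : 'rV[R]_d | forall k, `[(- C), C]%classic (v ord0 k)].
have cK : compact K by apply: (@rV_compact _ _ (fun=> `[(- C), C]%classic)) => _; exact: segment_compact.
pose U Q := [set v : 'rV[R]_d | nrm (of_co v - Q) < e Q].
have oU Q : open (U Q).
  have -> : U Q = (fun v : 'rV[R]_d => \sum_k `|v 0 k - co k Q|) @^-1` [set y | y < e Q].
    by apply/seteqP; split=> v /=; rewrite /U /= nrm_of_co.
  apply: open_comp; last exact: open_lt.
  move=> v _; apply: (@continuous_big R 'I_d +%R 0 xpredT); first exact: add_continuous.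
  move=> k _ w.
  apply: (@continuous_comp _ _ _ (fun v : 'rV[R]_d => v 0 k - co k Q) (fun x : R => `|x|) w).
    by apply: continuousB; [exact: (@coord_continuous R 1 d 0 k)|exact: cst_continuous].
  exact: norm_continuous.
move: cK; rewrite compact_cover => /(_ _ setT U (fun Q _ => oU Q)) [|D _ hD].
  move=> v _; exists (of_co v) => //=.
  by rewrite /U /= subrr nrm0.
exists (finmap.enum_fset D) => X hX.
have : K (\row_k co k X).
  move=> k /=; rewrite in_itv /= mxE.
  by rewrite -ler_norml; exact: le_trans (co_le k X) hX.
move=> /hD[Q QD] /=; rewrite /U /= of_coK => h.
by exists Q.
Qed.

End Compactness.

Section Lipschitz.
Context {R : realType} {n : nat}.
Local Notation M := 'M[Cplx R]_n.
Implicit Types (X Y Q A B W H E D : M).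

Section AtPoint.
Variable Q : M.
Let dom (X : M) : Prop := nrm (X - Q) <= 1.
Let dist (X : M) : R := nrm (X - Q).

Let dist01 X : dom X -> 0 <= dist X <= 1.
Proof. by move=> h; rewrite /dist nrm_ge0. Qed.

Let jid : jet dom dist (fun X => X) (fun _ => Q) (fun X => X - Q).
Proof.
split; first exact: isO_cst; last by apply: isO_eq (isO0 _ _ 2) => X _; rewrite subrr.
by exists 1 => // X _; rewrite mul1r expr1.
Qed.

Lemma jet_rinner_lip (T : Type) (D' : T -> Prop) (h : T -> R) c c0 c1 e e0 e1 :
  (forall t, D' t -> 0 <= h t <= 1) ->
  @jet R n T D' h c c0 c1 -> @jet R n T D' h e e0 e1 ->
  isOr D' h 1 (fun t => rinner (c t) (e t) - rinner (c0 t) (e0 t)).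
Proof.
move=> h01 jc je; have [c00 _ _] := jc.
have k1 := isO_rinner (jet_lip h01 jc) (jet_bounded h01 je).
have k2 := isO_rinner c00 (jet_lip h01 je).
by apply: isOr_eq (isOrD k1 k2) => t _; rewrite rinnerBl rinnerBr addrA subrK.
Qed.

Lemma isOr_continuous (F : M -> R) : isOr dom dist 1 (fun X => F X - F Q) ->
  forall eta, 0 < eta -> exists2 e : R, 0 < e & forall X, nrm (X - Q) < e -> `|F X - F Q| < eta.
Proof.
move=> [C C0 h] eta eta0; exists (Num.min 1 (eta / (C + 1))).
  by rewrite lt_min ltr01 divr_gt0 //; lra.
move=> X; rewrite lt_min ltr_pdivlMr; last lra.
move=> /andP[X1 X2]; apply: le_lt_trans (h X (ltW X1)) _; rewrite expr1 /dist.
by have := nrm_ge0 (X - Q); lra.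
Qed.

Let jconj A : jet dom dist (fun X => X^t* *m A *m X) (fun _ => Q^t* *m A *m Q)
    (fun X => Q^t* *m A *m (X - Q) + (Q^t* *m 0 + (X - Q)^t* *m A) *m Q).
Proof. exact: (jetM dist01 (jetM dist01 (jet_adj jid) (jet_cst _ _ A)) jid). Qed.

Let isOr_nrm (G : M -> M) : isO dom dist 1 (fun X => G X - G Q) ->
  isOr dom dist 1 (fun X => nrm (G X) - nrm (G Q)).
Proof.
move=> [C C0 h]; exists C => // X dX; apply: le_trans (h X dX).
rewrite ler_norml; apply/andP; split.
  have := nrmD (G X) (G Q - G X); rewrite addrC subrK nrmC; lra.
have := nrmD (G Q) (G X - G Q); rewrite addrC subrK; lra.
Qed.

Lemma unitary_defect_lip : isOr dom dist 1 (fun X =>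
  nrm (X^t* *m 1%:M *m X - 1%:M) - nrm (Q^t* *m 1%:M *m Q - 1%:M)).
Proof.
apply: (isOr_nrm (G := fun X => X^t* *m 1%:M *m X - 1%:M)).
apply: isO_eq (jet_lip dist01 (jconj 1%:M)) => X _ /=.
by rewrite opprB addrA subrK.
Qed.

Lemma gradient_lip A W : isOr dom dist 1 (fun X =>
  rinner (cm (dg (X^t* *m A *m X)) W) (X^t* *m A *m X) -
  rinner (cm (dg (Q^t* *m A *m Q)) W) (Q^t* *m A *m Q)).
Proof.
have j := jconj A.
exact: (jet_rinner_lip dist01 (jet_cm dist01 (jet_dg j) (jet_cst _ _ W)) j).
Qed.

Lemma hessform_lip A W : isOr dom dist 1 (fun X =>
  hessform (X^t* *m A *m X) W - hessform (Q^t* *m A *m Q) W).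
Proof.
have j := jconj A; have jW := jet_cm dist01 j (jet_cst _ _ W).
have h1 := jet_rinner_lip dist01 (jet_cm dist01 (jet_dg j) (jet_cst _ _ W)) jW.
have h2 := jet_rinner_lip dist01 (jet_dg jW) jW.
have arith (a b c e : R) : (a - b + (a - b)) - (c - e + (c - e)) =
  2 * a - 2 * c - (2 * b - 2 * e) by ring.
by apply: isOr_eq (isOrB (isOrD h1 h1) (isOrD h2 h2)) => X _; exact: arith.
Qed.

(** The function whose minimum on the unit sphere is taken in
    [posdef_bound]. *)
Lemma hessform_dir_lip B : isOr dom dist 1 (fun X =>
  (hessform B (offdiag (skew X)) + nrm (X - offdiag (skew X))) -
  (hessform B (offdiag (skew Q)) + nrm (Q - offdiag (skew Q)))).
Proof.
have j := jet_offdiag (jet_skew jid).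
have jW := jet_cm dist01 (jet_cst _ _ B) j.
have h1 := jet_rinner_lip dist01 (jet_cm dist01 (jet_cst _ _ (dg B)) j) jW.
have h2 := jet_rinner_lip dist01 (jet_dg jW) jW.
have h3 : isOr dom dist 1 (fun X => nrm (X - offdiag (skew X)) - nrm (Q - offdiag (skew Q))).
  exact: (isOr_nrm (G := fun X => X - offdiag (skew X)) (jet_lip dist01 (jetB jid j))).
have arith (a b c e f g : R) : (a - b + (a - b)) - (c - e + (c - e)) + (f - g) =
  (2 * a - 2 * c + f) - (2 * b - 2 * e + g) by ring.
by apply: isOr_eq (isOrD (isOrB (isOrD h1 h1) (isOrD h2 h2)) h3) => X _; exact: arith.
Qed.

End AtPoint.

Lemma cm0r B : cm B 0 = 0.
Proof. by rewrite cmE mulmx0 mul0mx subrr. Qed.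

Lemma hessform0 B : hessform B 0 = 0.
Proof. by rewrite /hessform !cm0r rinner0l rinner0r !mulr0 subrr. Qed.

Lemma hessformZ B H (t : R) : hessform B (mkC t 0 *: H) = t ^+ 2 * hessform B H.
Proof.
rewrite /hessform !cmZr dgZ !(rinnerZl, rinnerZr).
move: (rinner (cm (dg B) H) _) (rinner (dg _) _) => a b; ring.
Qed.

(** A minimum over the unit sphere of a subspace.  To use compactness in the
    whole matrix space, the form is evaluated on the projection [pi X] and the
    distance [nrm (X - pi X)] is added: the sum is positive at every
    [X <> 0]. *)
Lemma posdef_bound B :
  (forall H, H^t* = - H -> dg H = 0 -> H != 0 -> 0 < hessform B H) ->
  exists2 c : R, 0 < c & forall H, H^t* = - H -> dg H = 0 ->
    c * nrm H ^+ 2 <= hessform B H.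
Proof.
move=> hpos; pose pi X := offdiag (skew X).
have piS X : (pi X)^t* = - pi X.
  by rewrite /pi offdiagE adjB dg_adj skew_adj dgN opprK opprB addrC.
have pi0 X : dg (pi X) = 0 by rewrite /pi offdiagE dgB dgK subrr.
pose F X := hessform B (pi X) + nrm (X - pi X).
have Fpos X : X != 0 -> 0 < F X.
  move=> X0; have [p0|p0] := eqVneq (pi X) 0.
    by rewrite /F p0 subr0 hessform0 add0r nrm_gt0.
  by rewrite /F ltr_pwDl ?nrm_ge0 // hpos.
have /choice[r hr] Q : exists r : R * R, [/\ 0 < r.1, 0 < r.2 &
    forall X, nrm (X - Q) < r.1 -> nrm X = 1 -> r.2 <= F X].
  have [->|Q0] := eqVneq Q 0.
    by exists (1, 1); split=> // X; rewrite subr0 => + X1; rewrite X1 ltxx.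
  have FQ := Fpos Q Q0; have FQ2 : 0 < F Q / 2 by rewrite divr_gt0.
  have [e e0 he] := isOr_continuous (hessform_dir_lip Q B) FQ2.
  exists (e, F Q / 2); split; [exact: e0|exact: FQ2|move=> X XQ _].
  have hX : `|F X - F Q| < F Q / 2 by exact: he X XQ.
  move: hX; rewrite /=; move: (F X) (F Q) => a b; rewrite ltr_norml => /andP[h _]; lra.
have r1 Q : 0 < (r Q).1 by have [] := hr Q.
have [s hs] := finite_ball_cover 1 r1.
have [c c0 hc] : exists2 c : R, 0 < c & forall Q, Q \in s -> c <= (r Q).2.
  elim: s {hs} => [|Q s [c c0 hc]]; first by exists 1.
  have [_ q0 _] := hr Q; exists (Num.min c (r Q).2); first by rewrite lt_min c0 q0.
  move=> X; rewrite inE => /orP[/eqP ->|/hc h]; first by rewrite ge_min lexx orbT.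
  by rewrite ge_min h.
exists c => // H hH dH.
have [->|H0] := eqVneq H 0; first by rewrite hessform0 nrm0 expr2 !mulr0.
have nH := nrm_gt0 H0.
pose X := mkC (nrm H)^-1 0 *: H.
have X1 : nrm X = 1 by rewrite /X nrmZr gtr0_norm ?invr_gt0 // mulVf // gt_eqF.
have piX : pi X = X.
  by rewrite /pi skew_id ?offdiagE /X ?dgZ ?dH ?scaler0 ?subr0 // adjZ hH scalerN.
have X1le : nrm X <= 1 by rewrite X1.
have [Q Qs XQ] := hs X X1le.
have [_ _ hX] := hr Q; have := le_trans (hc Q Qs) (hX X XQ X1).
rewrite /F piX subrr nrm0 addr0 /X hessformZ exprVn mulrC ler_pdivlMr ?exprn_gt0 //.
Qed.

End Lipschitz.

(** * Isolation of nondegenerate critical points *)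

Section Isolation.
Context {R : realType} {n : nat}.
Local Notation M := 'M[Cplx R]_n.
Implicit Types (X Y Q A B W H E D : M).

(** The numerical part of the isolation argument: [h] is the norm of
    the off-diagonal part of [X], [m] that of its skew-Hermitian approximation,
    and [y] the Hessian in that direction.  From [h - C' h^2 <= m] and
    [c m^2 <= y <= 2 C h^3] follows a lower bound for [h]. *)
Lemma small_remainder (a b y z : R) :
  a = 0 -> b = 0 -> `|a - (b + 2^-1 * y)| <= z -> y <= 2 * z.
Proof.
by move=> -> ->; rewrite !add0r normrN => hz; have := le_trans (ler_norm _) hz; lra.
Qed.

Lemma isolation_const_gt0 (c C C' : R) : 0 < c -> 0 <= C -> 0 <= C' ->
  0 < 1 + 2 * C' + 8 * C / c.
Proof.
move=> c0 C0 C'0; have : 0 <= 8 * C / c by rewrite divr_ge0 ?mulr_ge0 // ltW.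
lra.
Qed.

Lemma isolation_radius_le1 (c C C' h : R) : 0 < c -> 0 <= C -> 0 <= C' -> 0 < h ->
  h * (1 + 2 * C' + 8 * C / c) < 1 -> h <= 1.
Proof.
move=> c0 C0 C'0 h0; have : 0 <= 8 * C / c by rewrite divr_ge0 ?mulr_ge0 // ltW.
by move: (8 * C / c) => z z0; nra.
Qed.

Lemma isolation_contradiction (c C C' h m y : R) : 0 < c -> 0 <= C -> 0 <= C' -> 0 < h ->
  h * (1 + 2 * C' + 8 * C / c) < 1 -> 0 <= m -> h <= m + C' * h ^+ 2 ->
  c * m ^+ 2 <= y -> y <= 2 * (C * h ^+ 3) -> False.
Proof.
move=> c0 C0 C'0 h0 hk m0 hm hy1 hy2.
have [z [z0 zc]] : exists z, 0 <= z /\ 8 * C = z * c.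
  by exists (8 * C / c); rewrite divr_ge0 ?mulr_ge0 ?(ltW c0) // divfK // lt0r_neq0.
have ez : 8 * C / c = z by rewrite zc mulfK // lt0r_neq0.
rewrite ez in hk; have hz : h * z < 1 by nra.
have hC' : h * (C' * 2) < 1 by nra.
have mh : h / 2 <= m.
  have : h * (h * (C' * 2)) <= h * 1 by rewrite ler_pM2l // ltW.
  by move: hm; rewrite expr2; lra.
have m2 : (h / 2) ^+ 2 <= m ^+ 2 by rewrite ler_pXn2r ?nnegrE // divr_ge0 // ltW.
have : c * (h / 2) ^+ 2 <= 2 * (C * h ^+ 3).
  by apply: le_trans hy2; apply: le_trans hy1; rewrite ler_wpM2l // ltW.
have -> : c * (h / 2) ^+ 2 = c * h ^+ 2 / 4 by field.
have -> : 2 * (C * h ^+ 3) = (8 * C) * h * h ^+ 2 / 4 by field.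
rewrite zc leNgt => /negP; apply.
rewrite ltr_pM2r ?invr_gt0 // ltr_pM2r ?exprn_gt0 //.
have -> : z * c * h = c * (h * z) by ring.
by rewrite gtr_pMr.
Qed.

(** The left side is a sum of terms of third order; the right side is the
    gradient at [B'] paired with [W], minus its expansion at [B]. *)
Lemma gradient_algebra B B' W : W^t* = - W -> let B1 := cm B W in
  rinner (cm (dg (B' - B - B1)) W) B' + rinner (cm (dg B1) W) (B' - B) +
  rinner (cm (dg B) W) (B' - B - B1) =
  rinner (cm (dg B') W) B' - (rinner (cm (dg B) W) B + 2^-1 * hessform B W).
Proof.
move=> hW B1; have e1 := rinner_cm (dg B1) B hW.
have -> : cm (dg (B' - B - B1)) W = cm (dg B') W - cm (dg B) W - cm (dg B1) W.
  by rewrite dgB dgB cmBl cmBl.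
have -> : hessform B W = 2 * rinner (cm (dg B) W) B1 - 2 * rinner (dg B1) B1 by [].
have {e1} : rinner (cm (dg B1) W) B = - rinner (dg B1) B1 by exact: e1.
move: (dg B1) => dB1; move: (cm dB1 W) (cm (dg B') W) (cm (dg B) W) => a1 a' a0.
clearbody B1; move=> e1.
rewrite 2!rinnerBl rinnerBr rinnerBr rinnerBr e1.
move: (rinner a' B') (rinner a0 B') (rinner a1 B') (rinner a0 B) (rinner a0 B1) (rinner dB1 B1).
by move=> *; field.
Qed.

Let dom (X : M) : Prop := [/\ X^t* *m X = 1%:M,
  forall i, 0 < re (X i i) /\ im (X i i) = 0 & nrm (offdiag X) <= 1].
Let dist (X : M) : R := nrm (offdiag X).
Local Notation O k c := (isO dom dist k c).

Let dist01 X : dom X -> 0 <= dist X <= 1.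
Proof. by move=> [_ _ h]; rewrite /dist nrm_ge0. Qed.

Let offdiag_O : O 1 (fun X => offdiag X).
Proof. by exists 1 => // X _; rewrite mul1r expr1. Qed.

(* A unit column with off-diagonal part of size h and a positive diagonal
   entry has that entry within h^2 of 1. *)
Let diag_O : O 2 (fun X => dg X - 1%:M).
Proof.
exists (n%:R * n%:R); first by rewrite mulr_ge0.
move=> X [hX pX _]; apply: nrm_le_entry => i j; rewrite addE oppE dgE mxE.
case: eqVneq => [->|_]; last by rewrite mulr0n subr0 /cnorm /= normr0 addr0 exprn_ge0 ?nrm_ge0.
have [x0 x1] := pX j; rewrite mulr1n /cnorm !(reD, imD, reN, imN) x1 /= subr0 normr0 addr0.
have := unitary_col j hX; rewrite (bigD1 j) //= {1}/sq x1 [0 ^+ 2]expr2 mul0r addr0.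
have hs : \sum_(i0 | i0 != j) sq (X i0 j) <= dist X ^+ 2.
  apply: le_trans (sum_sq_part (offdiag X) (fun a => a != j) (fun b => b == j)).
  apply: ler_sum => a aj; rewrite big_pred1_eq offdiag_ij (negPf aj) //.
have hs0 : 0 <= \sum_(i0 | i0 != j) sq (X i0 j) by apply: sumr_ge0 => *; exact: sq_ge0.
move: hs hs0; move: (\sum_(_ | _) _) => S hs hs0 e1.
have x1' : re (X j j) <= 1 by nra.
by rewrite ler0_norm; [nra|lra].
Qed.

Let sub1_split X : X - 1%:M = offdiag X + (dg X - 1%:M).
Proof. by rewrite offdiagE; mxab. Qed.

Let sub1_O : O 1 (fun X => X - 1%:M).
Proof.
apply: isO_eq (isOD offdiag_O (isO_weak dist01 (leqnSn 1) diag_O)) => X _.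
by rewrite -sub1_split.
Qed.

Let skew_O : O 2 (fun X => X - 1%:M - skew X).
Proof.
apply: isO_eq (isON (isOZ (2^-1) (isOM (isO_adj sub1_O) sub1_O))) => X [hX _ _].
by rewrite unitary_skew.
Qed.

Let Om X := offdiag (skew X).

Let Om_O2 : O 2 (fun X => offdiag X - Om X).
Proof.
apply: isO_eq (isO_offdiag skew_O) => X _; rewrite !offdiagB /Om.
have -> : offdiag (1%:M : M) = 0.
  by apply/matrixP => i j; rewrite offdiag_ij mxE zeroE; case: eqP.
by rewrite subr0.
Qed.

Let Om_O1 : O 1 Om.
Proof.
apply: isO_eq (isOB offdiag_O (isO_weak dist01 (leqnSn 1) Om_O2)) => X _.
by rewrite opprB addrC subrK.
Qed.

Let Om_skew X : (Om X)^t* = - Om X.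
Proof. by rewrite /Om offdiagE adjB dg_adj skew_adj dgN opprK opprB addrC. Qed.

Let jX : jet dom dist (fun X => X) (fun _ => 1%:M) Om.
Proof.
split; [exact: isO_cst|exact: Om_O1|].
apply: isO_eq (isOD (isOB diag_O (isO_weak dist01 (leqnn 2) (isO_offdiag (isO0 dom dist 2)))) Om_O2) => X _.
rewrite sub1_split offdiag0; mxab.
Qed.

Let jB B : jet dom dist (fun X => X^t* *m B *m X) (fun _ => B) (fun X => cm B (Om X)).
Proof.
have J := jetM dist01 (jetM dist01 (jet_adj jX) (jet_cst _ _ B)) jX.
have [J0 J1 J2] := J.
have e0 : (1%:M : M)^t* *m B *m 1%:M = B by rewrite adj1 mul1mx mulmx1.
have e1 X : (1%:M : M)^t* *m B *m Om X + ((1%:M : M)^t* *m 0 + (Om X)^t* *m B) *m 1%:M = cm B (Om X).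
  by rewrite adj1 mul1mx mulmx0 add0r mulmx1 Om_skew mulNmx cmE.
split.
- by apply: isO_eq J0 => X _.
- by apply: isO_eq J1 => X _; rewrite e1.
by apply: isO_eq J2 => X _; rewrite e0 e1.
Qed.

(* If B is critical, then the gradient at a nearby point, paired with the
   direction Om X that leads there, is half the Hessian up to third order. *)
Let gradient_expansion B :
  isOr dom dist 3 (fun X => rinner (cm (dg (X^t* *m B *m X)) (Om X)) (X^t* *m B *m X) -
   (rinner (cm (dg B) (Om X)) B + 2^-1 * hessform B (Om X))).
Proof.
have J := jB B; have [_ B1 r2] := J.
have a3 := isO_cm (isO_dg r2) Om_O1.
have a2 := isO_cm (isO_dg B1) Om_O1.
have a1 := isO_cm (isO_cst dom dist (dg B)) Om_O1.
have t1 := isO_rinner a3 (jet_bounded dist01 J).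
have t2 := isO_rinner a2 (jet_lip dist01 J).
have t3 := isO_rinner a1 r2.
apply: isOr_eq (isOrD (isOrD t1 t2) t3) => X _ /=.
exact: gradient_algebra (Om_skew X).
Qed.

(** If [X] is critical, then the left side of the gradient expansion vanishes
    at both points, so the Hessian in the direction [Om X] is [O (h^3)]; by
    [posdef_bound] it is at least of order [h^2]. *)
Lemma isolated_normalized B : critical B ->
  (forall H, H^t* = - H -> dg H = 0 -> H != 0 -> 0 < hessform B H) ->
  exists2 e : R, 0 < e & forall X, X^t* *m X = 1%:M ->
    (forall i, 0 < re (X i i) /\ im (X i i) = 0) -> nrm (offdiag X) < e ->
    critical (X^t* *m B *m X) -> offdiag X = 0.
Proof.
move=> hc /posdef_bound[c c0 hpos].
have [C C0 hC] := gradient_expansion B.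
have [C' C'0 hC'] := Om_O2.
pose k := 1 + 2 * C' + 8 * C / c.
have k0 : 0 < k by exact: isolation_const_gt0.
exists k^-1; first by rewrite invr_gt0.
move=> X hX pX; rewrite -[k^-1]mul1r ltr_pdivlMr // => hk hcX.
apply/eqP/negPn/negP => X0.
have h0 := nrm_gt0 X0.
have h1 : nrm (offdiag X) <= 1 := isolation_radius_le1 c0 C0 C'0 h0 hk.
have dX : dom X by split.
have upper := small_remainder (hcX _ (Om_skew X)) (hc _ (Om_skew X)) (hC X dX).
have dO : dg (Om X) = 0 by rewrite /Om offdiagE dgB dgK subrr.
have hOm : nrm (offdiag X) <= nrm (Om X) + C' * nrm (offdiag X) ^+ 2.
  have e1 : offdiag X = Om X + (offdiag X - Om X) by rewrite addrC subrK.
  rewrite {1}e1; apply: le_trans (nrmD _ _) _.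
  by rewrite lerD2l; exact: hC' X dX.
exact: isolation_contradiction c0 C0 C'0 h0 hk (nrm_ge0 _) hOm (hpos _ (Om_skew X) dO) upper.
Qed.

Lemma dg_conj E B : dg E = E -> E^t* *m E = 1%:M -> dg (E^t* *m B *m E) = dg B.
Proof.
move=> dE hE; apply/matrixP => i j; rewrite !dgE; case: eqP => // _.
have e : (E^t* : M) i i * E i i = 1.
  by have := hE; rewrite -{1}dE dg_adj => /matrixP/(_ i i); rewrite dg_mull [RHS]mxE eqxx.
by rewrite -[in LHS]dE dg_mulr dg_adj dg_mull mulrAC e mul1r.
Qed.

Lemma critical_conj E B : dg E = E -> E^t* *m E = 1%:M -> critical B ->
  critical (E^t* *m B *m E).
Proof.
move=> dE hE hc H hH; rewrite (dg_conj _ dE hE) rinnerC rinner_conjV rinnerC.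
rewrite (conj_cm _ _ hE) (conj_diag hE dE (dgK B)); apply: hc.
by rewrite !adjM trmxCK hH mulNmx mulmxN mulmxA.
Qed.

(** A critical [Q'] near [Q] is [Q X] with [X] near the identity; column phases
    [E] make the diagonal of [X] positive, and criticality is invariant under
    them.  Then [X E] is diagonal by [isolated_normalized]. *)
Lemma isolated A Q : Q^t* *m Q = 1%:M -> critical (Q^t* *m A *m Q) ->
  (forall H, H^t* = - H -> dg H = 0 -> H != 0 -> 0 < hessform (Q^t* *m A *m Q) H) ->
  exists2 e : R, 0 < e & forall Q' : M, Q'^t* *m Q' = 1%:M ->
    critical (Q'^t* *m A *m Q') -> nrm (Q' - Q) < e ->
    exists D : M, [/\ D^t* *m D = 1%:M, dg D = D & Q' = Q *m D].
Proof.
move=> hQ hc hpos; have [e e0 he] := isolated_normalized hc hpos.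
have u0 : 0 <= @ubound R n by rewrite !mulr_ge0.
pose u := @ubound R n + 1; have u1 : 0 < u by rewrite ltr_wpDl.
exists (Num.min 1 (e / 2) / u); first by rewrite divr_gt0 // lt_min ltr01 divr_gt0.
move=> Q' hQ' hc'; rewrite ltr_pdivlMr // lt_min => /andP[near1 near2].
have hQ1 := mulmx1C hQ.
have [X XE] : exists X, X = Q^t* *m Q' by exists (Q^t* *m Q').
have hX : X^t* *m X = 1%:M.
  by rewrite XE adjM trmxCK mulmxA -[_ *m Q *m _]mulmxA hQ1 mulmx1.
have QX : Q' = Q *m X by rewrite XE mulmxA hQ1 mul1mx.
have nX : nrm (X - 1%:M) <= nrm (Q' - Q) * u.
  have -> : X - 1%:M = Q^t* *m (Q' - Q) by rewrite mulmxBr hQ -XE.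
  apply: le_trans (nrmM _ _) _; rewrite nrm_adj mulrC ler_wpM2l ?nrm_ge0 //.
  by apply: le_trans (unitary_nrm hQ) _; rewrite /u lerDl.
have X0 i : X i i != 0.
  apply/eqP => h; have := le_lt_trans (le_trans (nrm_entry (X - 1%:M) i i) nX) near1.
  by rewrite addE oppE mxE eqxx mulr1n h sub0r cnormN /cnorm /= normr1 normr0 addr0 ltxx.
have [E [dE hE pE]] := diag_phase X0.
have hE1 := mulmx1C hE.
have hXE : (X *m E)^t* *m (X *m E) = 1%:M.
  by rewrite adjM mulmxA -[_ *m X]mulmxA hX mulmx1.
have nE i : cnorm (E i i) <= 2.
  rewrite -[leRHS]mulr1; apply: cnorm_le_sq => //; rewrite expr1n.
  by rewrite -(unitary_col i hE) (bigD1 i) //= lerDl sumr_ge0 // => *; exact: sq_ge0.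
have nXE : nrm (offdiag (X *m E)) <= 2 * nrm (X - 1%:M).
  rewrite nrmE mulr_sumr; apply: ler_sum => i _; rewrite mulr_sumr; apply: ler_sum => j _.
  rewrite offdiag_ij; case: eqVneq => [_|ij].
    by rewrite {1}/cnorm /= normr0 addr0 mulr_ge0 // cnorm_ge0.
  rewrite -dE dg_mulr addE oppE mxE (negPf ij) mulr0n subr0.
  by apply: le_trans (cnormM _ _) _; rewrite mulrC ler_wpM2r ?cnorm_ge0.
have small : nrm (offdiag (X *m E)) < e.
  apply: le_lt_trans nXE _; have := le_lt_trans nX near2; lra.
have hcX : critical ((X *m E)^t* *m (Q^t* *m A *m Q) *m (X *m E)).
  have -> : (X *m E)^t* *m (Q^t* *m A *m Q) *m (X *m E) = E^t* *m (Q'^t* *m A *m Q') *m E.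
    by rewrite QX !adjM !mulmxA.
  exact: critical_conj.
have XE0 := he _ hXE pE small hcX.
have dXE : dg (X *m E) = X *m E.
  by apply/esym/eqP; rewrite -subr_eq0 -offdiagE XE0.
exists X; split=> //.
have -> : X = (X *m E) *m E^t* by rewrite -mulmxA hE1 mulmx1.
move: dXE; move: (X *m E) => Y dY.
apply/matrixP => i j; rewrite dgE; case: eqVneq => [->//|ij].
by rewrite -dY dg_mull -dE dg_adj dgE (negPf ij) mulr0.
Qed.

End Isolation.

(** * Finiteness *)

Section Final.
Context {R : realType} {n : nat}.
Hypothesis n_gt0 : (0 < n)%N.
Local Notation M := 'M[Cplx R]_n.
Implicit Types (X Y Q A B W H E D : M).

Definition second_order A Q : Prop :=
  [/\ Q^t* *m Q = 1%:M, critical (Q^t* *m A *m Q) & psd (Q^t* *m A *m Q)].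

Lemma far_from_zero (x q : R) : x = 0 -> `|x - q| < `|q| -> False.
Proof. by move=> ->; rewrite sub0r normrN ltxx. Qed.

Lemma far_from_nonneg (x q : R) : 0 <= x -> `|x - q| < - q -> False.
Proof. by move=> x0; rewrite ltr_norml => /andP[_ h]; lra. Qed.

(** The three conditions are equalities and weak inequalities between functions
    that are Lipschitz near [Q]. *)
Lemma second_order_closed A Q : ~ second_order A Q ->
  exists2 e : R, 0 < e & forall X, nrm (X - Q) < e -> ~ second_order A X.
Proof.
move=> nQ.
have [hQ|hQ] := pselect (Q^t* *m 1%:M *m Q = 1%:M); last first.
  have d0 : 0 < `|nrm (Q^t* *m 1%:M *m Q - 1%:M)|.
    by rewrite normr_gt0 gt_eqF // nrm_gt0 // subr_eq0; apply/eqP.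
  have [e e0 he] := isOr_continuous (unitary_defect_lip Q) d0.
  exists e; first exact: e0.
  move=> X hX [hX1 _ _]; apply: (far_from_zero _ (he X hX)).
  by rewrite mulmx1 hX1 subrr nrm0.
rewrite mulmx1 in hQ.
have [hc|/existsNP[W /not_implyP[hW hc]]] := pselect (critical (Q^t* *m A *m Q)); last first.
  have d0 : 0 < `|rinner (cm (dg (Q^t* *m A *m Q)) W) (Q^t* *m A *m Q)|.
    by rewrite normr_gt0; apply/eqP.
  have [e e0 he] := isOr_continuous (gradient_lip Q A W) d0.
  exists e; first exact: e0.
  by move=> X hX [_ hX1 _]; exact: far_from_zero (hX1 W hW) (he X hX).
have [hp|/existsNP[W /not_implyP[hW hp]]] := pselect (psd (Q^t* *m A *m Q)).
  by exfalso; apply: nQ.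
have d0 : 0 < - hessform (Q^t* *m A *m Q) W by rewrite oppr_gt0 ltNge; apply/negP.
have [e e0 he] := isOr_continuous (hessform_lip Q A W) d0.
exists e; first exact: e0.
move=> X hX [_ _ hX1]; exact: far_from_nonneg (hX1 W hW) (he X hX).
Qed.

(** Every matrix [Q] has a ball in which all second-order points are equivalent
    to [Q]: by isolation if [Q] is one of them, by closedness otherwise, when
    there are none. *)
Lemma finite_classes A : ~ exceptional A -> exists s : seq M,
  forall X, second_order A X -> exists2 Q, Q \in s &
    exists D, [/\ D^t* *m D = 1%:M, dg D = D & X = Q *m D].
Proof.
move=> nA.
have /choice[e he] Q : exists e : R, 0 < e /\ forall X, nrm (X - Q) < e -> second_order A X ->
    exists D, [/\ D^t* *m D = 1%:M, dg D = D & X = Q *m D].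
  have [[hQ hc hp]|nQ] := pselect (second_order A Q).
    have [_ hpos] := nonexceptional n_gt0 nA hQ hc hp.
    have [e e0 he] := isolated hQ hc hpos.
    exists e; split; first exact: e0.
    by move=> X hX [h1 h2 h3]; exact: he.
  have [e e0 he] := second_order_closed nQ.
  exists e; split; first exact: e0.
  by move=> X hX h; have := he X hX h.
have [s hs] := finite_ball_cover (@ubound R n) (fun Q => (he Q).1).
exists s => X hX; have [hX1 _ _] := hX.
have [Q Qs XQ] := hs X (unitary_nrm hX1).
by exists Q => //; exact: (he Q).2 X XQ hX.
Qed.

Definition to_unitary X (hX : X^t* *m X = 1%:M) : unitary_group R n :=
  exist _ X (mem_set (unitary_KV hX)).

Lemma local_min_second_order A (Q : unitary_group R n) :
  local_minimizer (flag_fun (fA A)) (flag_class Q) -> second_order A (mx_of Q).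
Proof.
move=> /local_min_ball[e e0 he]; have hQ := mx_of_KV Q.
have [hc hp] : critical ((mx_of Q)^t* *m A *m mx_of Q) /\ psd ((mx_of Q)^t* *m A *m mx_of Q).
  apply: (second_order_necessary e0 hQ) => P hP near_Q.
  by have := he (to_unitary hP) near_Q; rewrite !flag_fun_fA.
by split.
Qed.

Lemma finite_local_min A : ~ exceptional A ->
  finite_set [set x : flag R n | local_minimizer (flag_fun (fA A)) x].
Proof.
move=> nA; have [s hs] := finite_classes nA.
have one : (1%:M : M)^t* *m 1%:M = 1%:M by rewrite adj1 mul1mx.
(* An entry Q of the finite list need not be unitary, so its class
   is chosen among the classes of the unitary matrices equivalent to it. *)
have /choice[g hg] Q : exists x : flag R n, forall P : unitary_group R n,
    (exists D, [/\ D^t* *m D = 1%:M, dg D = D & mx_of P = Q *m D]) -> flag_class P = x.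
  have [[P0 [D0 [hD0 dD0 e0]]]|h] := pselect (exists P0 : unitary_group R n,
      exists D, [/\ D^t* *m D = 1%:M, dg D = D & mx_of P0 = Q *m D]); last first.
    by exists (flag_class (to_unitary one)) => P hP; exfalso; apply: h; exists P.
  exists (flag_class P0) => P [D [hD dD e]].
  apply/eqmodP => /=; rewrite flag_rel_sym; apply/asboolP.
  exists (D0^t* *m D); last by rewrite e e0 mulmxA -(mulmxA Q) (mulmx1C hD0) mulmx1.
  split.
    apply: unitary_KV.
    by rewrite adjM trmxCK mulmxA -[_ *m D0 *m _]mulmxA (mulmx1C hD0) mulmx1.
  by rewrite -dD0 dg_adj -dD; apply: is_diag_mx_mul; exact: diag_mx_is_diag.
apply: (@sub_finite_set _ _ [set g Q | Q in [set` s]]); last exact: finite_image.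
move=> x /= hx; have ex : flag_class (generic_quotient.repr x) = x by exact: reprK.
rewrite -ex in hx; have [Q Qs hD] := hs _ (local_min_second_order hx).
by exists Q => //; rewrite -(hg Q _ hD).
Qed.

End Final.

Theorem theorem3p4 (R : realType) (n : nat) (n_ge1 : (1 <= n)%N) :
  exists J : set 'M[Cplx R]_n,
    lebesgue_null J /\
    forall A : 'M[Cplx R]_n, ~ J A ->
      finite_set [set x : flag R n | local_minimizer (flag_fun (fA A)) x] /\
      forall Q : unitary_group R n,
        local_minimizer (flag_fun (fA A)) (flag_class Q) ->
        (forall i j : 'I_n, i != j ->
           ((mx_of Q)^t* *m A *m mx_of Q) i i !=
           ((mx_of Q)^t* *m A *m mx_of Q) j j) /\
        flag_hess_posdef (fA A) (mx_of Q).
Proof.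
exists exceptional; split; first exact: exceptional_null.
move=> A nA; split; first exact: finite_local_min.
move=> Q /local_min_second_order[hQ hc hp].
have [dist hpos] := nonexceptional n_ge1 nA hQ hc hp.
split=> // xi [W [hW dW ->]] W0.
rewrite flag_hess_fA //; last exact: mx_ofP.
apply: hpos => //.
  by apply/matrixP => i j; rewrite dgE zeroE dW if_same.
by apply: contra_neq W0 => ->; rewrite mulmx0.
Qed.
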